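(* Let $\{X_j\}_{j\ge1}$ be a sequence of independent random elements in $D([0,1];E)$, let $S_n=\sum_{j=1}^n X_j$, and let $Y$ be a random element in $D([0,1];E)$. If $S_n\stackrel{d}{\rightarrow}Y$ in the Skorohod $J_1$-topology, and $Y$ does not have a jump of nonrandom size and location (that is, there are no $t\in[0,1]$ and $c\in E\setminus\{0\}$ with $\mathbb P(\Delta Y(t)=c)=1$), then $S_n$ converges a.s. uniformly on $[0,1]$.
   Context: $(\Omega,\mathcal F,\mathbb P)$ is a complete probability space and $(E,|\cdot|_E)$ is a separable Banach space. $D([0,1];E)$ is the space of c\`adl\`ag functions (right-continuous with left-hand limits) from $[0,1]$ into $E$, equipped with the cylindrical $\sigma$-algebra generated by the evaluations $x\mapsto x(t)$, $t\in[0,1]$; a random element in $D([0,1];E)$ is a random function with values in $D([0,1];E)$ measurable for this $\sigma$-algebra. $\Delta x(t)=x(t)-x(t-)$ is the jump of $x$ at $t$ (with $\Delta x(0)=0$). Uniform convergence is convergence in $\|x\|=\sup_{t\in[0,1]}|x(t)|_E$. The Skorohod $J_1$-topology on $D([0,1];E)$ is determined by the metric $$d(x,y)=\inf_{\lambda\in\Lambda}\max\Bigl\{\sup_{t\in[0,1]}|x(t)-y\circ\lambda(t)|_E,\ \sup_{t\in[0,1]}|\lambda(t)-t|\Bigr\},$$ where $\Lambda$ is the class of strictly increasing continuous mappings of $[0,1]$ onto itself. $\stackrel{d}{\rightarrow}$ denotes convergence in distribution. *)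

(* Defs.v *)
From HB Require Import structures.
From mathcomp Require Import all_boot all_order all_algebra.
From mathcomp Require Import finmap.
From mathcomp Require Import all_classical all_reals all_analysis.

Set Implicit Arguments.
Unset Strict Implicit.
Unset Printing Implicit Defensive.

Import Order.TTheory GRing.Theory Num.Theory.
Import numFieldNormedType.Exports.

Local Open Scope classical_set_scope.
Local Open Scope ring_scope.

Section Skorohod.
Context {R : realType}.

(* A function on [0, 1] is represented by its extension by zero to R, so that
   equality in R -> E is equality on [0, 1].  The value of the extension
   outside of [0, 1] plays no role in the two limit conditions. *)
Definition is_cadlag01 (E : normedModType R) (x : R -> E) : Prop :=
  [/\ forall t : R, 0 <= t < 1 -> x s @[s --> t^'+] --> x t,
      forall t : R, 0 < t <= 1 -> cvg (x s @[s --> t^'-])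
    & forall t : R, t \notin `[0, 1] -> x t = 0].

Definition cadlag01_pred (E : normedModType R) : {pred R -> E} :=
  fun x => `[< is_cadlag01 x >].

Fact cadlag01_zmod_closed (E : normedModType R) :
  zmod_closed (@cadlag01_pred E).
Proof.
split=> [|x y /asboolP[xr xl x0] /asboolP[yr yl y0]]; apply/asboolP.
  by split=> // t _; [exact: cvg_cst|exact: is_cvg_cst].
split=> t tI.
- by apply: cvgB; [exact: xr|exact: yr].
- by apply: is_cvgB; [exact: xl|exact: yl].
- by rewrite !fctE x0// y0// subrr.
Qed.

HB.instance Definition _ (E : normedModType R) :=
  GRing.isZmodClosed.Build (R -> E) (@cadlag01_pred E)
    (cadlag01_zmod_closed E).

Record cadlag01 (E : normedModType R) := Cadlag01 {
  cadlag01_fun :> R -> E ;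
  cadlag01P : cadlag01_fun \in @cadlag01_pred E }.

Section Structures.
Variable E : normedModType R.

HB.instance Definition _ := [isSub for @cadlag01_fun E].
HB.instance Definition _ := [Choice of cadlag01 E by <:].
HB.instance Definition _ := [SubChoice_isSubZmodule of cadlag01 E by <:].
HB.instance Definition _ := isPointed.Build (cadlag01 E) 0.

(* The jump x(t) - x(t-), with the convention that it vanishes at t = 0 *)
Definition jump (x : cadlag01 E) (t : R) : E :=
  if t == 0 then 0 else x t - lim (x s @[s --> t^'-]).

Definition time_change : set (R -> R) :=
  [set l : R -> R | [/\ {within `[0, 1]%classic, continuous l},
                         {in `[0, 1] &, {homo l : s t / s < t}}
                       & l @` `[0, 1]%classic = `[0, 1]%classic]].

Definition J1_dist (x y : cadlag01 E) : \bar R :=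
  ereal_inf
    [set maxe (ereal_sup [set `|x t - y (l t)|%:E | t in `[0, 1]%classic])
              (ereal_sup [set `|l t - t|%:E | t in `[0, 1]%classic])
    | l in time_change].

Definition J1_open (U : set (cadlag01 E)) : Prop :=
  forall x, U x -> exists2 e : R, 0 < e &
    forall y, (J1_dist x y < e%:E)%E -> U y.

Let J1_openT : J1_open setT.
Proof. by move=> x _; exists 1. Qed.

Let J1_openI : setI_closed J1_open.
Proof.
move=> U V oU oV x [/oU[e e0 eU] /oV[f f0 fV]].
exists (Num.min e f); first by rewrite lt_min e0.
by move=> y; rewrite EFin_min lt_min => /andP[/eU ? /fV].
Qed.

Let J1_open_bigU (I : Type) (f : I -> set (cadlag01 E)) :
  (forall i, J1_open (f i)) -> J1_open (\bigcup_i f i).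
Proof.
move=> of_ x [i _ /of_[e e0 ef]]; exists e => // y /ef fy; exists i => //.
Qed.

HB.instance Definition _ := isOpenTopological.Build (cadlag01 E)
  J1_openT J1_openI J1_open_bigU.

Definition cylinders : set (set (cadlag01 E)) :=
  [set A | exists t B, [/\ t \in `[0, 1], (<<s @open E >>) B &
                           A = [set x : cadlag01 E | B (x t)]]].

(* The sigma-algebra of D([0, 1]; E) is the cylindrical one; it is not defined
   as the Borel sigma-algebra of the J1-topology. *)
HB.instance Definition _ := @isMeasurable.Build (sigma_display cylinders)
  (cadlag01 E) (<<s cylinders >>)
  (@sigma_algebra0 _ setT cylinders) (@sigma_algebraC _ cylinders)
  (@sigma_algebra_bigcup _ setT cylinders).

End Structures.
End Skorohod.

Definition separable (T : topologicalType) : Prop :=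
  exists2 A : set T, countable A & dense A.

Section Probability.
Context {R : realType} {d : measure_display} {T : measurableType d}.
Variable P : probability T R.

Definition independent_RVs {d' : measure_display} {U : measurableType d'}
    (X : nat -> {RV P >-> U}) : Prop :=
  forall (J : {fset nat}) (A : nat -> set U),
    (forall j, j \in J -> measurable (A j)) ->
    P (\bigcap_(j in [set` J]) (X j @^-1` A j)) =
    (\prod_(j <- J) P (X j @^-1` A j))%E.

Definition cvg_in_distribution {U : topologicalType}
    (Z : nat -> T -> U) (Y : T -> U) : Prop :=
  forall f : U -> R, continuous f -> bounded_fun f ->
    ('E_P[f \o Z n] @[n --> \oo] --> 'E_P[f \o Y])%E.

End Probability.

(* Main.v *)
(* At times where Y has no fixed jump, evaluation is J1-continuous up to small
   probability.  Suprema over families of arguments stable under time changes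
   give J1-continuous functionals, and through them S_n inherits from Y
   tightness at such times t, and the property that on a short interval a path
   has at most one large jump.  The characters exp(i u f), f a norming
   functional, factor over independent increments, so that S_n(t) is Cauchy in
   probability.

   To control finitely many points at once, cut [0, 1] into short cells [u, v].
   If S_n - S_m is large at a point s of a cell but small at u and v, then each
   of S_m and S_n has its only large jump in the cell, and the increment of S_m
   over the cell is almost equal to (S_n - S_m)(s) up to sign, and independent
   of it.  This increment is either small with a probability bounded below, or
   the cell contains a fixed jump time of Y.  In the second case the jump is not
   constant, so the increment charges two separated balls, one of which is far
   from the prescribed value.  In both cases, with a conditional probability
   bounded below, a contradiction occurs; decoupling along the first such s
   bounds the probability of the event uniformly in the number of points.

   Ottaviani's inequality turns this into almost sure uniform convergence over a
   countable dense set of times, hence over [0, 1]. *)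

Require Import Defs.
From HB Require Import structures.
From mathcomp Require Import all_boot all_order all_algebra.
From mathcomp Require Import finmap.
From mathcomp Require Import all_classical all_reals all_analysis.
From mathcomp Require Import measurable_realfun.
From mathcomp Require Import ring lra.

Set Implicit Arguments.
Unset Strict Implicit.
Unset Printing Implicit Defensive.

Import Order.TTheory GRing.Theory Num.Theory.
Import numFieldNormedType.Exports.

Local Open Scope classical_set_scope.
Local Open Scope ring_scope.

(** * Probability preliminaries *)

Section RealProbability.
Context {R : realType} {d : measure_display} {T : measurableType d}.
Variable P : probability T R.

(** The obstacle is that J1-convergence lets [S n] jump slightly before or after [Y]: tightness and
    closeness of [S m] and [S n] on a grid do not exclude a large difference at times between their
    jumps. There the difference is, up to sign, the jump itself, that is, the increment of [S m]. A
    random quantity almost equal to one independent of it is almost constant, and a nonzero constant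
    jump is what the hypothesis on [Y] forbids. The order of choices is essential: [m] is fixed
    before the finite set of times, [n] after it. So [S n], but not [S m], can be compared with [Y]
    at the individual times; about [S m] only the grid and the absence of two close large jumps are
    used. Ottaviani's inequality fits this order, since it asks for the tails [S n - S k] at a
    single large [n]. *)

Definition pr (A : set T) : R := fine (P A).

Lemma prE A : measurable A -> P A = (pr A)%:E.
Proof. by move=> mA; rewrite /pr fineK// fin_num_measure. Qed.

Lemma pr_ge0 A : 0 <= pr A.
Proof. exact/fine_ge0/measure_ge0. Qed.

Lemma le_pr A B : measurable A -> measurable B -> A `<=` B -> pr A <= pr B.
Proof.
by move=> mA mB AB; rewrite -lee_fin -!prE//; apply: le_measure; rewrite ?inE.
Qed.

Lemma prT : pr setT = 1.
Proof. by rewrite /pr probability_setT. Qed.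

Lemma pr0 : pr set0 = 0.
Proof. by rewrite /pr measure0. Qed.

Lemma pr_le1 A : measurable A -> pr A <= 1.
Proof. by move=> mA; rewrite -prT; apply: le_pr. Qed.

Lemma prU_le A B : measurable A -> measurable B ->
  pr (A `|` B) <= pr A + pr B.
Proof.
move=> mA mB; rewrite -lee_fin EFinD -!prE//; last exact: measurableU.
exact: measureU2.
Qed.

Lemma prC A : measurable A -> pr (~` A) = 1 - pr A.
Proof.
move=> mA; apply: EFin_inj; rewrite -prE; last exact: measurableC.
by rewrite probability_setC// prE.
Qed.

Lemma prDI A B : measurable A -> measurable B ->
  pr A = pr (A `&` B) + pr (A `\` B).
Proof.
move=> mA mB; apply: EFin_inj; rewrite EFinD -!prE//.
- by rewrite addeC; exact: measureDI.
- exact: measurableD.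
- exact: measurableI.
Qed.

Lemma pr_cover A B C : measurable A -> measurable B -> measurable C ->
  A `<=` B `|` C -> pr A <= pr B + pr C.
Proof.
move=> mA mB mC AB; apply: le_trans (prU_le mB mC).
by apply: le_pr => //; exact: measurableU.
Qed.

Lemma pr_cover3 A B C D : measurable A -> measurable B -> measurable C ->
  measurable D -> A `<=` B `|` C `|` D -> pr A <= pr B + pr C + pr D.
Proof.
move=> mA mB mC mD AB; apply: le_trans (pr_cover _ (measurableU _ _ mB mC) _ AB) _ => //.
by rewrite lerD2r; exact: prU_le.
Qed.

(** Continuity from above, in the form that replaces a threshold depending on the path by a
    deterministic one at the price of an event of small probability. *)
Lemma pr_nonincreasing_lt (A : (set T)^nat) (e : R) :
  (forall k, measurable (A k)) -> nonincreasing_seq A ->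
  pr (\bigcap_k A k) < e -> exists k, pr (A k) < e.
Proof.
move=> mA ndA capA.
have mI : measurable (\bigcap_k A k) by exact: bigcap_measurable.
have P0 : (P (A 0%N) < +oo)%E by rewrite prE// ltry.
have : (P \o A) k @[k --> \oo] --> (pr (\bigcap_k A k))%:E.
  by rewrite -prE//; exact: nonincreasing_cvg_mu.
move=> /fine_cvg /cvgr_lt /(_ _ capA) [k _ /(_ k (leqnn k))] Ak.
by exists k.
Qed.

Lemma pr_nondecreasing_le (A : (set T)^nat) (e : R) :
  (forall k, measurable (A k)) -> nondecreasing_seq A ->
  (forall k, pr (A k) <= e) -> pr (\bigcup_k A k) <= e.
Proof.
move=> mA ndA Ae; rewrite leNgt; apply/negP => eA.
have mU : measurable (\bigcup_k A k) by exact: bigcup_measurable.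
have [] := @pr_nonincreasing_lt (fun k => ~` A k) (1 - e).
- by move=> k; exact: measurableC.
- by move=> m n mn; apply/subsetPset/subsetC/subsetPset/ndA.
- by rewrite -setC_bigcup prC//; lra.
- by move=> k; rewrite prC//; have := Ae k; lra.
Qed.

Lemma pr_bigcup_eq0 (A : (set T)^nat) : (forall k, measurable (A k)) ->
  (forall k, pr (A k) = 0) -> pr (\bigcup_k A k) = 0.
Proof.
move=> mA A0; apply/le_anti; rewrite pr_ge0 andbT.
rewrite -lee_fin -prE; last exact: bigcup_measurable.
apply: le_trans (measure_sigma_subadditive _ mA _ (@subset_refl _ _)) _ => //.
  exact: bigcup_measurable.
have PA0 k : P (A k) = 0%E by rewrite prE// A0.
by rewrite eseries0// => k _ _; exact: PA0.
Qed.

(** The disjoint sets [seqDU A k] record the first index at which some [A k] occurs, and each keeps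
    at least the fraction [c] of its mass after intersection with [C k]. It serves in both
    directions of time: [A k] in the future and [C k] in the past, and conversely for Ottaviani's
    inequality. *)
Lemma decoupling (A C : (set T)^nat) (Z : set T) (c : R) :
  (forall k, measurable (A k)) -> (forall k, measurable (C k)) ->
  measurable Z -> 0 <= c -> (forall k, A k `&` C k `<=` Z) ->
  (forall k, c * pr (seqDU A k) <= pr (seqDU A k `&` C k)) ->
  c * pr (\bigcup_k A k) <= pr Z.
Proof.
move=> mA mC mZ c0 ACZ cAC.
have mD k : measurable (seqDU A k) by exact: seqDU_measurable.
have mDC k : measurable (seqDU A k `&` C k) by exact: measurableI.
rewrite -lee_fin EFinM -!prE//; last exact: bigcup_measurable.
have tD := @trivIset_seqDU _ A.
have tDC : trivIset setT (fun k => seqDU A k `&` C k) by exact: trivIset_setIr.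
rewrite seqDU_bigcup_eq (measure_bigcup P _ _ (fun k _ => mD k) tD).
apply: (@le_trans _ _ (P (\bigcup_k (seqDU A k `&` C k)))); last first.
  apply: le_measure; rewrite ?inE//; first exact: bigcup_measurable.
  move=> w [k _ [Aw Cw]]; apply: (ACZ k); split=> //.
  exact: subset_seqDU Aw.
rewrite (measure_bigcup P _ _ (fun k _ => mDC k) tDC) -nneseriesZl//.
apply: lee_nneseries => [k _ _|k _].
  by rewrite mule_ge0// lee_fin.
by have := cAC k; rewrite -lee_fin EFinM -!prE.
Qed.

End RealProbability.

Section VectorMeasurability.
Context {R : realType} {E : normedModType R}.

Lemma separable_seq : separable E ->
  exists q : nat -> E, forall x e, 0 < e -> exists i, `|x - q i| < e.
Proof.
move=> [A /pcard_surjP[q qA] dA]; exists q => x e e0.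
have [|y [xy Ay]] := dA (ball x e) _ (ball_open x e).
  by exists x; exact: ballxx.
by have [i _ qi] := qA _ Ay; exists i; rewrite qi -ball_normE in xy *.
Qed.

(** Measurability is expressed through distances to points, without a sigma-algebra on [E];
    separability makes the class stable under sums and gives measurability of Lipschitz functions of
    its members. *)
Definition vmeasurable d (M : measurableType d) (f : M -> E) :=
  forall a, measurable_fun setT (fun w => `|f w - a|).

Section Separable.
Hypothesis sepE : separable E.
Context {d : measure_display} {M : measurableType d}.
Implicit Types f g : M -> E.

(* A Lipschitz function is an infimum of cones centred on a dense set. *)
Lemma measurable_lipschitz2 (h : E -> E -> R) (C : R) f g :
  (forall x y x' y', `|h x y - h x' y'| <= C * (`|x - x'| + `|y - y'|)) ->
  vmeasurable f -> vmeasurable g ->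
  measurable_fun setT (fun w => h (f w) (g w)).
Proof.
move=> hC mf mg; have [q qE] := separable_seq sepE.
apply: (measurability _ (RGenInftyO.measurableE R)) => //.
move=> _ [_ [r ->] <-]; rewrite setTI.
pose k i j := fun w => h (q i) (q j) + C * (`|f w - q i| + `|g w - q j|).
have -> : (fun w => h (f w) (g w)) @^-1` `]-oo, r[%classic =
    \bigcup_i \bigcup_j (k i j @^-1` `]-oo, r[%classic).
  apply/seteqP; split => w /=; rewrite ?in_itv/=.
    move=> hr; pose e := (r - h (f w) (g w)) / (4 * (`|C| + 1)).
    have e0 : 0 < e.
      by rewrite divr_gt0 ?subr_gt0// mulr_gt0// ltr_wpDl.
    have [i fi] := qE (f w) _ e0; have [j gj] := qE (g w) _ e0.
    exists i => //; exists j => //; rewrite /= in_itv/= /k.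
    have := hC (f w) (g w) (q i) (q j).
    set s := `|_| + `|_| in fi gj *.
    have s0 : 0 <= s by rewrite addr_ge0.
    have se : s < 2 * e by rewrite /s; lra.
    have Cs : C * s <= `|C| * s by rewrite ler_wpM2r// ler_norm.
    have : (`|C| + 1) * s < (`|C| + 1) * (2 * e).
      by rewrite ltr_pM2l// ltr_wpDl.
    have -> : (`|C| + 1) * (2 * e) = (r - h (f w) (g w)) / 2.
      by rewrite /e; field; rewrite gt_eqF// ltr_wpDl.
    by rewrite ler_norml mulrDl mul1r => ? /andP[? ?]; lra.
  move=> [i _ [j _ ]]; rewrite /= in_itv/= /k; apply: le_lt_trans.
  by have := hC (f w) (g w) (q i) (q j); rewrite ler_norml => /andP[? ?]; lra.
apply: bigcup_measurable => i _; apply: bigcup_measurable => j _.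
rewrite -[X in measurable X]setTI.
have mk : measurable_fun setT (k i j).
  apply: measurable_funD => //; apply: measurable_funM => //.
  exact: measurable_funD.
by apply: mk => //; exact: measurable_itv.
Qed.

Lemma measurable_lipschitz (h : E -> R) (C : R) f :
  (forall x y, `|h x - h y| <= C * `|x - y|) -> vmeasurable f ->
  measurable_fun setT (fun w => h (f w)).
Proof.
move=> hC mf; apply: (@measurable_lipschitz2 (fun x _ => h x) `|C| f f) => //.
move=> x y x' y'; apply: le_trans (hC _ _) _.
apply: (@le_trans _ _ (`|C| * `|x - x'|)).
  by rewrite ler_wpM2r// ler_norm.
by rewrite ler_wpM2l// lerDl.
Qed.

Lemma vmeasurableD f g : vmeasurable f -> vmeasurable g ->
  vmeasurable (fun w => f w + g w).
Proof.
move=> mf mg a.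
apply: (@measurable_lipschitz2 (fun x y => `|x + y - a|) 1 f g) => //.
move=> x y x' y'; rewrite mul1r; apply: le_trans (ler_dist_dist _ _) _.
rewrite [leLHS](_ : _ = `|(x - x') + (y - y')|) ?ler_normD//.
by congr `|_|; rewrite opprB addrA addrNK opprD addrACA.
Qed.

Lemma vmeasurableN f : vmeasurable f -> vmeasurable (fun w => - f w).
Proof.
move=> mf a; have -> : (fun w => `|- f w - a|) = fun w => `|f w - - a|.
  by apply/funext => w; rewrite -opprD normrN opprK.
exact: mf.
Qed.

Lemma vmeasurableB f g : vmeasurable f -> vmeasurable g ->
  vmeasurable (fun w => f w - g w).
Proof. by move=> mf mg; apply: vmeasurableD => //; exact: vmeasurableN. Qed.

Lemma vmeasurable_cst (c : E) : vmeasurable (fun _ : M => c).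
Proof. by move=> a; exact: measurable_cst. Qed.

Lemma vmeasurable_norm f : vmeasurable f -> measurable_fun setT (fun w => `|f w|).
Proof.
by move=> /(_ 0); under eq_fun do rewrite subr0.
Qed.

Lemma vmeasurable_sum (I : eqType) (s : seq I) (F : I -> M -> E) :
  (forall i, i \in s -> vmeasurable (F i)) ->
  vmeasurable (fun w => \sum_(i <- s) F i w).
Proof.
elim: s => [|i s ih] mF.
  by under eq_fun do rewrite big_nil; exact: vmeasurable_cst.
under eq_fun do rewrite big_cons; apply: vmeasurableD.
  by apply: mF; rewrite mem_head.
by apply: ih => j js; apply: mF; rewrite inE js orbT.
Qed.

End Separable.

Lemma vmeasurable_borel d (M : measurableType d) (f : M -> E) :
  (forall U, open U -> measurable (f @^-1` U)) -> vmeasurable f.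
Proof.
move=> mf a; apply: (measurability _ (RGenInftyO.measurableE R)) => //.
move=> _ [_ [r ->] <-]; rewrite setTI.
rewrite [X in measurable X](_ : _ = f @^-1` [set x | `|x - a| < r]).
  apply: mf; have -> : [set x | `|x - a| < r] = (fun x => `|x - a|) @^-1` [set z | z < r] by [].
  apply: open_comp; last exact: open_lt.
  move=> x _; apply: cvg_norm; apply: cvgB; [exact: cvg_id|exact: cvg_cst].
by apply/seteqP; split => w /=; rewrite in_itv.
Qed.

End VectorMeasurability.

Section Independence.
Context {R : realType} {d : measure_display} {T : measurableType d}.
Variable P : probability T R.

(** Dynkin's argument with [b] frozen: the sets satisfying the product formula form a Dynkin class
    containing the pi-system [G]. *)
Lemma independent_generated_l (G : set (set T)) (b : set T) :
  setI_closed G -> G `<=` measurable -> measurable b ->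
  (forall a, G a -> P (a `&` b) = P a * P b)%E ->
  forall a, <<s G >> a -> measurable a /\ (P (a `&` b) = P a * P b)%E.
Proof.
move=> GI mG mb Gb a; rewrite -setI_closed_g_dynkin_g_sigma_algebra// => Ga.
apply: (Ga [set a | measurable a /\ (P (a `&` b) = P a * P b)%E]); split.
  split.
  - by split; rewrite ?setTI ?probability_setT ?mul1e//; exact: measurableT.
  - move=> A [mA AE]; split; first exact: measurableC.
    have mAb := measurableI _ _ mA mb.
    have mCb := measurableI _ _ (measurableC mA) mb.
    rewrite (prE P (measurableC mA)) (prE P mCb) (prE P mb) prC//.
    move: AE; rewrite (prE P mA) (prE P mAb) (prE P mb) -!EFinM => -[AE].
    congr EFin; have := prDI P mb mA.
    by rewrite setDE !(setIC b) AE => E1; lra.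
  - move=> F tF FE; have mF k := (FE k).1.
    split; first exact: bigcup_measurable.
    rewrite setI_bigcupl (measure_bigcup P _ _ (fun k _ => mF k) tF).
    rewrite (measure_bigcup P _ _ (fun k _ => measurableI _ _ (mF k) mb));
      last exact: trivIset_setIr.
    rewrite (prE P mb) muleC -nneseriesZl//; apply: eq_eseriesr => k _.
    by rewrite muleC -(prE P mb); exact: (FE k).2.
by move=> A GA; split; [exact: mG|exact: Gb].
Qed.

Lemma independent_generated (G1 G2 : set (set T)) :
  setI_closed G1 -> setI_closed G2 ->
  G1 `<=` measurable -> G2 `<=` measurable ->
  (forall a b, G1 a -> G2 b -> P (a `&` b) = P a * P b)%E ->
  forall a b, <<s G1 >> a -> <<s G2 >> b -> P (a `&` b) = (P a * P b)%E.
Proof.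
move=> I1 I2 m1 m2 G12 a b Ga Gb.
(* Against the whole space the product formula is trivial; only the measurability of [b] is
   extracted. *)
have [mb _] := independent_generated_l I2 m2 measurableT
  (fun a _ => ltac:(by rewrite setIT probability_setT mule1)) Gb.
apply: (independent_generated_l I1 m1 mb _ Ga).2 => a' Ga'.
rewrite setIC muleC.
by apply: (independent_generated_l I2 m2 (m1 _ Ga') _ Gb).2 => b' Gb';
  rewrite setIC muleC; exact: G12.
Qed.

Context {d' : measure_display} {U : measurableType d'}.
Variable X : nat -> {RV P >-> U}.

(* The pi-system of finite intersections generating sigma(X_j, j in I) *)
Definition rectangles (I : set nat) : set (set T) :=
  [set B | exists (J : {fset nat}) (A : nat -> set U),
     [/\ forall j, j \in J -> I j, forall j, measurable (A j) &
         B = \bigcap_(j in [set` J]) (X j @^-1` A j)]].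

Lemma rectangles_setI I : setI_closed (rectangles I).
Proof.
move=> _ _ [J1 [A1 [JI1 mA1 ->]]] [J2 [A2 [JI2 mA2 ->]]].
exists (J1 `|` J2)%fset, (fun j => (if j \in J1 then A1 j else setT) `&`
                                  (if j \in J2 then A2 j else setT)).
split.
- by move=> j; rewrite inE => /orP[/JI1|/JI2].
- by move=> j; apply: measurableI; case: ifP.
- apply/seteqP; split => w /=.
    move=> [w1 w2] j /= _; split.
      by case: ifPn => // /w1.
    by case: ifPn => // /w2.
  move=> w12; split=> j /= jJ.
    by have := w12 j; rewrite /= inE jJ => /(_ isT)[].
  by have := w12 j; rewrite /= inE jJ orbT => /(_ isT)[].
Qed.

Lemma rectangles_measurable I : rectangles I `<=` measurable.
Proof.
move=> _ [J [A [_ mA ->]]]; apply: bigcap_measurableType => j _.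
by rewrite -[X in measurable X]setTI; exact: measurable_funP.
Qed.

Lemma rectangles_indep I1 I2 : I1 `&` I2 = set0 -> independent_RVs X ->
  forall a b, rectangles I1 a -> rectangles I2 b ->
    P (a `&` b) = (P a * P b)%E.
Proof.
move=> I12 Xi _ _ [J1 [A1 [JI1 mA1 ->]]] [J2 [A2 [JI2 mA2 ->]]].
have dJ j : j \in J1 -> j \in J2 -> False.
  by move=> /JI1 ? /JI2 ?; have : (I1 `&` I2) j by []; rewrite I12.
pose A j := if j \in J1 then A1 j else A2 j.
have -> : \bigcap_(j in [set` J1]) X j @^-1` A1 j `&`
    \bigcap_(j in [set` J2]) X j @^-1` A2 j =
    \bigcap_(j in [set` (J1 `|` J2)%fset]) X j @^-1` A j.
  apply/seteqP; split => w /=.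
    move=> [w1 w2] j /=; rewrite inE /A; case: ifPn => [jJ _|jJ /= jJ2].
      exact: w1.
    exact: w2.
  move=> w12; split=> j /= jJ.
    by have := w12 j; rewrite /= inE jJ /A jJ => /(_ isT).
  have := w12 j; rewrite /= inE jJ orbT /A => /(_ isT).
  by case: ifPn => // jJ1; case: (dJ j).
rewrite !Xi//; last by move=> j _; rewrite /A; case: ifP.
rewrite (big_fsetID _ (mem J1))/=.
have -> : [fset j | j in (J1 `|` J2)%fset & j \in J1]%fset = J1.
  by apply/fsetP => j; rewrite !inE /=; case: (j \in J1); rewrite ?andbF.
have -> : [fset j | j in (J1 `|` J2)%fset & j \notin J1]%fset = J2.
  apply/fsetP => j; rewrite !inE /=; case: (boolP (j \in J1)) => //= jJ1.
    by apply/esym/negP => jJ2; apply: (dJ j).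
  by rewrite andbT.
congr (_ * _)%E; rewrite big_seq_cond [RHS]big_seq_cond; apply: eq_bigr => j /andP[jJ _].
  by rewrite /A jJ.
by rewrite /A; case: ifPn => // jJ1; case: (dJ j).
Qed.

Lemma rectangles_sigma_measurable I A : <<s rectangles I >> A -> measurable A.
Proof.
move=> GA; apply: (GA measurable); split; last exact: rectangles_measurable.
exact: sigma_algebra_measurable.
Qed.

Lemma sigma_indep I1 I2 a b : I1 `&` I2 = set0 -> independent_RVs X ->
  <<s rectangles I1 >> a -> <<s rectangles I2 >> b ->
  pr P (a `&` b) = pr P a * pr P b.
Proof.
move=> I12 Xi Ga Gb; rewrite /pr.
rewrite (independent_generated (@rectangles_setI I1) (@rectangles_setI I2)
  (@rectangles_measurable I1) (@rectangles_measurable I2) _ Ga Gb).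
  rewrite fineM// fin_num_measure//.
    exact: rectangles_sigma_measurable Ga.
  exact: rectangles_sigma_measurable Gb.
exact: rectangles_indep.
Qed.

End Independence.

(** * Norming functionals *)

Section NormingFunctional.
Context {R : realType} {E : normedModType R}.

Definition sublinear (p : E -> R) :=
  (forall x y, p (x + y) <= p x + p y) /\
  (forall (c : R) x, 0 < c -> p (c *: x) = c * p x).

Lemma sublinear_norm : sublinear (fun x => `|x|).
Proof.
split=> [x y|c x c0]; first exact: ler_normD.
by rewrite normrZ gtr0_norm.
Qed.

Lemma sublinear0 p : sublinear p -> p 0 = 0.
Proof.
move=> [_ /(_ 2 0 (ltr0Sn _ _))]; rewrite scaler0; lra.
Qed.

Lemma sublinearN p x : sublinear p -> - p (- x) <= p x.
Proof.
move=> ps; have := ps.1 x (- x); rewrite subrr sublinear0//; lra.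
Qed.

(* Lowers the sublinear functional [p] so that it becomes linear along [y]. *)
Definition descent (p : E -> R) (y x : E) : R :=
  inf [set p (x + t *: y) - t * p y | t in [set t : R | 0 <= t]].

Section Descent.
Variables (p : E -> R) (y : E).
Hypothesis ps : sublinear p.

Lemma descent_has_inf x :
  has_inf [set p (x + t *: y) - t * p y | t in [set t : R | 0 <= t]].
Proof.
split; first by exists (p (x + 0 *: y) - 0 * p y); exists 0 => /=.
exists (- p (- x)) => _ [t /= t0 <-].
have : t * p y <= p (x + t *: y) + p (- x).
  have -> : t * p y = p (t *: y).
    move: t0; rewrite le_eqVlt => /predU1P[<-|t0]; last by rewrite ps.2.
    by rewrite mul0r scale0r sublinear0.
  by rewrite -[in leLHS](addKr x (t *: y)) addrC; exact: ps.1.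
by lra.
Qed.

Lemma descent_le x t : 0 <= t -> descent p y x <= p (x + t *: y) - t * p y.
Proof.
by move=> t0; apply: ge_inf; [exact: (descent_has_inf x).2|exists t].
Qed.

Lemma le_descent x c : (forall t, 0 <= t -> c <= p (x + t *: y) - t * p y) ->
  c <= descent p y x.
Proof.
move=> cp; apply: lb_le_inf; first exact: (descent_has_inf x).1.
by move=> _ [t t0 <-]; exact: cp.
Qed.

Lemma descent_sublinear : sublinear (descent p y).
Proof.
have hom c x : 0 < c -> descent p y (c *: x) <= c * descent p y x.
  move=> c0; rewrite -ler_pdivrMl//; apply: le_descent => t t0.
  rewrite ler_pdivrMl// mulrBr -ps.2// scalerDr scalerA mulrA.
  by apply: descent_le; rewrite mulr_ge0// ltW.
split=> [x x'|c x c0].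
  rewrite -lerBlDr; apply: le_descent => t t0.
  rewrite lerBlDr -lerBlDl; apply: le_descent => s s0.
  apply: (@le_trans _ _ (p (x + x' + (t + s) *: y) - (t + s) * p y - (p (x + t *: y) - t * p y))).
    by rewrite lerD2r; apply: descent_le; rewrite addr_ge0.
  by have := ps.1 (x + t *: y) (x' + s *: y); rewrite scalerDl addrACA; lra.
apply/le_anti; rewrite hom//=.
have := hom c^-1 (c *: x); rewrite invr_gt0 => /(_ c0).
by rewrite scalerA mulVf ?gt_eqF// scale1r ler_pdivlMl.
Qed.

Lemma descent_le_id x : descent p y x <= p x.
Proof. by have := @descent_le x 0 (lexx _); rewrite scale0r addr0 mul0r subr0. Qed.

Lemma descentN : descent p y (- y) <= - p y.
Proof.
have := @descent_le (- y) 1 ler01.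
by rewrite scale1r addNr sublinear0// mul1r sub0r.
Qed.

End Descent.

(** Zorn's lemma for the reversed pointwise order. The infimum along a chain is finite because every
    member satisfies [p x >= - N (- x)], and it is subadditive because, of two members of the chain,
    the smaller one serves for both arguments. *)
Lemma minimal_sublinear_below N : sublinear N -> exists2 p, sublinear p &
  (forall x, p x <= N x) /\
  forall q, sublinear q -> (forall x, q x <= p x) -> q = p.
Proof.
move=> Ns.
pose S := {p : E -> R | sublinear p /\ forall x, p x <= N x}.
pose le (p q : S) := `[< forall x, sval q x <= sval p x >].
have [||||p pmin] := @Zorn S le.
- by move=> p; apply/asboolP.
- move=> p q r /asboolP pq /asboolP qr; apply/asboolP => x.
  exact: le_trans (qr x) (pq x).
- move=> p q /asboolP pq /asboolP qp.
  apply: eq_sig_hprop => [? ? ?|]; first exact: Prop_irrelevance.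
  apply/funext => x; apply/le_anti.
  by rewrite pq qp.
- move=> A totA; have [[p0 Ap0]|A0] := pselect (A !=set0); last first.
    have Nb : sublinear N /\ forall x, N x <= N x by [].
    exists (exist _ N Nb) => s As; exfalso; apply: A0; by exists s.
  pose V x := [set sval p x | p in A].
  have Vinf x : has_inf (V x).
    split; first by exists (sval p0 x), p0.
    exists (- N (- x)) => _ [p Ap <-]; have [ps pN] := svalP p.
    by apply: le_trans _ (sublinearN x ps); rewrite lerN2.
  have Vle x p : A p -> inf (V x) <= sval p x.
    by move=> Ap; apply: ge_inf; [exact: (Vinf x).2|exists p].
  have leV x c : (forall p, A p -> c <= sval p x) -> c <= inf (V x).
    move=> cA; apply: lb_le_inf; first exact: (Vinf x).1.
    by move=> _ [p Ap <-]; exact: cA.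
  have Vs : sublinear (fun x => inf (V x)) /\ forall x, inf (V x) <= N x.
    split; last by move=> x; apply: le_trans (Vle _ _ Ap0) ((svalP p0).2 x).
    have hom c x : 0 < c -> inf (V (c *: x)) <= c * inf (V x).
      move=> c0; rewrite -ler_pdivrMl//; apply: (leV) => p Ap.
      by rewrite ler_pdivrMl// -(svalP p).1.2//; exact: Vle.
    split=> [x y|c x c0].
      rewrite -lerBlDr; apply: (leV) => p Ap.
      rewrite lerBlDr -lerBlDl; apply: (leV) => q Aq; rewrite lerBlDl.
      have [/asboolP pq|/asboolP qp] := totA p q Ap Aq.
        apply: le_trans (Vle _ _ Aq) _; apply: le_trans ((svalP q).1.1 x y) _.
        by have := pq x; lra.
      apply: le_trans (Vle _ _ Ap) _; apply: le_trans ((svalP p).1.1 x y) _.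
      by have := qp y; lra.
    apply/le_anti; rewrite hom//=.
    have := hom c^-1 (c *: x); rewrite invr_gt0 => /(_ c0).
    by rewrite scalerA mulVf ?gt_eqF// scale1r ler_pdivlMl.
  have [v vE] : exists v : S, sval v = fun x => inf (V x).
    by exists (exist (fun p => sublinear p /\ forall x, p x <= N x) _ Vs).
  exists v => p Ap; rewrite /le vE; apply/asboolP => x; exact: Vle.
exists (sval p); first exact: (svalP p).1.
split; first exact: (svalP p).2.
move=> q qs qp.
have qN : sublinear q /\ forall x, q x <= N x.
  by split=> // x; apply: le_trans (qp x) ((svalP p).2 x).
by have /(_ (asboolT qp))/(congr1 sval) := pmin (exist _ q qN).
Qed.

(** A form of Hahn-Banach: minimality forces [descent p y = p] for every [y], hence
    [p x + p y <= p (x + y)], so a minimal sublinear functional is additive. Starting below the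
    descent of the norm along [b] gives [p (- b) <= - |b|], which makes [p] norming at [b]. *)
Lemma norming_functional (b : E) : exists f : E -> R,
  [/\ forall x y, f (x + y) = f x + f y, forall x, `|f x| <= `|x| &
      f b = `|b|].
Proof.
have Ns := descent_sublinear b sublinear_norm.
have [p ps [pN pmin]] := minimal_sublinear_below Ns.
have padd x y : p (x + y) = p x + p y.
  apply/le_anti; rewrite ps.1/=.
  have <- : descent p y x = p x.
    rewrite (pmin (descent p y))//; first exact: descent_sublinear.
    exact: descent_le_id.
  by have := descent_le y ps x ler01; rewrite scale1r mul1r; lra.
have pN1 x : p x <= `|x|.
  by apply: le_trans (pN x) _; exact: (descent_le_id b sublinear_norm).
have pNx x : p (- x) = - p x.
  by have := padd x (- x); rewrite subrr sublinear0//; lra.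
exists p; split=> //.
  by move=> x; rewrite ler_norml pN1 andbT -normrN; have := pN1 (- x); rewrite pNx; lra.
apply/le_anti; rewrite pN1/=.
have := le_trans (pN (- b)) (descentN b sublinear_norm); rewrite pNx; lra.
Qed.

End NormingFunctional.

(** * J1-continuous functionals *)

Section TimeChange.
Context {R : realType}.
Variable l : R -> R.
Hypothesis tl : @time_change R l.

Lemma time_change_in t : t \in `[0, 1] -> l t \in `[0, 1].
Proof.
case: tl => _ _ lI tI; have : (l @` `[0, 1]%classic) (l t) by exists t.
by rewrite lI.
Qed.

Lemma time_change_surj t : t \in `[0, 1] -> exists2 s, s \in `[0, 1] & l s = t.
Proof.
case: tl => _ _ lI tI; have : `[0, 1]%classic t by [].
by rewrite -lI => -[s sI <-]; exists s.
Qed.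

Lemma time_change_le s t : s \in `[0, 1] -> t \in `[0, 1] ->
  (l s <= l t) = (s <= t).
Proof.
case: tl => _ li _ sI tI; apply/idP/idP => [|st].
  by apply: contraTT; rewrite -!ltNge => ts; exact: li.
by move: st; rewrite le_eqVlt => /predU1P[->//|st]; apply/ltW/li.
Qed.

Lemma time_change1 : l 1 = 1.
Proof.
have I1 : (1 : R) \in `[0, 1] by rewrite in_itv/= ler01 lexx.
have [s sI ls] := time_change_surj I1; apply/le_anti.
have := time_change_in I1; rewrite in_itv/= => /andP[_ ->]/=.
rewrite -[leLHS]ls time_change_le//.
by move: sI; rewrite in_itv/= => /andP[].
Qed.

End TimeChange.

Lemma J1_dist_lt (R : realType) (E : normedModType R) (x y : cadlag01 E) (e : R) :
  (J1_dist x y < e%:E)%E -> exists2 l, time_change l &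
    forall t, t \in `[0, 1] -> `|x t - y (l t)| <= e /\ `|l t - t| <= e.
Proof.
move=> /ereal_inf_lt[_ [l tl <-]]; rewrite gt_max => /andP[d1 d2].
exists l => // t tI; split; rewrite -lee_fin ltW//.
  by apply: le_lt_trans d1; apply: ereal_sup_ubound; exists t.
by apply: le_lt_trans d2; apply: ereal_sup_ubound; exists t.
Qed.

Section J1Functional.
Context {R : realType} {E : normedModType R} {J : Type}.
Variables (K : set (J -> R)) (Phi : (J -> R) -> (J -> E) -> R) (C : R).
Hypothesis K01 : forall s, K s -> forall j, s j \in `[0, 1].
Hypothesis K0 : K !=set0.
Hypothesis K_time_change : forall l s, time_change l -> K s -> K (l \o s).
Hypothesis K_inv : forall l s, time_change l -> K s ->
  exists2 s', K s' & s = l \o s'.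
Hypothesis Phi01 : forall s x, 0 <= Phi s x <= 1.
Hypothesis Phi_lipschitz : forall (g : R) s s' x x',
  (forall j, `|s j - s' j| <= g) -> (forall j, `|x j - x' j| <= g) ->
  `|Phi s x - Phi s' x'| <= C * g.

Definition sup_functional (x : cadlag01 E) : R :=
  sup [set Phi s (x \o s) | s in K].

Let has_sup_functional (x : cadlag01 E) :
  has_sup [set Phi s (x \o s) | s in K].
Proof.
split; first by have [s Ks] := K0; exists (Phi s (x \o s)), s.
by exists 1 => _ [s _ <-]; have /andP[] := Phi01 s (x \o s).
Qed.

Lemma sup_functional_ge (x : cadlag01 E) s : K s -> Phi s (x \o s) <= sup_functional x.
Proof.
by move=> Ks; apply: ub_le_sup; [exact: (has_sup_functional x).2|exists s].
Qed.

Lemma sup_functional_le (x : cadlag01 E) c : (forall s, K s -> Phi s (x \o s) <= c) ->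
  sup_functional x <= c.
Proof.
move=> xc; apply: ge_sup; first exact: (has_sup_functional x).1.
by move=> _ [s Ks <-]; exact: xc.
Qed.

Lemma sup_functional01 (x : cadlag01 E) : 0 <= sup_functional x <= 1.
Proof.
have [s Ks] := K0; apply/andP; split.
  by apply: le_trans (sup_functional_ge x Ks); have /andP[] := Phi01 s (x \o s).
by apply: sup_functional_le => s' _; have /andP[] := Phi01 s' (x \o s').
Qed.

(** Let [l] be a time change showing that the distance is less than [e]. Sampling [x] along [s] and
    [y] along [l \o s] changes both the times and the values by at most [e]; the two stability
    properties of [K] match the samples of [x] with those of [y] in both directions. *)
Lemma sup_functional_lipschitz (x y : cadlag01 E) (e : R) : (J1_dist x y < e%:E)%E ->
  `|sup_functional x - sup_functional y| <= C * e.
Proof.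
move=> /J1_dist_lt[l tl xy].
have key s : K s ->
    `|Phi s (x \o s) - Phi (l \o s) (y \o (l \o s))| <= C * e.
  move=> Ks; apply: Phi_lipschitz => j.
    by rewrite distrC; apply: (xy _ _).2; exact: K01.
  by apply: (xy _ _).1; exact: K01.
rewrite ler_distl; apply/andP; split.
  rewrite lerBlDr; apply: sup_functional_le => s /(K_inv tl)[s' Ks' ->].
  have := sup_functional_ge x Ks'; have := key _ Ks'.
  by rewrite ler_distl => /andP[]; lra.
apply: sup_functional_le => s Ks.
have := sup_functional_ge y (K_time_change tl Ks); have := key _ Ks.
by rewrite ler_distl => /andP[]; lra.
Qed.

Lemma sup_functional_continuous : continuous sup_functional.
Proof.
apply/continuousP => A oA; change (J1_open (sup_functional @^-1` A)) => x Ax.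
have /nbhs_ballP[e /= e0 eA] : nbhs (sup_functional x) A.
  by apply: open_nbhs_nbhs; split.
pose r := e / (2 * (`|C| + 1)).
have C1 : 0 < `|C| + 1 by rewrite ltr_wpDl.
have r0 : 0 < r by rewrite divr_gt0// mulr_gt0.
exists r => // y /sup_functional_lipschitz xy.
apply: eA; rewrite -ball_normE /=; apply: le_lt_trans xy _.
have : C * r <= `|C| * r by rewrite ler_wpM2r ?ler_norm// ltW.
have : (`|C| + 1) * r = e / 2 by rewrite /r; field; rewrite gt_eqF.
by rewrite mulrDl mul1r; lra.
Qed.

End J1Functional.

Section LowerExpectation.
Context {R : realType} {d : measure_display} {T : measurableType d}.
Variable P : probability T R.
Implicit Types f g : T -> R.

(* For nonnegative functions 'E_P is a supremum over simple functions, hence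
   monotone even without measurability. *)
Definition Ex f : R := fine 'E_P[f].

Lemma expectation_mono f g : (forall w, 0 <= f w) -> (forall w, f w <= g w) ->
  ('E_P[f] <= 'E_P[g])%E.
Proof.
move=> f0 fg; rewrite unlock !ge0_integralTE.
- apply: ereal_sup_le => _ [h hf <-]; exists h => // w.
  by apply: le_trans (hf w) _; rewrite lee_fin.
- by move=> w; rewrite lee_fin (le_trans (f0 w)).
- by move=> w; rewrite lee_fin.
Qed.

Lemma ExE f : (forall w, 0 <= f w <= 1) -> ('E_P[f] = (Ex f)%:E)%E.
Proof.
move=> f01; rewrite /Ex fineK// ge0_fin_numE; last first.
  by apply: expectation_ge0 => w; have /andP[] := f01 w.
apply: (@le_lt_trans _ _ 'E_P[cst 1%R]%E); last by rewrite expectation_cst ltry.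
by apply: expectation_mono => w; have /andP[] := f01 w.
Qed.

Lemma Ex_indic_le f A : measurable A -> (forall w, 0 <= f w <= 1) ->
  (forall w, ~ A w -> f w = 0) -> Ex f <= pr P A.
Proof.
move=> mA f01 fA; rewrite -lee_fin -ExE// -prE// -expectation_indic//.
apply: expectation_mono => w; first by have /andP[] := f01 w.
rewrite indicE; case: (boolP (w \in A)) => [_|]; first by have /andP[] := f01 w.
by rewrite notin_setE => /fA ->.
Qed.

Lemma pr_le_Ex f A : measurable A -> (forall w, 0 <= f w <= 1) ->
  (forall w, A w -> f w = 1) -> pr P A <= Ex f.
Proof.
move=> mA f01 fA; rewrite -lee_fin -ExE// -prE// -expectation_indic//.
apply: expectation_mono => w; rewrite indicE//.
case: (boolP (w \in A)) => [|_]; first by rewrite inE => /fA ->.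
by have /andP[] := f01 w.
Qed.

(** Additivity of the integral is applied to the measurable bound [g + c + \1_A] only. The function
    [f], in the application a supremum over uncountably many samples, enters through
    monotonicity. *)
Lemma Ex_le_shift f g A (c : R) : measurable A ->
  measurable_fun setT g -> 0 <= c ->
  (forall w, 0 <= f w <= 1) -> (forall w, 0 <= g w <= 1) ->
  (forall w, ~ A w -> f w <= g w + c) -> Ex f <= Ex g + c + pr P A.
Proof.
move=> mA mg c0 f01 g01 fg; rewrite -lee_fin !EFinD -!ExE// -prE//.
rewrite -expectation_indic// -(expectation_cst P c).
have m1 : measurable_fun setT (EFin \o g) by exact/measurable_EFinP.
have m2 : measurable_fun setT (EFin \o (\1_A : T -> R)).
  by apply/measurable_EFinP; exact: measurable_indic.
have m3 : measurable_fun setT (fun _ : T => c%:E) by exact: measurable_cst.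
have g0 w : (0 <= (g w)%:E)%E by rewrite lee_fin; have /andP[] := g01 w.
have fg1 : ('E_P[f] <= 'E_P[fun w => (g w + c + \1_A w)%R])%E.
  apply: expectation_mono => w; first by have /andP[] := f01 w.
  rewrite indicE; case: (boolP (w \in A)) => [_|].
    have := g01 w; have := f01 w; move=> /andP[_ f1] /andP[g0' _].
    by rewrite (le_trans f1)//= lerDr addr_ge0.
  by rewrite notin_setE => /fg; rewrite addr0.
apply: le_trans fg1 _; rewrite unlock.
under eq_integral do rewrite EFinD EFinD.
rewrite ge0_integralD//; first rewrite ge0_integralD//.
- by move=> w _; apply: adde_ge0 => //; rewrite lee_fin.
- exact: emeasurable_funD.
Qed.

End LowerExpectation.

Section Clip.
Context {R : realType}.
Implicit Types a b c g : R.

Lemma dist_min a b a' b' g : `|a - a'| <= g -> `|b - b'| <= g ->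
  `|Num.min a b - Num.min a' b'| <= g.
Proof.
rewrite !ler_norml => /andP[? ?] /andP[? ?].
by have [?|?] := leP a b; have [?|?] := leP a' b'; apply/andP; split; lra.
Qed.

Lemma dist_max a b a' b' g : `|a - a'| <= g -> `|b - b'| <= g ->
  `|Num.max a b - Num.max a' b'| <= g.
Proof.
rewrite !ler_norml => /andP[? ?] /andP[? ?].
by have [?|?] := leP a b; have [?|?] := leP a' b'; apply/andP; split; lra.
Qed.

Definition clip a : R := Num.max 0 (Num.min 1 a).

Lemma clip01 a : 0 <= clip a <= 1.
Proof. by rewrite /clip le_max lexx/= ge_max ler01 ge_min lexx. Qed.

Lemma clip_le0 a : a <= 0 -> clip a = 0.
Proof. by move=> a0; apply/max_idPl; rewrite ge_min a0 orbT. Qed.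

Lemma clip_ge1 a : 1 <= a -> clip a = 1.
Proof. by move=> a1; rewrite /clip (min_idPl a1); apply/max_idPr. Qed.

Lemma dist_clip a b g : `|a - b| <= g -> `|clip a - clip b| <= g.
Proof.
move=> ab; have g0 : 0 <= g by rewrite (le_trans _ ab).
by apply: dist_max; rewrite ?subrr ?normr0//; apply: dist_min; rewrite ?subrr ?normr0.
Qed.

Lemma dist_distM (E : normedModType R) (x y x' y' : E) g :
  `|x - x'| <= g -> `|y - y'| <= g -> `| `|x - y| - `|x' - y'| | <= 2 * g.
Proof.
move=> xx yy; apply: le_trans (ler_dist_dist _ _) _.
rewrite (_ : _ - _ - _ = (x - x') - (y - y')); last first.
  by rewrite !opprD !opprK addrACA.
by apply: le_trans (ler_normB _ _) _; lra.
Qed.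

Lemma dist_div_sub1 a b e : 0 < e ->
  `|a / e - 1 - (b / e - 1)| = `|a - b| / e.
Proof.
move=> e0; rewrite (_ : _ - _ = (a - b) / e); last by ring.
by rewrite normrM (gtr0_norm (x := e^-1)) ?invr_gt0.
Qed.

End Clip.

(** * Transfer of probability bounds from [Y] to [S n] *)

Section ConvergenceInDistribution.
Context {R : realType} {d : measure_display} {T : measurableType d}.
Variable P : probability T R.
Context {E : normedModType R}.
Variables (S : nat -> T -> cadlag01 E) (Y : T -> cadlag01 E).
Hypothesis S_cvg : cvg_in_distribution P S Y.

Lemma Ex_near (F : cadlag01 E -> R) (eta : R) : continuous F ->
  (forall x, 0 <= F x <= 1) -> 0 < eta ->
  \forall n \near \oo, Ex P (F \o S n) < Ex P (F \o Y) + eta.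
Proof.
move=> cF F01 eta0.
have bF : bounded_fun F.
  exists 1; split=> // M M1 x _ /=.
  have /andP[F0 F1] := F01 x; rewrite ger0_norm//; lra.
have := S_cvg cF bF; rewrite ExE; last by move=> w; exact: F01.
by move=> /fine_cvg /cvgr_lt; apply; rewrite ltrDl.
Qed.

(* Only the terms of index 0, 1 and 2 enter [triple_test]. *)
Definition ordered_triples : set (nat -> R) :=
  [set s | (forall j, s j \in `[0, 1]) /\ {homo s : i j / (i <= j)%N >-> i <= j}].

(** A Lipschitz substitute for an indicator: it is 1 if both increments are at least [2 * eps] and
    the time span is at most [del / 2], and it is 0 if one increment is at most [eps] or the span is
    at least [del]. *)
Definition triple_test (del eps : R) (s : nat -> R) (x : nat -> E) : R :=
  clip (Num.min (Num.min (`|x 1%N - x 0%N|) (`|x 2 - x 1%N|) / eps - 1)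
                (2 - 2 * (s 2 - s 0%N) / del)).

(** The event that some triple is bad is an uncountable union, whence the quantification over
    measurable [A] inside it, with [n] uniform in [A]. The losses from [eps] to [2 * eps] and from
    [del] to [del / 2] are the ramps of [triple_test]. *)
Lemma three_point_near (del eps eta : R) (B : set T) :
  0 < del -> 0 < eps -> measurable B -> pr P B < eta ->
  (forall w, ~ B w -> forall s1 s2 s3 : R, 0 <= s1 -> s1 <= s2 -> s2 <= s3 ->
     s3 <= 1 -> s3 - s1 < del ->
     `|Y w s2 - Y w s1| <= eps \/ `|Y w s3 - Y w s2| <= eps) ->
  \forall n \near \oo, forall A, measurable A ->
    (forall w, A w -> exists s1 s2 s3 : R, [/\ 0 <= s1, s1 <= s2, s2 <= s3 & s3 <= 1] /\
      [/\ s3 - s1 <= del / 2, 2 * eps <= `|S n w s2 - S n w s1| &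
        2 * eps <= `|S n w s3 - S n w s2|]) ->
    pr P A < eta.
Proof.
move=> del0 eps0 mB PB YB.
pose F := @sup_functional R E nat ordered_triples (triple_test del eps).
have K01 (s : nat -> R) : ordered_triples s -> forall j, s j \in `[0, 1] by case.
have T01 (s : nat -> R) (x : nat -> E) : 0 <= triple_test del eps s x <= 1.
  exact: clip01.
have K0 : ordered_triples !=set0.
  by exists (fun _ => 0); split => // j; rewrite in_itv/= lexx ler01.
have F01 x : 0 <= F x <= 1 by apply: sup_functional01.
have cF : continuous F.
  (* If times and values move by [g], each increment moves by at most [2 * g] and is divided by
     [eps]; the time span also moves by at most [2 * g] and is multiplied by [2 / del]. *)
  apply: (@sup_functional_continuous _ _ _ _ _ (2 / eps + 4 / del)) => //.
  - move=> l s tl [s01 smono]; split=> [j|i j ij]; first exact: time_change_in.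
    by rewrite /= time_change_le//; exact: smono.
  - move=> l s tl [s01 smono].
    have /choice[s' s'P] : forall j, exists t, t \in `[0, 1] /\ l t = s j.
      by move=> j; have [t tI lt] := time_change_surj tl (s01 j); exists t.
    exists s'; last by apply/funext => j /=; rewrite (s'P j).2.
    split=> [j|i j ij]; first exact: (s'P j).1.
    rewrite -(time_change_le tl (s'P i).1 (s'P j).1) (s'P i).2 (s'P j).2.
    exact: smono.
  - move=> g s s' x x' sg xg.
    have g0 : 0 <= g by apply: le_trans (sg 0%N).
    have e0 : 0 <= 2 / eps * g by rewrite mulr_ge0// divr_ge0// ltW.
    have d0 : 0 <= 4 / del * g by rewrite mulr_ge0// divr_ge0// ltW.
    rewrite mulrDl; apply: dist_clip; apply: dist_min.
      rewrite dist_div_sub1//.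
      apply: (@le_trans _ _ (2 * g / eps)); last by rewrite mulrAC lerDl.
      rewrite ler_wpM2r// ?invr_ge0; first exact: ltW.
      by apply: dist_min; apply: dist_distM.
    have -> : 2 - 2 * (s 2 - s 0%N) / del - (2 - 2 * (s' 2 - s' 0%N) / del) =
       2 / del * ((s' 2 - s 2) + (s 0%N - s' 0%N)) by field; rewrite gt_eqF.
    rewrite normrM gtr0_norm ?divr_gt0//.
    apply: (@le_trans _ _ (4 / del * g)); last by rewrite lerDr.
    rewrite (_ : 4 / del * g = 2 / del * (g + g)); last by field; rewrite gt_eqF.
    rewrite ler_pM2l ?divr_gt0//; apply: le_trans (ler_normD _ _) _.
    by rewrite lerD// distrC.
have : \forall n \near \oo, Ex P (F \o S n) < Ex P (F \o Y) + (eta - pr P B).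
  by apply: Ex_near => //; rewrite subr_gt0.
apply: filterS => n Fn A mA SA.
have ExB : Ex P (F \o Y) <= pr P B.
  apply: Ex_indic_le => // [w|w /YB YBw /=]; first exact: F01.
  apply/le_anti; have /andP[-> _] := F01 (Y w); rewrite andbT.
  apply: sup_functional_le => // s [s01 smono].
  rewrite /triple_test clip_le0//= ge_min.
  have [sd|sd] := ltP (s 2 - s 0%N) del; last first.
    by apply/orP; right; rewrite subr_le0 ler_pdivlMr// ler_pM2l.
  apply/orP; left; rewrite subr_le0 ler_pdivrMr// mul1r ge_min.
  have := s01 0%N; have := s01 2; rewrite !in_itv/= => /andP[_ s21] /andP[s00 _].
  by have [->|->] := YBw _ _ _ s00 (smono 0%N 1%N isT) (smono 1%N 2 isT) s21 sd;
    rewrite ?orbT.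
have : pr P A <= Ex P (F \o S n).
  apply: pr_le_Ex => // [w|w /SA[s1 [s2 [s3 [[s10 s12 s23 s31] [sd x12 x23]]]]]]; first exact: F01.
  apply/le_anti; have /andP[_ ->] := F01 (S n w); rewrite /=.
  pose s (j : nat) := match j with 0 => s1 | 1 => s2 | _ => s3 end.
  have Ks : ordered_triples s.
    split=> [[|[|j]]|[|[|i]] [|[|j]] _ //=]; rewrite ?in_itv /=; lra.
  apply: le_trans (sup_functional_ge K0 T01 (S n w) Ks).
  rewrite /triple_test clip_ge1//= le_min; apply/andP; split.
    rewrite lerBrDr ler_pdivlMr// le_min; apply/andP; split; lra.
  suff : 2 * (s3 - s1) / del <= 1 by lra.
  by rewrite ler_pdivrMr//; lra.
lra.
Qed.

(* Time changes fix 1, so that a jump of [Y] at time 1 does no harm. *)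
Definition stable_at (t : R) := t \in `[0, 1] /\
  (t = 1 \/ forall gam eta : R, 0 < gam -> 0 < eta ->
    exists2 a : R, 0 < a & exists B, [/\ measurable B, pr P B < eta &
      forall w, ~ B w -> forall s : R, s \in `[0, 1] -> `|s - t| < a ->
        `|Y w s - Y w t| <= gam]).

Lemma stable_at_seq (L : seq R) (gam eta : R) :
  (forall t, t \in L -> stable_at t) -> 0 < gam -> 0 < eta ->
  exists2 a : R, 0 < a & exists B, [/\ measurable B, pr P B < eta &
    forall w, ~ B w -> forall t, t \in L -> forall s : R, s \in `[0, 1] ->
      (t = 1 -> s = 1) -> `|s - t| < a -> `|Y w s - Y w t| <= gam].
Proof.
move=> + gam0; elim: L eta => [|t L ih] eta Lst eta0.
  by exists 1 => //; exists set0; split; rewrite ?pr0.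
have eta2 : 0 < eta / 2 by rewrite divr_gt0.
have [|a a0 [B [mB PB YB]]] := ih (eta / 2) _ eta2.
  by move=> u uL; apply: Lst; rewrite inE uL orbT.
have [tI [t1|/(_ _ _ gam0 eta2)[a' a'0 [B' [mB' PB' YB']]]]] := Lst t (mem_head _ _).
  exists a => //; exists B; split => //; first by lra.
  move=> w Bw u; rewrite inE => /predU1P[->|uL] s sI su sa; last exact: (YB w).
  by rewrite su// t1 subrr normr0 ltW.
exists (Num.min a a'); first by rewrite lt_min a0.
exists (B `|` B'); split; first exact: measurableU.
  by have := prU_le P mB mB'; lra.
move=> w /not_orP[Bw B'w] u; rewrite inE => + s sI su; rewrite lt_min => + /andP[sa sa'].
by move=> /predU1P[uE|uL]; [rewrite uE; apply: (YB' w) => //; rewrite -uE|exact: (YB w)].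
Qed.

(** Evaluation at fixed times is not J1-continuous, so [h] is replaced by the supremum of
    [h (x \o s)] minus a penalty for moving the points of [L]. This dominates [h] on every path, and
    for [Y] it exceeds [h] by little outside a small event, since the penalty confines [s] to a
    neighbourhood where [Y] is stable. A one-sided bound suffices: the opposite one comes from
    [1 - h]. *)
Lemma fdd_near (L : seq R) (h : (R -> E) -> R) (C eta : R) :
  (forall t, t \in L -> stable_at t) -> 0 <= C -> 0 < eta ->
  (forall x, 0 <= h x <= 1) ->
  (forall (g : R) x x', (forall t, t \in L -> `|x t - x' t| <= g) ->
     `|h x - h x'| <= C * g) ->
  measurable_fun setT (fun w => h (Y w)) ->
  \forall n \near \oo, Ex P (fun w => h (S n w)) < Ex P (fun w => h (Y w)) + eta.
Proof.
move=> Lst C0 eta0 h01 hC mh.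
pose gam := eta / (4 * (C + 1)).
have C1 : 0 < C + 1 by rewrite ltr_wpDl.
have gam0 : 0 < gam by rewrite divr_gt0// mulr_gt0.
have Cgam : C * gam <= eta / 4.
  have -> : eta / 4 = (C + 1) * gam by rewrite /gam; field; rewrite gt_eqF.
  by rewrite ler_pM2r ?lerDl.
have [|a a0 [B [mB PB YB]]] := stable_at_seq Lst gam0 (_ : 0 < eta / 4).
  by rewrite divr_gt0.
pose K : set (R -> R) := [set s | (forall t, s t \in `[0, 1]) /\ s 1 = 1].
pose Phi (s : R -> R) (x : R -> E) :=
  clip (h x - a^-1 * \sum_(t <- L) `|s t - t|).
pose F := @sup_functional R E R K Phi.
have K01 (s : R -> R) : K s -> forall j, s j \in `[0, 1] by case.
have Phi01 s x : 0 <= Phi s x <= 1 by exact: clip01.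
(* The unperturbed sample; the default keeps all its values in the unit interval, as [K] demands. *)
pose s0 t : R := if t \in `[0, 1] then t else 0.
have Ks0 : K s0.
  split=> [t|]; first by rewrite /s0; case: ifPn => // _; rewrite in_itv/= lexx ler01.
  by rewrite /s0 in_itv/= ler01 lexx.
have K0 : K !=set0 by exists s0.
have F01 x : 0 <= F x <= 1 by apply: sup_functional01.
have cF : continuous F.
  apply: (@sup_functional_continuous _ _ _ _ _ (C + a^-1 * (size L)%:R)) => //.
  - move=> l s tl [s01 s1]; split=> [t|/=]; first exact: (time_change_in tl (s01 t)).
    by rewrite s1 time_change1.
  - move=> l s tl [s01 s1].
    have /choice[s' s'P] : forall j, exists t, t \in `[0, 1] /\ l t = s j.
      by move=> j; have [t tI lt] := time_change_surj tl (s01 j); exists t.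
    exists s'; last by apply/funext => j /=; rewrite (s'P j).2.
    split=> [j|]; first exact: (s'P j).1.
    have := (s'P 1).2; rewrite s1 -[RHS](time_change1 tl) => l11.
    have I1 : (1 : R) \in `[0, 1] by rewrite in_itv/= ler01 lexx.
    have s'1 := (s'P 1).1; apply/le_anti.
    by rewrite -(time_change_le tl s'1 I1) -(time_change_le tl I1 s'1) l11 lexx.
  - move=> g s s' x x' sg xg.
    apply: dist_clip.
    rewrite (_ : _ - _ - _ = h x - h x' -
      a^-1 * (\sum_(t <- L) `|s t - t| - \sum_(t <- L) `|s' t - t|)); last by ring.
    rewrite mulrDl.
    apply: le_trans (ler_normB _ _) _; rewrite lerD//; first exact: hC.
    rewrite normrM gtr0_norm ?invr_gt0// -mulrA.
    rewrite ler_pM2l ?invr_gt0// -sumrB.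
    apply: le_trans (ler_norm_sum _ _ _) _.
    apply: (@le_trans _ _ (\sum_(t <- L) g)).
      apply: ler_sum => t _; apply: le_trans (ler_dist_dist _ _) _.
      by rewrite opprB addrA addrNK distrC; rewrite distrC; exact: sg.
    by rewrite big_const_seq count_predT iter_addr addr0 mulr_natl.
have h_loc x x' : (forall t, t \in L -> x t = x' t) -> h x = h x'.
  move=> xx; apply/eqP; rewrite -subr_eq0 -normr_le0 -(mulr0 C).
  by apply: hC => t /xx ->; rewrite subrr normr0.
have LI t : t \in L -> t \in `[0, 1] by move=> /Lst[].
have Sle n w : h (S n w) <= F (S n w).
  apply: le_trans (sup_functional_ge K0 Phi01 (S n w) Ks0); rewrite /Phi big1_seq; last first.
    by move=> t /andP[_ /LI tI]; rewrite /s0 tI subrr normr0.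
  rewrite mulr0 subr0 (h_loc _ (S n w)); last first.
    by move=> t /LI tI; rewrite /= /s0 tI.
  by rewrite /clip le_max le_min; have /andP[_ ->] := h01 (S n w); rewrite lexx orbT.
have Yle : Ex P (F \o Y) <= Ex P (fun w => h (Y w)) + eta / 4 + pr P B.
  apply: Ex_le_shift => //; first by rewrite ltW// divr_gt0.
    by move=> w; exact: F01.
  move=> w Bw /=; apply: sup_functional_le => // s [s01 s1].
  rewrite /Phi; set D := \sum_(t <- L) _.
  have h0 := h01 (Y w).
  (* A total displacement of at least [a] costs a penalty of at least 1, which absorbs [h];
     otherwise every point of [L] moves by less than [a] and [Y] is stable there. *)
  have [Da|Da] := ltP D a; last first.
    rewrite clip_le0; first by lra.
    have /andP[_ h1] := h01 (Y w \o s); apply: (le_trans (lerB h1 (lexx _))).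
    by rewrite subr_le0 mulrC ler_pdivlMr// mul1r.
  have D0 : 0 <= D by rewrite sumr_ge0.
  have aD : 0 <= a^-1 * D by rewrite mulr_ge0// invr_ge0 ltW.
  have hY : `|h (Y w \o s) - h (Y w)| <= C * gam.
    apply: hC => t tL; apply: (YB w Bw) => //; first by move=> ->.
    apply: le_lt_trans Da; rewrite /D (big_rem t)//= lerDl.
    by rewrite sumr_ge0.
  move: hY; rewrite ler_distl => /andP[_ hY].
  rewrite /clip ge_max ge_min; apply/andP; split; first by lra.
  by apply/orP; right; lra.
have : \forall n \near \oo, Ex P (F \o S n) < Ex P (F \o Y) + eta / 4.
  by apply: Ex_near => //; rewrite divr_gt0.
apply: filterS => n Fn.
have : Ex P (fun w => h (S n w)) <= Ex P (F \o S n).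
  rewrite -lee_fin -!ExE//; last by move=> w; exact: F01.
  by apply: expectation_mono => w; [have /andP[] := h01 (S n w)|exact: Sle].
lra.
Qed.

Lemma fdd_pr_near (L : seq R) (h : (R -> E) -> R) (C r eta : R) :
  (forall t, t \in L -> stable_at t) -> 0 <= C -> 0 < r ->
  (forall (g : R) x x', (forall t, t \in L -> `|x t - x' t| <= g) ->
     `|h x - h x'| <= C * g) ->
  measurable_fun setT (fun w => h (Y w)) ->
  pr P [set w | r < h (Y w)] < eta ->
  \forall n \near \oo, forall A, measurable A ->
    (forall w, A w -> 2 * r <= h (S n w)) -> pr P A < eta.
Proof.
move=> Lst C0 r0 hC mh PY.
have mr : measurable [set w | r < h (Y w)].
  rewrite -[X in measurable X]setTI.
  rewrite (_ : [set w | r < h (Y w)] = (fun w => h (Y w)) @^-1` `]r, +oo[); last first.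
    by apply/seteqP; split => w /=; rewrite in_itv/= andbT.
  by apply: mh => //; exact: measurable_itv.
(* A ramp that vanishes for [h x <= r] and equals 1 for [h x >= 2 * r]; this is the origin of the
   factor 2 in the conclusion. *)
pose k x := clip (h x / r - 1).
have k01 x : 0 <= k x <= 1 by exact: clip01.
have : \forall n \near \oo, Ex P (fun w => k (S n w)) <
    Ex P (fun w => k (Y w)) + (eta - pr P [set w | r < h (Y w)]).
  apply: (@fdd_near L k (C / r)) => //.
  - by rewrite divr_ge0// ltW.
  - by rewrite subr_gt0.
  - move=> g x x' xx; apply: dist_clip.
    rewrite dist_div_sub1// mulrAC.
    by rewrite ler_wpM2r// ?invr_ge0; [exact: ltW|exact: hC].
  - apply: measurable_maxr => //; apply: measurable_minr => //.
    apply: measurable_funB => //.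
    by apply: measurable_funM => //; exact: measurable_cst.
apply: filterS => n kn A mA SA.
have : Ex P (fun w => k (Y w)) <= pr P [set w | r < h (Y w)].
  apply: Ex_indic_le => // w /negP; rewrite -leNgt => hr.
  by rewrite /k clip_le0// subr_le0 ler_pdivrMr// mul1r.
have : pr P A <= Ex P (fun w => k (S n w)).
  apply: pr_le_Ex => // w /SA hr; rewrite /k clip_ge1//.
  by rewrite lerBrDr ler_pdivlMr.
lra.
Qed.

End ConvergenceInDistribution.

(** * Cadlag paths *)

Section CadlagPaths.
Context {R : realType} {E : normedModType R}.
Implicit Type x : cadlag01 E.

Lemma subrBB (V : zmodType) (a b z : V) : (a - z) - (b - z) = a - b.
Proof. by rewrite opprB addrA addrNK. Qed.

Lemma cadlagP x : is_cadlag01 x.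
Proof. exact/asboolP/(cadlag01P x). Qed.

Lemma cadlag_out x t : t \notin `[0, 1] -> x t = 0.
Proof. by have [_ _ x0] := cadlagP x => /x0. Qed.

(* The left limit at [t], which the convention [jump x 0 = 0] extends by
   [x 0] at [0] *)
Definition left_value x (t : R) : E := x t - jump x t.

Lemma cadlag_right x (t rho : R) : 0 <= t < 1 -> 0 < rho ->
  exists2 a : R, 0 < a & forall s, t <= s < t + a -> `|x s - x t| < rho.
Proof.
move=> t01 rho0; have [/(_ t t01) + _ _] := cadlagP x.
move=> /cvgr_distC_lt /(_ _ rho0)[a /= a0 ax].
exists a => // s /andP[]; rewrite le_eqVlt => /predU1P[<- _|ts sa].
  by rewrite subrr normr0.
apply: ax => //=; rewrite ltr_distlC; lra.
Qed.

Lemma cadlag_left x (t rho : R) : 0 < t <= 1 -> 0 < rho ->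
  exists2 a : R, 0 < a &
    forall s, t - a < s < t -> `|x s - left_value x t| < rho.
Proof.
move=> t01; have [_ /(_ t t01) + _] := cadlagP x.
rewrite /left_value /jump gt_eqF; last by case/andP: t01.
rewrite subKr => /cvgr_distC_lt /[apply] -[a /= a0 ax].
exists a => // s /andP[sa st]; apply: ax => //=; rewrite ltr_distlC; lra.
Qed.

Lemma cadlag_local x (t rho : R) : t \in `[0, 1] -> 0 < rho ->
  exists2 a : R, 0 < a & forall s : R, s \in `[0, 1] ->
    (t - a < s < t -> `|x s - left_value x t| < rho) /\
    (t <= s < t + a -> `|x s - x t| < rho).
Proof.
rewrite in_itv/= => /andP[t0 t1] rho0.
have [a a0 ax] : exists2 a : R, 0 < a & forall s : R, s \in `[0, 1] ->
    t - a < s < t -> `|x s - left_value x t| < rho.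
  move: t0; rewrite le_eqVlt => /predU1P[<-|t0].
    by exists 1 => // s; rewrite in_itv/=; lra.
  have [|a a0 ax] := @cadlag_left x t rho _ rho0; first by rewrite t0.
  by exists a => // s _; exact: ax.
have [b b0 bx] : exists2 b : R, 0 < b & forall s : R, s \in `[0, 1] ->
    t <= s < t + b -> `|x s - x t| < rho.
  move: t1; rewrite le_eqVlt => /predU1P[->|t1].
    exists 1 => // s; rewrite in_itv/= => s01 s1.
    by rewrite (_ : s = 1) ?subrr ?normr0//; lra.
  have [|b b0 bx] := @cadlag_right x t rho _ rho0; first by rewrite t0.
  by exists b => // s _; exact: bx.
exists (Num.min a b) => [|s sI]; first by rewrite lt_min a0.
have ma : Num.min a b <= a by rewrite ge_min lexx.
have mb : Num.min a b <= b by rewrite ge_min lexx orbT.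
by split=> /andP[? ?]; [apply: ax|apply: bx] => //; lra.
Qed.

(** On either side of [t] the path stays within [gam / 3] of a single value, so a jump at [s != t]
    is controlled by a point [u] just before [s] on the same side. *)
Lemma jump_local x (t gam : R) : t \in `[0, 1] -> 0 < gam ->
  exists2 a : R, 0 < a & forall s : R, s \in `[0, 1] -> `|s - t| < a -> s != t ->
    `|jump x s| <= gam.
Proof.
move=> tI gam0; have [|a a0 ax] := @cadlag_local x t (gam / 3) tI.
  by rewrite divr_gt0.
exists a => // s sI; rewrite ltr_distl => /andP[sa1 sa2] st.
have [->|s0] := eqVneq s 0; first by rewrite /jump eqxx normr0 ltW.
have s01 : 0 < s <= 1.
  by move: sI; rewrite in_itv/= lt_neqAle eq_sym s0 => /andP[-> ->].
have [|b b0 bx] := @cadlag_left x s (gam / 3) s01; first by rewrite divr_gt0.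
have key (z : E) (lo : R) : lo < s -> `|x s - z| < gam / 3 ->
    (forall u, lo <= u < s -> u \in `[0, 1] -> `|x u - z| < gam / 3) ->
    `|jump x s| <= gam.
  move=> los xsz xuz.
  pose u := Num.max (Num.max lo 0) (s - b / 2).
  have us : u < s by rewrite !gt_max los; lra.
  have lou : lo <= u by rewrite !le_max lexx.
  have u0 : 0 <= u by rewrite !le_max lexx orbT.
  have ub : s - b < u by rewrite !lt_max; apply/orP; right; lra.
  have uI : u \in `[0, 1] by rewrite in_itv/=; lra.
  have x1 : `|x u - z| < gam / 3 by apply: xuz => //; rewrite lou.
  have x2 : `|x u - left_value x s| < gam / 3 by apply: bx; rewrite ub.
  have -> : jump x s = (x s - z) - (x u - z) + (x u - left_value x s).
    by rewrite subrBB addrA addrNK /left_value subKr.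
  apply: le_trans (ler_normD _ _) _; apply: le_trans (lerD (ler_normB _ _) (lexx _)) _.
  lra.
have [st'|ts] := ltP s t.
  apply: (key (left_value x t) (t - a + (s - (t - a)) / 2)); first by lra.
    by apply: (ax s sI).1; rewrite sa1.
  by move=> u ? uI; apply: (ax u uI).1; lra.
have {}ts : t < s by rewrite lt_neqAle eq_sym st.
apply: (key (x t) t) => //; first by apply: (ax s sI).2; lra.
by move=> u ? uI; apply: (ax u uI).2; lra.
Qed.

Lemma compact_sequence (u : nat -> R) : (forall k, u k \in `[0, 1]) ->
  exists2 t, t \in `[0, 1] & forall (a : R) N, 0 < a ->
    exists2 k, (N <= k)%N & `|u k - t| < a.
Proof.
move=> uI; have := @segment_compact R 0 1.
move=> /(_ (u @ \oo) _) [|t [tI tu]].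
  by exists 0%N => // k _; exact: uI.
exists t => // a N a0.
have [||_ [[k /= Nk <-] tk]] := tu (u @` [set k | (N <= k)%N]) (ball t a).
- by exists N => // k /= Nk; exists k.
- exact: nbhsx_ballx.
by exists k => //; rewrite distrC.
Qed.

(** Lebesgue's covering lemma, phrased for a relation between the ends of an interval: pairs
    violating [Q] at smaller and smaller distance would cluster at some [t], where [Q] holds
    locally. *)
Lemma lebesgue_number (Q : R -> R -> Prop) :
  (forall t : R, t \in `[0, 1] -> exists2 a : R, 0 < a &
    forall u v : R, u \in `[0, 1] -> v \in `[0, 1] -> `|u - t| < a -> `|v - t| < a ->
      Q u v) ->
  exists2 a : R, 0 < a & forall u v : R, u \in `[0, 1] -> v \in `[0, 1] ->
    `|u - v| < a -> Q u v.
Proof.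
move=> Qloc; apply: contrapT => noQ.
have /choice[uv uvP] : forall k : nat, exists uv : R * R,
    [/\ uv.1 \in `[0, 1], uv.2 \in `[0, 1], `|uv.1 - uv.2| < k.+1%:R^-1 &
        ~ Q uv.1 uv.2].
  move=> k; apply: contrapT => noq; apply: noQ; exists k.+1%:R^-1 => //.
  move=> u v uI vI uv; apply: contrapT => nQ.
  by apply: noq; exists (u, v).
have [|t tI tuv] := @compact_sequence (fun k => (uv k).1).
  by move=> k; have [] := uvP k.
have [a a0 aQ] := Qloc t tI.
have a2 : 0 < a / 2 by rewrite divr_gt0.
have [N Na] : exists N : nat, N.+1%:R^-1 < a / 2.
  exists (Num.truncn (a / 2)^-1); rewrite -[ltRHS]invrK ltf_pV2 ?posrE ?invr_gt0//.
  exact: truncnS_gt.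
have [k Nk ta] := tuv _ N a2; have [uI vI uvk] := uvP k; apply.
apply: aQ => //; first by lra.
have kN : k.+1%:R^-1 <= N.+1%:R^-1 :> R by rewrite lef_pV2 ?posrE// ler_nat.
rewrite (_ : _ - t = - ((uv k).1 - (uv k).2) + ((uv k).1 - t)); last by ring.
have uv2 := lt_trans (lt_le_trans uvk kN) Na; clear uvk kN Na.
by apply: le_lt_trans (ler_normD _ _) _; rewrite normrN; lra.
Qed.

(** Near [t] the path consists of two almost constant pieces, before [t] and from [t] on. The middle
    point shares its piece with the first point in one case and with the last in the other. *)
Lemma three_point_modulus x (gam : R) : 0 < gam -> exists2 a : R, 0 < a &
  forall s1 s2 s3 : R, 0 <= s1 -> s1 <= s2 -> s2 <= s3 -> s3 <= 1 ->
    s3 - s1 < a -> `|x s2 - x s1| <= gam \/ `|x s3 - x s2| <= gam.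
Proof.
move=> gam0.
have [t tI|a a0 aQ] := @lebesgue_number (fun u v => forall s, u <= s -> s <= v ->
    `|x s - x u| <= gam \/ `|x v - x s| <= gam).
  have [|a a0 ax] := @cadlag_local x t (gam / 2) tI; first by rewrite divr_gt0.
  exists a => // u v uI vI; rewrite !ltr_distl => /andP[ua1 ua2] /andP[va1 va2] s us sv.
  have sI : s \in `[0, 1] by move: uI vI; rewrite !in_itv/=; lra.
  have tri (z y1 y2 : E) : `|y1 - z| < gam / 2 -> `|y2 - z| < gam / 2 ->
      `|y1 - y2| <= gam.
    move=> ? ?; rewrite (_ : y1 - y2 = (y1 - z) - (y2 - z)).
      by apply: le_trans (ler_normB _ _) _; lra.
    by rewrite subrBB.
  have [st|ts] := ltP s t; [left|right].
    by apply: (tri (left_value x t)); [apply: (ax _ sI).1|apply: (ax _ uI).1]; lra.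
  by apply: (tri (x t)); [apply: (ax _ vI).2|apply: (ax _ sI).2]; lra.
exists a => // s1 s2 s3 s10 s12 s23 s31 sa.
apply: (aQ s1 s3) => //; rewrite ?in_itv/= ?ltr_distl; lra.
Qed.

(** Approximation from the right matches right-continuity. At [s = 1] the condition forces [q] to
    attain 1, where the path may jump. *)
Definition right_dense (q : nat -> R) := (forall i, q i \in `[0, 1]) /\
  forall s a : R, s \in `[0, 1] -> 0 < a -> exists i, s <= q i < s + a.

Lemma right_dense_exists : exists q : nat -> R, right_dense q.
Proof.
pose q (i : nat) : R := if (choice.unpickle i : option rat) is Some r then
  let z : R := ratr (r : rat) in if z \in `[0, 1] then z else 1 else 1.
exists q; split=> [i|s a].
  rewrite /q; case: (choice.unpickle i) => [r|]; last by rewrite in_itv/= ler01 lexx.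
  by case: ifPn => // _; rewrite in_itv/= ler01 lexx.
rewrite in_itv/= => /andP[s0]; rewrite le_eqVlt => /predU1P[->|s1] a0.
  exists (choice.pickle (1 : rat)); rewrite /q choice.pickleK rmorph1 in_itv/= ler01 lexx/=.
  by rewrite lexx ltrDl.
have [|r] := @rat_in_itvoo R s (Num.min 1 (s + a)).
  by rewrite lt_min s1 ltrDl.
rewrite in_itv/= lt_min => /and3P[sr r1 ra].
exists (choice.pickle r); rewrite /q choice.pickleK in_itv/= (ltW (le_lt_trans s0 sr)) (ltW r1)/=.
by rewrite (ltW sr) ra.
Qed.

Lemma right_dense_approx q x (s a rho : R) : right_dense q -> s \in `[0, 1] ->
  0 < a -> 0 < rho -> exists i, s <= q i < s + a /\ `|x (q i) - x s| < rho.
Proof.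
move=> [qI qd] sI a0 rho0; have [b b0 bx] := cadlag_local x sI rho0.
have [|i /andP[sq]] := qd s (Num.min a b) sI; first by rewrite lt_min a0.
rewrite -ltrBlDl lt_min !ltrBlDl => /andP[qa qb]; exists i; split; first by rewrite sq.
by apply: (bx _ (qI i)).2; rewrite sq.
Qed.

End CadlagPaths.

(** * Moduli and fixed jump times of a random path *)

Section RandomPaths.
Context {R : realType} {d : measure_display} {T : measurableType d}.
Variable P : probability T R.
Context {E : normedModType R}.
Hypothesis sepE : separable E.

Definition invS (k : nat) : R := k.+1%:R^-1.

Lemma invS_gt0 k : 0 < invS k.
Proof. by rewrite invr_gt0. Qed.

Lemma invS_lt (a : R) : 0 < a -> exists k : nat, invS k < a.
Proof.
move=> a0; exists (Num.truncn a^-1).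
by rewrite -[ltRHS]invrK ltf_pV2 ?posrE ?invr_gt0// truncnS_gt.
Qed.

Lemma le_invS (k n : nat) : (k <= n)%N -> invS n <= invS k.
Proof. by move=> kn; rewrite lef_pV2 ?posrE// ler_nat. Qed.

Lemma measurable_fun_gt d' (M : measurableType d') (f : M -> R) (c : R) :
  measurable_fun setT f -> measurable [set w | c < f w].
Proof.
move=> mf; rewrite -[X in measurable X]setTI.
rewrite (_ : [set w | c < f w] = f @^-1` `]c, +oo[); last first.
  by apply/seteqP; split => w /=; rewrite in_itv/= andbT.
by apply: mf => //; exact: measurable_itv.
Qed.

Lemma measurable_fun_le d' (M : measurableType d') (f : M -> R) (c : R) :
  measurable_fun setT f -> measurable [set w | f w <= c].
Proof.
move=> mf; rewrite (_ : [set w | f w <= c] = ~` [set w | c < f w]).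
  exact/measurableC/measurable_fun_gt.
by apply/seteqP; split => w /=; rewrite ?leNgt => /negP.
Qed.

Lemma measurable_fun_lt d' (M : measurableType d') (f : M -> R) (c : R) :
  measurable_fun setT f -> measurable [set w | f w < c].
Proof.
move=> mf; rewrite -[X in measurable X]setTI.
rewrite (_ : [set w | f w < c] = f @^-1` `]-oo, c[); last first.
  by apply/seteqP; split => w /=; rewrite in_itv.
by apply: mf => //; exact: measurable_itv.
Qed.

Lemma measurable_fun_ge d' (M : measurableType d') (f : M -> R) (c : R) :
  measurable_fun setT f -> measurable [set w | c <= f w].
Proof.
move=> mf; rewrite (_ : [set w | c <= f w] = ~` [set w | f w < c]).
  exact/measurableC/measurable_fun_lt.
by apply/seteqP; split => w /=; rewrite leNgt => /negP.
Qed.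

Lemma measurable_bool_and d' (M : measurableType d') (b : bool) (A : set M) :
  measurable A -> measurable [set w | b /\ A w].
Proof.
case: b => mA.
  by rewrite (_ : [set w | _] = A)//; apply/seteqP; split => w //= [].
by rewrite (_ : [set w | _] = set0)//; apply/seteqP; split => w //= [].
Qed.

Variable Y : {RV P >-> cadlag01 E}.

Lemma vmeasurable_eval t : vmeasurable (fun w => Y w t).
Proof.
have [tI|tI] := boolP (t \in `[0, 1]); last first.
  rewrite (_ : (fun w => Y w t) = fun=> 0); first exact: vmeasurable_cst.
  by apply/funext => w; rewrite cadlag_out.
apply: vmeasurable_borel => U oU.
have mU : measurable [set x : cadlag01 E | U (x t)].
  apply: sub_sigma_algebra; exists t, U; split => //.
  exact: sub_sigma_algebra.
have mY : measurable_fun setT Y by [].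
by have := mY measurableT _ mU; rewrite setTI.
Qed.

Lemma vmeasurable_jump t : t \in `[0, 1] -> vmeasurable (fun w => jump (Y w) t).
Proof.
rewrite in_itv/= => /andP[t0 t1] a.
have [->|tn0] := eqVneq t 0.
  under eq_fun do rewrite /jump eqxx; exact: measurable_cst.
have {}t0 : 0 < t by rewrite lt_neqAle eq_sym tn0.
pose s k := t - t * invS k.+1.
apply: (@measurable_fun_cvg _ _ _ _ (fun k w => `|Y w t - Y w (s k) - a|)).
- move=> k; apply: vmeasurableB => //; exact: vmeasurable_eval.
- move=> w _; apply: cvg_norm; apply: cvgB; last exact: cvg_cst.
  rewrite -[jump _ _](subKr (Y w t)) -/(left_value _ _).
  apply: cvgB; first exact: cvg_cst.
  apply/cvgrPdistC_lt => e e0.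
  have [|b b0 bY] := @cadlag_left _ _ (Y w) t e _ e0; first by rewrite t0.
  have [N Nb] := invS_lt (divr_gt0 b0 t0).
  exists N => // k /= Nk; apply: bY.
  have k0 : 0 < invS k.+1 by exact: invS_gt0.
  have kb : invS k.+1 < b / t.
    by apply: le_lt_trans Nb; apply: le_invS; rewrite leqW.
  rewrite ltr_pdivlMr// mulrC in kb.
  have tk : 0 < t * invS k.+1 by rewrite mulr_gt0.
  by rewrite /s; apply/andP; split; lra.
Qed.

Lemma vmeasurable_left_value t : t \in `[0, 1] ->
  vmeasurable (fun w => left_value (Y w) t).
Proof.
by move=> tI; apply: vmeasurableB => //; [exact: vmeasurable_eval|exact: vmeasurable_jump].
Qed.

(** For each path a suitable window exists, so the bad events over the countable set of times [q],
    with windows [invS k], decrease to the empty set and one of them is small. Right-continuity then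
    extends the estimate from [q] to all times. *)
Lemma random_window (t gam eta : R) : t \in `[0, 1] -> 0 < gam -> 0 < eta ->
  exists2 a : R, 0 < a & exists B, [/\ measurable B, pr P B < eta &
    forall w, ~ B w -> forall s : R, s \in `[0, 1] ->
      (t - a < s < t -> `|Y w s - left_value (Y w) t| <= gam) /\
      (t <= s < t + a -> `|Y w s - Y w t| <= gam)].
Proof.
move=> tI gam0 eta0; have [q qd] := @right_dense_exists R; have [qI _] := qd.
pose B1 k i := [set w | (t - invS k < q i < t) /\
                  gam < `|Y w (q i) - left_value (Y w) t|].
pose B2 k i := [set w | (t <= q i < t + invS k) /\
                  gam < `|Y w (q i) - Y w t|].
pose B k := \bigcup_i (B1 k i `|` B2 k i).
have mB k : measurable (B k).
  apply: bigcup_measurable => i _; apply: measurableU.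
    apply/measurable_bool_and/measurable_fun_gt/vmeasurable_norm.
    apply: vmeasurableB => //; first exact: vmeasurable_eval.
    exact: vmeasurable_left_value.
  apply/measurable_bool_and/measurable_fun_gt/vmeasurable_norm.
  by apply: vmeasurableB => //; exact: vmeasurable_eval.
have [||k Bk] := pr_nonincreasing_lt (P := P) (e := eta) mB.
- apply/nonincreasing_seqP => k; apply/subsetPset => w [i _ [[] /= ? ?|[] /= ? ?]];
    have ki := le_invS (leqnSn k); exists i => //.
    by left; split=> //; apply/andP; split; lra.
  by right; split=> //; apply/andP; split; lra.
- rewrite (_ : \bigcap_k B k = set0) ?pr0//.
  apply/seteqP; split => // w wB.
  have [a a0 aY] := cadlag_local (Y w) tI gam0.
  have [k ka] := invS_lt a0; have [i _ [[/= ? /ltW + ]|[/= ? /ltW +]]] := wB k I.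
    by apply/negP; rewrite -ltNge; apply: (aY _ (qI i)).1; lra.
  by apply/negP; rewrite -ltNge; apply: (aY _ (qI i)).2; lra.
exists (invS k); first exact: invS_gt0.
exists (B k); split => // w Bw s sI.
have no i : (t - invS k < q i < t -> `|Y w (q i) - left_value (Y w) t| <= gam)
    /\ (t <= q i < t + invS k -> `|Y w (q i) - Y w t| <= gam).
  by split=> ?; rewrite leNgt; apply/negP => ?; apply: Bw; exists i => //; [left|right].
(* Half-open intervals matter: [s] is approximated from the right by some [q i] without leaving the
   interval. *)
have close (z : E) (lo hi : R) : lo <= s < hi ->
    (forall i, lo <= q i < hi -> `|Y w (q i) - z| <= gam) -> `|Y w s - z| <= gam.
  move=> /andP[los shi] qz; rewrite leNgt; apply/negP => zs.
  have [||i [/andP[sq qa] qr]] := right_dense_approx (Y w) (a := hi - s)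
    (rho := `|Y w s - z| - gam) qd sI; rewrite ?subr_gt0//.
  have : `|Y w (q i) - z| <= gam by apply: qz; lra.
  have := ler_distD (Y w (q i)) (Y w s) z; rewrite (distrC (Y w s) (Y w _)); lra.
split=> /andP[s1 s2].
  by apply: (close _ s t) => [|i ?]; [rewrite lexx|apply: (no i).1; lra].
by apply: (close _ t (t + invS k)) => [|i ?]; [rewrite s1|apply: (no i).2].
Qed.

Lemma random_three_point (gam eta : R) : 0 < gam -> 0 < eta ->
  exists2 a : R, 0 < a & exists B, [/\ measurable B, pr P B < eta &
    forall w, ~ B w -> forall s1 s2 s3 : R, 0 <= s1 -> s1 <= s2 -> s2 <= s3 ->
      s3 <= 1 -> s3 - s1 < a ->
      `|Y w s2 - Y w s1| <= gam \/ `|Y w s3 - Y w s2| <= gam].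
Proof.
move=> gam0 eta0; have [q qd] := @right_dense_exists R; have [qI _] := qd.
pose C i j l := [set w | gam < `|Y w (q j) - Y w (q i)|] `&`
                [set w | gam < `|Y w (q l) - Y w (q j)|].
pose B k := \bigcup_i \bigcup_j \bigcup_l
  [set w | [&& q i <= q j, q j <= q l & q l - q i < invS k] /\ C i j l w].
have mB k : measurable (B k).
  apply: bigcup_measurable => i _; apply: bigcup_measurable => j _.
  apply: bigcup_measurable => l _; apply: measurable_bool_and.
  by apply: measurableI; apply/measurable_fun_gt/vmeasurable_norm;
    apply: vmeasurableB => //; exact: vmeasurable_eval.
have [||k Bk] := pr_nonincreasing_lt (P := P) (e := eta) mB.
- apply/nonincreasing_seqP => k; apply/subsetPset => w [i _ [j _ [l _ [/= /and3P[? ? ?] ?]]]].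
  have ki := le_invS (leqnSn k).
  by exists i => //; exists j => //; exists l => //; split => //; apply/and3P; split => //; lra.
- rewrite (_ : \bigcap_k B k = set0) ?pr0//.
  apply/seteqP; split => // w wB.
  have [a a0 aY] := three_point_modulus (Y w) gam0.
  have [k ka] := invS_lt a0.
  have [i _ [j _ [l _ [/= /and3P[ij jl il] [/= c1 c2]]]]] := wB k I.
  have := qI i; have := qI l; rewrite !in_itv/= => /andP[_ l1] /andP[i0 _].
  by have [|] := aY _ _ _ i0 ij jl l1 (lt_trans il ka); rewrite leNgt ?c1 ?c2.
exists (invS k); first exact: invS_gt0.
exists (B k); split => // w Bw s1 s2 s3 s10.
(* Triples with coinciding points are trivial. Strict inequalities leave room to move each point
   slightly to the right into the range of [q] while keeping the order. *)
rewrite le_eqVlt => /predU1P[->|s12]; first by left; rewrite subrr normr0 ltW.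
rewrite le_eqVlt => /predU1P[->|s23] s31 s13; first by right; rewrite subrr normr0 ltW.
apply: contrapT => /not_orP[/negP + /negP]; rewrite -!ltNge => c1 c2; apply: Bw.
pose r1 := (`|Y w s2 - Y w s1| - gam) / 2; pose r2 := (`|Y w s3 - Y w s2| - gam) / 2.
pose r := Num.min r1 r2.
have r0 : 0 < r by rewrite lt_min !divr_gt0 ?subr_gt0.
have rr1 : r <= r1 by rewrite ge_min lexx.
have rr2 : r <= r2 by rewrite ge_min lexx orbT.
have I1 : s1 \in `[0, 1] by rewrite in_itv/=; lra.
have I2 : s2 \in `[0, 1] by rewrite in_itv/=; lra.
have I3 : s3 \in `[0, 1] by rewrite in_itv/=; lra.
have [||i [/andP[si is2] ri]] := right_dense_approx (Y w) (a := s2 - s1) (rho := r) qd I1;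
  rewrite ?subr_gt0//.
have [||j [/andP[sj js3] rj]] := right_dense_approx (Y w) (a := s3 - s2) (rho := r) qd I2;
  rewrite ?subr_gt0//.
have [||l [/andP[sl ls] rl]] := right_dense_approx (Y w) (rho := r)
  (a := invS k - (s3 - s1)) qd I3; rewrite ?subr_gt0//.
exists i => //; exists j => //; exists l => //; split.
  by apply/and3P; split; lra.
have far (y z y' z' : E) : gam < `|y - z| -> `|y' - y| < r -> `|z' - z| < r ->
    r <= (`|y - z| - gam) / 2 -> gam < `|y' - z'|.
  move=> yz yy zz ryz; have := ler_distD y' y z; have := ler_distD z' y' z.
  rewrite (distrC y y'); lra.
by split; [apply: far c1 rj ri rr1|apply: far c2 rl rj rr2].
Qed.

Lemma measurable_jump_gt t gam : t \in `[0, 1] ->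
  measurable [set w | gam < `|jump (Y w) t|].
Proof. by move=> tI; apply/measurable_fun_gt/vmeasurable_norm/vmeasurable_jump. Qed.

(** Otherwise, along a sequence of distinct such times, the events of a jump larger than [gam] would
    have a nonempty limsup: one path would have infinitely many such jumps, accumulating at some [t]
    against [jump_local]. *)
Lemma finite_jump_times (gam p : R) : 0 < gam -> 0 < p ->
  finite_set [set t | t \in `[0, 1] /\ p <= pr P [set w | gam < `|jump (Y w) t|]].
Proof.
move=> gam0 p0; apply: contrapT => /infiniteP /pcard_leP[u].
pose A k := [set w | gam < `|jump (Y w) (u k)|].
have uA k : u k \in `[0, 1] /\ p <= pr P (A k) by exact: (@funS _ _ _ _ u).
have uinj : injective u by move=> i j; apply: inj; rewrite inE.
have mA k : measurable (A k) by apply: measurable_jump_gt; exact: (uA k).1.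
pose L n := \bigcup_(k in [set k | (n <= k)%N]) A k.
have mL n : measurable (L n) by apply: bigcup_measurable => k _; exact: mA.
have [w wL] : \bigcap_n L n !=set0.
  apply/set0P/eqP => L0.
  have [||n] := pr_nonincreasing_lt (P := P) (e := p) mL.
  - by move=> m n mn; apply/subsetPset => w [k /= nk Ak]; exists k => //=; exact: leq_trans nk.
  - by rewrite L0 pr0.
  - apply/negP; rewrite -leNgt; apply: le_trans (uA n).2 _.
    by apply: le_pr => // w Aw; exists n => /=.
have /choice[k kP] : forall n, exists k, (n <= k)%N /\ A k w.
  by move=> n; have [k nk Ak] := wL n I; exists k.
have [|t tI tk] := @compact_sequence R (fun n => u (k n)).
  by move=> n; exact: (uA _).1.
have [a a0 aJ] := jump_local (Y w) tI gam0.
have [N Nt] : exists N, forall n, (N <= n)%N -> u n != t.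
  have [[N <-]|noN] := pselect (exists N, u N = t).
    by exists N.+1 => n Nn; apply/eqP => /uinj nN; rewrite nN ltnn in Nn.
  by exists 0%N => n _; apply/eqP => un; apply: noN; exists n.
have [n Nn nt] := tk a N a0; have [nk /=] := kP n.
apply/negP; rewrite -leNgt; apply: aJ => //; first exact: (uA _).1.
by apply: Nt; exact: leq_trans nk.
Qed.

Definition jump_free (t : R) := t \in `[0, 1] /\
  (t = 1 \/ pr P [set w | 0 < `|jump (Y w) t|] = 0).

Lemma jump_free_stable t : jump_free t -> stable_at P Y t.
Proof.
move=> [tI tJ]; split=> //; case: tJ => [|J0]; first by left.
right=> gam eta gam0 eta0; have [a a0 [B [mB PB YB]]] := random_window tI gam0 eta0.
exists a => //; exists (B `|` [set w | 0 < `|jump (Y w) t|]).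
have mJ := @measurable_jump_gt t 0 tI.
split; first exact: measurableU.
  by have := prU_le P mB mJ; rewrite J0; lra.
move=> w /not_orP[Bw /negP Jw] s sI; rewrite ltr_distl => /andP[s1 s2].
have JY : jump (Y w) t = 0 by apply/eqP; rewrite -normr_le0 leNgt.
have [st|ts] := ltP s t; last by apply: (YB w Bw s sI).2; rewrite ts.
have := (YB w Bw s sI).1; rewrite /left_value JY subr0; apply.
by rewrite s1.
Qed.

Lemma jump_free0 : jump_free 0.
Proof.
split; first by rewrite in_itv/= lexx ler01.
right; rewrite (_ : [set w | _] = set0) ?pr0//.
by apply/seteqP; split => w //=; rewrite /jump eqxx normr0 ltxx.
Qed.

Lemma jump_free1 : jump_free 1.
Proof. by split; [rewrite in_itv/= ler01 lexx|left]. Qed.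

(** The other times lie in a countable union of finite sets, which cannot cover an interval of
    positive Lebesgue measure. *)
Lemma jump_free_dense (a b : R) : 0 <= a -> a < b -> b <= 1 ->
  exists t, a < t < b /\ jump_free t.
Proof.
move=> a0 ab b1.
pose N k := [set t | t \in `[0, 1] /\
  invS k <= pr P [set w | invS k < `|jump (Y w) t|]].
have cN : countable (\bigcup_k N k).
  by apply: bigcup_countable => // k _; apply/finite_set_countable/finite_jump_times;
    exact: invS_gt0.
have abN : ~ (`]a, b[%classic `<=` \bigcup_k N k).
  move=> abN.
  have c0 := countable_lebesgue_measure0 (sub_countable (subset_card_le abN) cN).
  by move: c0; rewrite lebesgue_measure_itv/= lte_fin ab -EFinB => -[]; lra.
apply: contrapT => no; apply: abN => t /=; rewrite in_itv/= => tab.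
have tI : t \in `[0, 1] by rewrite in_itv/=; lra.
apply: contrapT => tN; apply: no; exists t; split=> //; split => //; right.
rewrite (_ : [set w | _] = \bigcup_k [set w | invS k < `|jump (Y w) t|]); last first.
  apply/seteqP; split => w /=; first by move=> /invS_lt[k ?]; exists k.
  by move=> [k _]; apply: lt_trans; exact: invS_gt0.
apply: pr_bigcup_eq0 => k; first exact: measurable_jump_gt.
apply/le_anti; rewrite pr_ge0 andbT leNgt; apply/negP => pk.
have [n nk] := invS_lt pk; apply: tN; exists (maxn n k) => //; split => //.
apply: (@le_trans _ _ (invS n)); first by apply: le_invS; exact: leq_maxl.
apply: ltW; apply: lt_le_trans nk _; apply: le_pr; [exact: measurable_jump_gt..|].
by move=> w /=; apply: le_lt_trans; apply: le_invS; exact: leq_maxr.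
Qed.

End RandomPaths.

Section IndependentExpectation.
Context {R : realType} {d : measure_display} {T : measurableType d}.
Variable P : probability T R.

Lemma bounded_integrable d' (T' : measurableType d') (P' : probability T' R)
    (f : T' -> R) (M : R) : measurable_fun setT f -> (forall w, `|f w| <= M) ->
  P'.-integrable setT (EFin \o f).
Proof.
move=> mf fM; apply: measurable_bounded_integrable => //.
  by apply: le_lt_trans (probability_le1 P' measurableT) _; rewrite ltry.
exists M; split; rewrite ?num_real// => M' MM' w _ /=.
exact: le_trans (fM w) (ltW MM').
Qed.

(** By uniqueness of the product measure, the joint law of [a] and [b] is the product of their laws;
    the formula is then Fubini's theorem for these laws. *)
Lemma Rintegral_indep (g h : R -> R) (a b : T -> R) (M : R) :
  measurable_fun setT a -> measurable_fun setT b ->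
  (forall U V, measurable U -> measurable V ->
    pr P (a @^-1` U `&` b @^-1` V) = pr P (a @^-1` U) * pr P (b @^-1` V)) ->
  measurable_fun setT g -> measurable_fun setT h ->
  (forall x, `|g x| <= M) -> (forall x, `|h x| <= M) ->
  \int[P]_w (g (a w) * h (b w)) = \int[P]_w g (a w) * \int[P]_w h (b w).
Proof.
move=> ma mb ab mg mh gM hM.
pose fa : {mfun T >-> R} := HB.pack a (isMeasurableFun.Build _ _ _ _ a ma).
pose fb : {mfun T >-> R} := HB.pack b (isMeasurableFun.Build _ _ _ _ b mb).
have mab : measurable_fun setT (fun w => (a w, b w)) by exact: measurable_fun_pair.
pose fab : {mfun T >-> (R * R)%type} :=
  HB.pack (fun w => (a w, b w)) (isMeasurableFun.Build _ _ _ _ _ mab).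
pose Pa := distribution P fa; pose Pb := distribution P fb.
have prod_ab : forall X, measurable X -> (Pa \x Pb)%E X = distribution P fab X.
  apply: product_measure_unique => U V mU mV.
  rewrite /Pa /Pb /distribution /pushforward/=.
  have mU' : measurable (a @^-1` U).
    by rewrite -[X in measurable X]setTI; exact: (ma measurableT _ mU).
  have mV' : measurable (b @^-1` V).
    by rewrite -[X in measurable X]setTI; exact: (mb measurableT _ mV).
  change (P (a @^-1` U `&` b @^-1` V) = P (a @^-1` U) * P (b @^-1` V))%E.
  by rewrite (prE P (measurableI _ _ mU' mV')) ab// EFinM -!prE.
have M0 : 0 <= M by apply: le_trans (gM 0).
pose k (z : R * R) := g z.1 * h z.2.
have mk : measurable_fun setT k.
  apply: measurable_funM.
    exact: (measurableT_comp mg measurable_fst).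
  exact: (measurableT_comp mh measurable_snd).
have kM z : `|k z| <= M * M by rewrite normrM ler_pM.
rewrite /Rintegral.
transitivity (fine (\int[distribution P fab]_z (k z)%:E)).
  rewrite integral_distribution//; first exact/measurable_EFinP.
  apply: (@bounded_integrable _ _ _ _ (M * M)); first exact: measurableT_comp.
  by move=> w /=; exact: kM.
rewrite (eq_measure_integral (Pa \x Pb)%E); last by move=> X mX _; exact/esym/prod_ab.
rewrite -integral12_prod_meas1; last first.
  apply: (@bounded_integrable _ _ _ _ (M * M)) => //.
have ia : Pa.-integrable setT (EFin \o g) by exact: bounded_integrable gM.
have ib : Pb.-integrable setT (EFin \o h) by exact: bounded_integrable hM.
have Ea : (\int[Pa]_x (g x)%:E)%E = (\int[P]_w (g (a w))%:E)%E.
  rewrite integral_distribution//; first exact/measurable_EFinP.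
  by apply: bounded_integrable (fun w => gM (a w)); exact: measurableT_comp.
have Eb : (\int[Pb]_x (h x)%:E)%E = (\int[P]_w (h (b w))%:E)%E.
  rewrite integral_distribution//; first exact/measurable_EFinP.
  by apply: bounded_integrable (fun w => hM (b w)); exact: measurableT_comp.
rewrite -Ea -Eb -fineM; [|exact: integrable_fin_num..].
have [r rE] : exists r : R, (\int[Pb]_x (h x)%:E)%E = r%:E.
  exists (fine (\int[Pb]_x (h x)%:E)%E).
  by rewrite fineK//; exact: integrable_fin_num.
congr fine; rewrite rE -integralZr//; apply: eq_integral => x _.
rewrite /fubini_F /k /= -rE; under eq_integral do rewrite EFinM.
by rewrite integralZl.
Qed.

End IndependentExpectation.

(** * Convergence at a fixed time *)

Section Trigonometry.
Context {R : realType}.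

Lemma cos_lipschitz (a b : R) : `|cos a - cos b| <= `|a - b|.
Proof.
wlog ab : a b / a < b => [H|].
  have [/H//|ba|->] := ltgtP a b; last by rewrite !subrr.
  by rewrite distrC (distrC a); exact: H.
rewrite distrC (distrC a); have [|c _ ->] := @MVT R cos (fun x => - sin x) a b ab.
  exact/continuous_subspaceT/continuous_cos.
by rewrite normrM normrN ler_piMl// sin_max.
Qed.

Lemma sin_lipschitz (a b : R) : `|sin a - sin b| <= `|a - b|.
Proof.
wlog ab : a b / a < b => [H|].
  have [/H//|ba|->] := ltgtP a b; last by rewrite !subrr.
  by rewrite distrC (distrC a); exact: H.
rewrite distrC (distrC a); have [|c _ ->] := @MVT R sin cos a b ab.
  exact/continuous_subspaceT/continuous_sin.
by rewrite normrM ler_piMl// cos_max.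
Qed.

End Trigonometry.

Section PartialSums.
Context {R : realType} {d : measure_display} {T : measurableType d}.
Variable P : probability T R.
Context {E : normedModType R}.
Hypothesis sepE : separable E.
Variable X : nat -> {RV P >-> cadlag01 E}.
Hypothesis X_indep : independent_RVs X.
Variable S : nat -> T -> cadlag01 E.
Hypothesis S_def : forall n w, S n w = \sum_(j < n) X j w.

Lemma partial_sum_eval n w t : S n w t = \sum_(0 <= j < n) X j w t.
Proof.
rewrite S_def big_mkord.
by elim/big_rec2: _ => // j y x _ <-.
Qed.

Lemma increment_eval m n w t : (m <= n)%N ->
  S n w t - S m w t = \sum_(m <= j < n) X j w t.
Proof.
move=> mn; rewrite !partial_sum_eval (big_cat_nat (leq0n m) mn)//=.
by rewrite addrAC subrr add0r.
Qed.

(** A copy of [T] with a smaller sigma-algebra: dependence on the first [m] terms becomes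
    measurability on [past m], preserved by all measurable operations, and likewise for the
    remaining terms on [future m]. *)
Definition past m := g_sigma_algebraType (rectangles X [set j | (j < m)%N]).
Definition future m := g_sigma_algebraType (rectangles X [set j | (m <= j)%N]).

Lemma vmeasurable_term (I : set nat) j t : I j ->
  @vmeasurable R E _ (g_sigma_algebraType (rectangles X I)) (fun w => X j w t).
Proof.
move=> Ij; have [tI|tI] := boolP (t \in `[0, 1]); last first.
  rewrite (_ : (fun w => X j w t) = fun=> 0); first exact: vmeasurable_cst.
  by apply/funext => w; rewrite cadlag_out.
apply: vmeasurable_borel => U oU; apply: sub_sigma_algebra.
exists [fset j]%fset, (fun _ => [set x : cadlag01 E | U (x t)]); split.
- by move=> i; rewrite inE => /eqP ->.
- move=> _; apply: sub_sigma_algebra; exists t, U; split => //.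
  exact: sub_sigma_algebra.
- apply/seteqP; split => w /=; first by move=> Uw i; rewrite /= inE => /eqP ->.
  by move=> /(_ j); apply; rewrite /= inE.
Qed.

Lemma past_partial_sum m k t : (k <= m)%N ->
  @vmeasurable R E _ (past m) (fun w => S k w t).
Proof.
move=> km; rewrite (_ : (fun w => S k w t) =
  fun w => \sum_(j <- index_iota 0 k) X j w t); last first.
  by apply/funext => w; rewrite partial_sum_eval.
apply: vmeasurable_sum => // j; rewrite mem_index_iota => /andP[_ jk].
by apply: vmeasurable_term; exact: leq_trans km.
Qed.

Lemma future_increment m k n t : (m <= k <= n)%N ->
  @vmeasurable R E _ (future m) (fun w => S n w t - S k w t).
Proof.
move=> /andP[mk kn]; rewrite (_ : (fun w => S n w t - S k w t) =
  fun w => \sum_(j <- index_iota k n) X j w t); last first.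
  by apply/funext => w; rewrite increment_eval.
apply: vmeasurable_sum => // j; rewrite mem_index_iota => /andP[kj _].
by apply: vmeasurable_term; exact: leq_trans mk kj.
Qed.

Lemma vmeasurable_partial_sum n t : vmeasurable (fun w => S n w t).
Proof.
under eq_fun do rewrite partial_sum_eval.
by apply: vmeasurable_sum => // j _; exact: vmeasurable_eval.
Qed.

Lemma past_future_indep m (A B : set T) :
  measurable (A : set (past m)) -> measurable (B : set (future m)) ->
  pr P (A `&` B) = pr P A * pr P B.
Proof.
move=> mA mB; apply: sigma_indep X_indep mA mB.
by apply/seteqP; split => j //= []; rewrite ltnNge => /negP.
Qed.

Lemma past_measurable m (A : set T) : measurable (A : set (past m)) -> measurable A.
Proof. exact: rectangles_sigma_measurable. Qed.

Lemma future_measurable m (A : set T) : measurable (A : set (future m)) -> measurable A.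
Proof. exact: rectangles_sigma_measurable. Qed.

Variable Y : {RV P >-> cadlag01 E}.
Hypothesis S_cvg : cvg_in_distribution P S Y.

Section CharacteristicFunction.
Variable t : R.
Hypothesis t_stable : stable_at P Y t.
Variable f : E -> R.
Hypothesis fD : forall x y, f (x + y) = f x + f y.
Hypothesis f_le : forall x, `|f x| <= `|x|.

Lemma additive_lipschitz x y : `|f x - f y| <= 1 * `|x - y|.
Proof.
have -> : f x - f y = f (x - y).
  by have := fD (x - y) y; rewrite subrK => ->; rewrite addrK.
by rewrite mul1r.
Qed.

Lemma measurable_char d' (M : measurableType d') (g : R -> R) (z : M -> E) (u : R) :
  continuous g -> vmeasurable z -> measurable_fun setT (fun w => g (u * f (z w))).
Proof.
move=> cg mz; apply: measurableT_comp; first exact: continuous_measurable_fun.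
apply: measurable_funM => //; exact: measurable_lipschitz additive_lipschitz mz.
Qed.

Lemma char_near (g : R -> R) (u eta : R) : continuous g ->
  (forall x, `|g x| <= 1) -> (forall x y, `|g x - g y| <= `|x - y|) -> 0 < eta ->
  \forall n \near \oo,
    `|\int[P]_w g (u * f (S n w t)) - \int[P]_w g (u * f (Y w t))| < eta.
Proof.
move=> cg g1 gL eta0.
(* This maps [g] affinely into the unit interval; the signs [c = 1] and [c = -1] yield the two
   one-sided bounds. *)
pose h (c : R) (x : R -> E) := (1 + c * g (u * f (x t))) / 2.
have ExM (c : R) (z : T -> R -> E) : vmeasurable (fun w => z w t) ->
    Ex P (fun w => h c (z w)) = (1 + c * \int[P]_w g (u * f (z w t))) / 2.
  move=> mz; have mg := measurable_char u cg mz.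
  have ig : P.-integrable setT (EFin \o (fun w => g (u * f (z w t)))).
    exact: bounded_integrable (fun w => g1 _).
  have icg : P.-integrable setT (EFin \o (fun w => c * g (u * f (z w t)))).
    apply: (@bounded_integrable _ _ _ _ _ `|c|); first exact: measurable_funM.
    by move=> w; rewrite normrM ler_piMr.
  have i1 : P.-integrable setT (EFin \o (fun _ : T => 1 : R)).
    by apply: (@bounded_integrable _ _ _ _ _ 1) => // w; rewrite normr1.
  rewrite /Ex unlock -/(Rintegral _ _ _) /h RintegralZr//; last first.
    apply: (@bounded_integrable _ _ _ _ _ (1 + `|c|)).
      by apply: measurable_funD => //; exact: measurable_funM.
    move=> w; apply: le_trans (ler_normD _ _) _.
    by rewrite normr1 lerD2l normrM ler_piMr.
  by rewrite RintegralD// RintegralZl// Rintegral_cst// mul1r -/(pr P setT) prT.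
have near1 (c : R) : `|c| = 1 ->
    \forall n \near \oo, c * \int[P]_w g (u * f (S n w t)) <
                        c * \int[P]_w g (u * f (Y w t)) + eta.
  move=> c1; have eta2 : 0 < eta / 2 by rewrite divr_gt0.
  have : \forall n \near \oo, Ex P (fun w => h c (S n w)) <
      Ex P (fun w => h c (Y w)) + eta / 2.
    apply: (@fdd_near _ _ _ _ _ _ _ S_cvg [:: t] (h c) `|u|) => //.
    - by move=> s; rewrite inE => /eqP ->.
    - move=> x; have : `|c * g (u * f (x t))| <= 1 by rewrite normrM c1 mul1r.
      by rewrite ler_norml /h => /andP[? ?]; lra.
    - move=> r x x' xx; rewrite /h -mulrBl opprD addrACA subrr add0r -mulrBr.
      rewrite !normrM c1 mul1r (gtr0_norm (x := 2^-1)) ?invr_gt0//.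
      have : `|g (u * f (x t)) - g (u * f (x' t))| <= `|u| * r.
        apply: le_trans (gL _ _) _; rewrite -mulrBr normrM ler_wpM2l//.
        apply: le_trans (additive_lipschitz _ _) _; rewrite mul1r; apply: xx.
        by rewrite mem_head.
      have := normr_ge0 (g (u * f (x t)) - g (u * f (x' t))); lra.
    - apply: measurable_funM => //; apply: measurable_funD => //.
      apply: measurable_funM => //; apply: measurable_char => //.
      exact: vmeasurable_eval.
  apply: filterS => n; rewrite !ExM; [lra|exact: vmeasurable_eval|].
  exact: vmeasurable_partial_sum.
near=> n; rewrite ltr_distl; apply/andP; split.
  have : -1 * \int[P]_w g (u * f (S n w t)) < -1 * \int[P]_w g (u * f (Y w t)) + eta.
    by near: n; apply: near1; rewrite normrN normr1.
  lra.
have : 1 * \int[P]_w g (u * f (S n w t)) < 1 * \int[P]_w g (u * f (Y w t)) + eta.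
  by near: n; apply: near1; rewrite normr1.
lra.
Unshelve. all: by end_near. Qed.

(* With [phi_k = E exp(i u f(S_k))] this is the real part of
   [E exp(i u f(S_n - S_m)) |phi_m|^2 = phi_n conj(phi_m)]. *)
Lemma char_increment_identity (m n : nat) (u : R) : (m <= n)%N ->
  let c k := \int[P]_w cos (u * f (S k w t)) in
  let s k := \int[P]_w sin (u * f (S k w t)) in
  (\int[P]_w cos (u * f (S n w t - S m w t))) * (c m ^+ 2 + s m ^+ 2) =
  c n * c m + s n * s m.
Proof.
move=> mn c s.
pose A w := f (S m w t); pose B w := f (S n w t - S m w t).
have mpA : measurable_fun (setT : set (past m)) A.
  by apply: measurable_lipschitz additive_lipschitz _ => //; exact: past_partial_sum.
have mfB : measurable_fun (setT : set (future m)) B.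
  apply: measurable_lipschitz additive_lipschitz _ => //.
  by apply: future_increment; rewrite leqnn.
have vB : vmeasurable (fun w => S n w t - S m w t).
  by apply: vmeasurableB => //; exact: vmeasurable_partial_sum.
have mA : measurable_fun setT A.
  by apply: measurable_lipschitz additive_lipschitz _ => //; exact: vmeasurable_partial_sum.
have mB : measurable_fun setT B.
  exact: measurable_lipschitz additive_lipschitz vB.
have AB U V : measurable U -> measurable V ->
    pr P (A @^-1` U `&` B @^-1` V) = pr P (A @^-1` U) * pr P (B @^-1` V).
  move=> mU mV; apply: (@past_future_indep m).
    by have := mpA measurableT _ mU; rewrite setTI.
  by have := mfB measurableT _ mV; rewrite setTI.
have nE w : f (S n w t) = A w + B w by rewrite -fD addrC subrK.
have mu : measurable_fun setT ( *%R u) by exact: mulrl_measurable.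
have mcos : measurable_fun setT (fun x : R => cos (u * x)).
  exact: (measurableT_comp (continuous_measurable_fun (@continuous_cos R)) mu).
have msin : measurable_fun setT (fun x : R => sin (u * x)).
  exact: (measurableT_comp (continuous_measurable_fun (@continuous_sin R)) mu).
have bcos (x : R) : `|cos (u * x)| <= 1 by exact: cos_max.
have bsin (x : R) : `|sin (u * x)| <= 1 by exact: sin_max.
have prod_int (g h : R -> R) : measurable_fun setT g -> measurable_fun setT h ->
    (forall x, `|g x| <= 1) -> (forall x, `|h x| <= 1) ->
    P.-integrable setT (EFin \o (fun w => g (A w) * h (B w))).
  move=> mg mh g1 h1; apply: (@bounded_integrable _ _ _ _ _ 1).
    by apply: measurable_funM; [exact: measurableT_comp mA|exact: measurableT_comp mB].
  by move=> w; rewrite normrM mulr_ile1.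
pose cR := \int[P]_w cos (u * B w); pose sR := \int[P]_w sin (u * B w).
have cn : c n = c m * cR - s m * sR.
  rewrite /c; under eq_Rintegral do rewrite nE mulrDr cosD.
  rewrite RintegralB//; [|exact: (prod_int (fun x => cos (u * x)) (fun x => cos (u * x)))
    |exact: (prod_int (fun x => sin (u * x)) (fun x => sin (u * x)))].
  rewrite (Rintegral_indep mA mB AB mcos mcos bcos bcos).
  by rewrite (Rintegral_indep mA mB AB msin msin bsin bsin).
have sn : s n = s m * cR + c m * sR.
  rewrite /s; under eq_Rintegral do rewrite nE mulrDr sinD.
  rewrite RintegralD//; [|exact: (prod_int (fun x => sin (u * x)) (fun x => cos (u * x)))
    |exact: (prod_int (fun x => cos (u * x)) (fun x => sin (u * x)))].
  rewrite (Rintegral_indep mA mB AB msin mcos bsin bcos).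
  by rewrite (Rintegral_indep mA mB AB mcos msin bcos bsin).
by rewrite -/cR cn sn; ring.
Qed.

(** The identity gives [(1 - c) |phi_m|^2 = Re (phi_m conj(phi_m - phi_n))]. The right-hand side is
    small because both characteristic functions are close to that of [Y], and the lower bound [kap]
    on the real part of [phi_m] permits division. *)
Lemma char_increment_near (u eta kap : R) : 0 < eta -> 0 < kap ->
  (\forall m \near \oo, kap <= \int[P]_w cos (u * f (S m w t))) ->
  exists N, forall m n, (N <= m)%N -> (m <= n)%N ->
    1 - \int[P]_w cos (u * f (S n w t - S m w t)) < eta.
Proof.
move=> eta0 kap0 [N0 _ kc].
pose e := eta * kap ^+ 2 / 8.
have e0 : 0 < e by rewrite !mulr_gt0 ?exprn_gt0.
have [N1 _ N1c] := char_near u (@continuous_cos R) (@cos_max R) (@cos_lipschitz R) e0.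
have [N2 _ N2s] := char_near u (@continuous_sin R) (@sin_max R) (@sin_lipschitz R) e0.
exists (maxn N0 (maxn N1 N2)) => m n; rewrite !geq_max => /and3P[m0 m1 m2] mn.
have := char_increment_identity u mn.
set c := \int[P]_w cos (u * f (S n w t - S m w t)) => /=.
have := kc m m0 => /=; have := N1c m m1 => /=; have := N2s m m2 => /=.
have := N1c n (leq_trans m1 mn) => /=; have := N2s n (leq_trans m2 mn) => /=.
set cm := \int[P]_w cos (u * f (S m w t)); set sm := \int[P]_w sin (u * f (S m w t)).
set cn := \int[P]_w cos (u * f (S n w t)); set sn := \int[P]_w sin (u * f (S n w t)).
set sy := \int[P]_w _; set cy := \int[P]_w _ => sny cny smy cmy km eqn.
have b1 (g : R -> R) k : continuous g -> (forall x, `|g x| <= 1) ->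
    `|\int[P]_w g (u * f (S k w t))| <= 1.
  move=> cg g1; have mg := measurable_char u cg (vmeasurable_partial_sum k t).
  have ig : P.-integrable setT (EFin \o (fun w => g (u * f (S k w t)))).
    exact: bounded_integrable (fun w => g1 _).
  apply: le_trans (le_normr_Rintegral _ ig) _ => //.
  apply: (@le_trans _ _ (\int[P]_w (1 : R))).
    apply: le_Rintegral => //.
      apply: (@bounded_integrable _ _ _ _ _ 1); first exact: measurableT_comp.
      by move=> w; rewrite normr_id.
    by apply: (@bounded_integrable _ _ _ _ _ 1) => // w; rewrite normr1.
  by rewrite Rintegral_cst// mul1r -/(pr P setT) prT.
have cm1 : `|cm| <= 1 by exact: b1 (@continuous_cos R) (@cos_max R).
have sm1 : `|sm| <= 1 by exact: b1 (@continuous_sin R) (@sin_max R).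
have dc : `|cm - cn| < 2 * e.
  by have := ler_distD cy cm cn; rewrite (distrC cy); lra.
have ds : `|sm - sn| < 2 * e.
  by have := ler_distD sy sm sn; rewrite (distrC sy); lra.
have kk : kap ^+ 2 <= cm ^+ 2 + sm ^+ 2.
  apply: le_trans (_ : cm ^+ 2 <= _); last by rewrite lerDl sqr_ge0.
  have cm0 : 0 < cm by exact: lt_le_trans km.
  by rewrite ler_sqr ?nnegrE// ltW.
have lt4 : (1 - c) * (cm ^+ 2 + sm ^+ 2) < 8 * e.
  have -> : (1 - c) * (cm ^+ 2 + sm ^+ 2) = cm * (cm - cn) + sm * (sm - sn).
    by rewrite mulrBl eqn; ring.
  apply: le_lt_trans (ler_norm _) _; apply: le_lt_trans (ler_normD _ _) _.
  rewrite !normrM.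
  have : `|cm| * `|cm - cn| <= `|cm - cn| by rewrite ler_piMl.
  have : `|sm| * `|sm - sn| <= `|sm - sn| by rewrite ler_piMl.
  lra.
rewrite ltNge; apply/negP => etac.
have : eta * kap ^+ 2 <= (1 - c) * (cm ^+ 2 + sm ^+ 2).
  by apply: ler_pM => //; [exact: ltW|exact: sqr_ge0].
rewrite /e in lt4; lra.
Qed.

End CharacteristicFunction.

End PartialSums.

Section PointwiseCauchy.
Context {R : realType} {d : measure_display} {T : measurableType d}.
Variable P : probability T R.
Context {E : normedModType R}.
Hypothesis sepE : separable E.

Lemma pr_bigcup_le (A : nat -> set T) (K : nat) (e : R) :
  (forall i, measurable (A i)) -> (forall i, (i < K)%N -> pr P (A i) <= e) ->
  pr P (\bigcup_(i in `I_K) A i) <= K%:R * e.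
Proof.
move=> mA; elim: K => [|K ih] Ae.
  by rewrite bigcup_mkord big_ord0 pr0 mul0r.
rewrite bigcup_mkord big_ord_recr/= -bigcup_mkord.
apply: le_trans (prU_le _ _ _) _ => //.
  by apply: bigcup_measurable => i _; exact: mA.
rewrite -natr1 mulrDl mul1r lerD ?Ae//.
by apply: ih => i iK; apply: Ae; rewrite ltnW.
Qed.

Section DistanceToFinite.
Variable q : nat -> E.

Fixpoint dist_to (K : nat) (z : E) : R :=
  if K is K'.+1 then Num.min (dist_to K' z) `|z - q K| else `|z - q 0|.

Lemma dist_to_lipschitz K (z z' : E) : `|dist_to K z - dist_to K z'| <= 1 * `|z - z'|.
Proof.
have L i : `| `|z - q i| - `|z' - q i| | <= `|z - z'|.
  by apply: le_trans (ler_dist_dist _ _) _; rewrite subrBB.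
by rewrite mul1r; elim: K => [|K ih] /=; [exact: L|exact: dist_min].
Qed.

Lemma dist_to_ge K (z : E) (r : R) : (forall i, (i <= K)%N -> r <= `|z - q i|) ->
  r <= dist_to K z.
Proof.
elim: K => [|K ih] rz /=; first exact: rz.
by rewrite le_min rz// ih// => i iK; apply: rz; exact: leqW.
Qed.

Lemma dist_to_le K (z : E) i : (i <= K)%N -> dist_to K z <= `|z - q i|.
Proof.
elim: K => [|K ih] /=; first by rewrite leqn0 => /eqP ->.
by rewrite ge_min leq_eqVlt => /predU1P[->|/ih ->]//; rewrite lexx orbT.
Qed.

End DistanceToFinite.

Variable X : nat -> {RV P >-> cadlag01 E}.
Hypothesis X_indep : independent_RVs X.
Variable S : nat -> T -> cadlag01 E.
Hypothesis S_def : forall n w, S n w = \sum_(j < n) X j w.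
Variable Y : {RV P >-> cadlag01 E}.
Hypothesis S_cvg : cvg_in_distribution P S Y.
Variable t : R.
Hypothesis t_stable : stable_at P Y t.

Let vS n s := vmeasurable_partial_sum sepE S_def n s.

(** Separability gives tightness by finitely many balls: the distance from [Y w t] to the first [K]
    points of a dense sequence tends to 0, and this distance is Lipschitz, so the bound passes to
    [S n]. *)
Lemma marginal_tight (q : nat -> E) (eps eta : R) :
  (forall x (e : R), 0 < e -> exists i, `|x - q i| < e) -> 0 < eps -> 0 < eta ->
  exists K, \forall n \near \oo, forall A, measurable A ->
    (forall w, A w -> forall i, (i <= K)%N -> 2 * eps <= `|S n w t - q i|) ->
    pr P A < eta.
Proof.
move=> qE eps0 eta0.
pose B K := [set w | eps < dist_to q K (Y w t)].
have mD K : measurable_fun setT (fun w => dist_to q K (Y w t)).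
  apply: measurable_lipschitz (dist_to_lipschitz q K) _ => //.
  exact: vmeasurable_eval.
have mB K : measurable (B K) by exact: measurable_fun_gt.
have [||K BK] := pr_nonincreasing_lt (P := P) (e := eta) mB.
- apply/nonincreasing_seqP => K; apply/subsetPset => w /=.
  by rewrite /B /= lt_min => /andP[].
- rewrite (_ : \bigcap_k B k = set0) ?pr0//; apply/seteqP; split => // w wB.
  have [i iY] := qE (Y w t) eps eps0; have /= := wB i I.
  by apply/negP; rewrite -leNgt (le_trans (dist_to_le q _ (leqnn i)))// ltW.
exists K.
have := fdd_pr_near S_cvg (L := [:: t]) (h := fun x => dist_to q K (x t)) (C := 1)
  (r := eps) (eta := eta).
move=> /(_ _ _ eps0 _ (mD K) BK) [||g x x' xx|N _ SN].
- by move=> s; rewrite inE => /eqP ->.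
- exact: ler01.
- apply: le_trans (dist_to_lipschitz _ _ _ _) _; rewrite !mul1r; apply: xx.
  by rewrite mem_head.
exists N => // n Nn A mA SA; apply: (SN n Nn) => // w /SA Sw.
exact: dist_to_ge.
Qed.

(** Let [f] norm [b]. If the increment is [eps]-close to [b], then [f] of it lies between [eps] and
    [M], so [1 - cos (u f)] is at least the fixed positive number [del], while its expectation is
    small; a Markov bound concludes. *)
Lemma increment_avoids (b : E) (eps M eta : R) :
  0 < eps -> 2 * eps <= `|b| -> `|b| + eps <= M -> 0 < eta ->
  (forall f : E -> R, (forall x y, f (x + y) = f x + f y) ->
    (forall x, `|f x| <= `|x|) ->
    \forall m \near \oo, 1 / 8 <= \int[P]_w cos (M^-1 / 2 * f (S m w t))) ->
  exists N, forall m n, (N <= m)%N -> (m <= n)%N -> forall A, measurable A ->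
    (forall w, A w -> `|S n w t - S m w t - b| < eps) -> pr P A < eta.
Proof.
move=> eps0 epsb bM eta0 low.
have M0 : 0 < M by lra.
(* With this scale [u * f] stays in the interval from 0 to 1/2, where the cosine is decreasing. *)
pose u := M^-1 / 2; have u0 : 0 < u by rewrite divr_gt0 ?invr_gt0.
have uM : u * M = 2^-1 by rewrite /u mulrAC mulVf ?mul1r// gt_eqF.
have [f [fD fle fb]] := norming_functional b.
have pi2 := pi_ge2 R.
pose del := 1 - cos (u * eps).
have ueps : 0 < u * eps by rewrite mulr_gt0.
have ueM : u * eps <= 2^-1 by rewrite -uM ler_pM2l//; lra.
have del0 : 0 < del.
  rewrite subr_gt0 -[ltRHS]cos0 ltr_cos// in_itv/= ?lexx; lra.
have [N NP] := char_increment_near sepE X_indep S_def S_cvg t_stable fD fle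
  (u := u) (mulr_gt0 eta0 del0) (ltac:(lra) : 0 < 1 / 8 :> R) (low f fD fle).
exists N => m n Nm mn A mA AP.
have := NP m n Nm mn; set c := \int[P]_w _ => cdel.
have vR : vmeasurable (fun w => S n w t - S m w t) by exact: vmeasurableB.
have mcos : measurable_fun setT (fun w => cos (u * f (S n w t - S m w t))).
  exact: (measurable_char sepE fD fle u (@continuous_cos R) vR).
have icos : P.-integrable setT (EFin \o (fun w => cos (u * f (S n w t - S m w t)))).
  by apply: (@bounded_integrable _ _ _ _ _ 1) => // w; exact: cos_max.
have i1 : P.-integrable setT (EFin \o (fun _ : T => 1 : R)).
  by apply: (@bounded_integrable _ _ _ _ _ 1) => // w; rewrite normr1.
have iA : P.-integrable setT (EFin \o (fun w => del * (\1_A w : R))).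
  apply: (@bounded_integrable _ _ _ _ _ del).
    by apply: measurable_funM => //; exact: measurable_indic.
  move=> w; rewrite indicE; case: (_ \in _); first by rewrite mulr1 gtr0_norm.
  by rewrite mulr0 normr0 ltW.
have : del * pr P A <= 1 - c.
  have <- : \int[P]_w (del * (\1_A w : R)) = del * pr P A.
    rewrite RintegralZl//; last first.
      apply: (@bounded_integrable _ _ _ _ _ 1); first exact: measurable_indic.
      by move=> w; rewrite indicE; case: (_ \in _); rewrite ?normr1 ?normr0.
    by rewrite /Rintegral integral_indic// setIT.
  have <- : \int[P]_w (1 - cos (u * f (S n w t - S m w t))) = 1 - c.
    by rewrite RintegralB// Rintegral_cst// mul1r -/(pr P setT) prT.
  apply: le_Rintegral => //.
    apply: (@bounded_integrable _ _ _ _ _ 2); first exact: measurable_funB.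
    move=> w; apply: le_trans (ler_normB _ _) _; rewrite normr1.
    have := cos_max (u * f (S n w t - S m w t)); lra.
  move=> w _; rewrite indicE; case: (boolP (w \in A)) => [|_]; last first.
    by rewrite mulr0 subr_ge0 cos_le1.
  rewrite inE mulr1 => /AP; set r := S n w t - S m w t => rb.
  have : `|f r - `|b| | < eps.
    rewrite -fb (_ : f r - f b = f (r - b)); first exact: le_lt_trans (fle _) rb.
    by have := fD (r - b) b; rewrite subrK => ->; rewrite addrK.
  rewrite ltr_distl => /andP[fr1 fr2].
  have epsf : eps <= f r by lra.
  have fM : f r <= M by lra.
  have : u * eps <= u * f r by rewrite ler_pM2l.
  have : u * f r <= u * M by rewrite ler_pM2l.
  rewrite uM => ufM efr.
  rewrite /del lerD2l lerN2.
  move: efr; rewrite le_eqVlt => /predU1P[->//|efr]; apply: ltW.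
  by rewrite ltr_cos// in_itv/=; lra.
move=> dP; rewrite -(ltr_pM2l del0) mulrC (mulrC del eta); lra.
Qed.

(** By tightness [S m] and [S n] are both close to a finite set, so their difference is close to one
    of finitely many vectors [q i - q j]; those far from 0 are excluded by [increment_avoids]. *)
Lemma pointwise_cauchy (eps eta : R) : 0 < eps -> 0 < eta ->
  exists N, forall m n, (N <= m)%N -> (m <= n)%N ->
    pr P [set w | eps < `|S n w t - S m w t|] < eta.
Proof.
move=> eps0 eta0; have [q qE] := separable_seq sepE.
(* The difference is within [4 * e] of [q i - q j]; if the latter has norm less than [8 * e], the
   difference has norm less than [12 * e = eps]. *)
pose e := eps / 12; have e0 : 0 < e by rewrite divr_gt0.
(* Three events of probability about [h] are discarded at the end, whence [eta / 4]; the bound 1/4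
   yields the value 1/8 in [low], as 3/2 * 3/4 - 1 = 1/8. *)
pose h := Num.min (eta / 4) (1 / 4).
have h0 : 0 < h by rewrite lt_min !divr_gt0.
have he : h <= eta / 4 by rewrite ge_min lexx.
have h4 : h <= 1 / 4 by rewrite ge_min lexx orbT.
have [K [N0 _ tight]] := marginal_tight qE e0 h0.
pose Q := \sum_(i < K.+1) `|q i|.
have qQ i : (i <= K)%N -> `|q i| <= Q.
  move=> iK; rewrite /Q (bigD1 (Ordinal (iK : (i < K.+1)%N)))//= lerDl.
  exact: sumr_ge0.
pose M := 2 * Q + 4 * e.
have Q0 : 0 <= Q by exact: sumr_ge0.
have M0 : 0 < M by rewrite /M; lra.
pose near_q n := \bigcup_(i in `I_K.+1) [set w | `|S n w t - q i| < 2 * e].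
have mball n i (r : R) : measurable [set w | `|S n w t - q i| < r].
  exact/measurable_fun_lt/vS.
have mnear n : measurable (near_q n) by apply: bigcup_measurable => i _; exact: mball.
have tightC n : (N0 <= n)%N -> pr P (~` near_q n) < h.
  move=> nN; apply: (tight n nN); first exact: measurableC.
  move=> w nw i iK; rewrite leNgt; apply/negP => Si; apply: nw.
  by exists i.
have low (f : E -> R) : (forall x y, f (x + y) = f x + f y) ->
    (forall x, `|f x| <= `|x|) ->
    \forall m \near \oo, 1 / 8 <= \int[P]_w cos (M^-1 / 2 * f (S m w t)).
  move=> fD fle; exists N0 => // m /= mN.
  have mcos : measurable_fun setT (fun w => cos (M^-1 / 2 * f (S m w t))).
    exact: (measurable_char sepE fD fle (M^-1 / 2) (@continuous_cos R) (vS m t)).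
  have icos : P.-integrable setT (EFin \o (fun w => cos (M^-1 / 2 * f (S m w t)))).
    by apply: (@bounded_integrable _ _ _ _ _ 1) => // w; exact: cos_max.
  have iA : P.-integrable setT (EFin \o (\1_(near_q m) : T -> R)).
    apply: (@bounded_integrable _ _ _ _ _ 1); first exact: measurable_indic.
    by move=> w; rewrite indicE; case: (_ \in _); rewrite ?normr1 ?normr0.
  have i1 : P.-integrable setT (EFin \o (fun _ : T => 1 : R)).
    by apply: (@bounded_integrable _ _ _ _ _ 1) => // w; rewrite normr1.
  have i3 : P.-integrable setT (EFin \o (fun w => 3 / 2 * (\1_(near_q m) w : R))).
    apply: (@bounded_integrable _ _ _ _ _ (3 / 2)).
      by apply: measurable_funM => //; exact: measurable_indic.
    by move=> w; rewrite indicE; case: (_ \in _); rewrite ?mulr1 ?mulr0 ?normr0 ?ger0_norm//; lra.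
  (* The cosine is at least 1/2 on [near_q m], where its argument is at most 1/2 in absolute value,
     and at least -1 elsewhere. *)
  apply: (@le_trans _ _ (\int[P]_w (3 / 2 * (\1_(near_q m) w : R) - 1))).
    rewrite RintegralB// RintegralZl// Rintegral_cst// mul1r -/(pr P setT) prT.
    rewrite /Rintegral integral_indic// setIT -/(pr P _).
    have := tightC m mN; rewrite prC//; lra.
  apply: le_Rintegral => //.
    apply: (@bounded_integrable _ _ _ _ _ (3 / 2 + 1)).
      by apply: measurable_funB => //; exact: measurable_funM.
    move=> w; apply: le_trans (ler_normB _ _) _; rewrite normr1 lerD2r.
    by rewrite indicE; case: (_ \in _); rewrite ?mulr1 ?mulr0 ?normr0 ?ger0_norm//; lra.
  move=> w _; rewrite indicE; case: (boolP (w \in near_q m)) => [|_]; last first.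
    by rewrite mulr0 sub0r cos_geN1.
  rewrite inE => -[i /= iK Si]; rewrite mulr1.
  have SM : `|S m w t| <= M.
    have := qQ i iK; have := ler_distD (q i) (S m w t) 0; rewrite !subr0 /M; lra.
  have := cos_lipschitz 0 (M^-1 / 2 * f (S m w t)).
  rewrite cos0 sub0r normrN normrM gtr0_norm ?divr_gt0 ?invr_gt0//.
  have : M^-1 / 2 * `|f (S m w t)| <= M^-1 / 2 * M.
    by rewrite ler_pM2l ?divr_gt0 ?invr_gt0//; exact: le_trans (fle _) SM.
  have -> : M^-1 / 2 * M = 2^-1 by rewrite mulrAC mulVf ?mul1r// gt_eqF.
  move=> c1; rewrite ler_norml => /andP[_ c2]; lra.
pose K2 : R := K.+1%:R * K.+1%:R.
have K20 : 0 < K2 by rewrite mulr_gt0.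
have /choice[N1 N1P] : forall ij : nat * nat, exists N,
    (ij.1 <= K)%N -> (ij.2 <= K)%N -> 8 * e <= `|q ij.1 - q ij.2| ->
    forall m n, (N <= m)%N -> (m <= n)%N -> forall A, measurable A ->
    (forall w, A w -> `|S n w t - S m w t - (q ij.1 - q ij.2)| < 4 * e) ->
    pr P A < h / K2.
  move=> [i j] /=; have [/and3P[iK jK qij]|no] := boolP [&& (i <= K)%N, (j <= K)%N &
      8 * e <= `|q i - q j|]; last first.
    by exists 0%N => iK jK qij; move: no; rewrite iK jK qij.
  have [|||||N NP] := @increment_avoids (q i - q j) (4 * e) M (h / K2).
  - lra.
  - lra.
  - have := ler_normB (q i) (q j); have := qQ i iK; have := qQ j jK; rewrite /M; lra.
  - by rewrite divr_gt0.
  - exact: low.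
  by exists N => _ _ _; exact: NP.
pose N := maxn N0 (\max_(i < K.+1) \max_(j < K.+1) N1 (i : nat, j : nat)).
exists N => m n Nm mn.
have N0m : (N0 <= m)%N by apply: leq_trans Nm; exact: leq_maxl.
have N1m i j : (i <= K)%N -> (j <= K)%N -> (N1 (i, j) <= m)%N.
  move=> iK jK; apply: leq_trans Nm; apply: leq_trans (leq_maxr _ _).
  apply: leq_trans (leq_bigmax (Ordinal (iK : (i < K.+1)%N))).
  exact: (leq_bigmax (F := fun j : 'I_K.+1 => N1 (i, j : nat)) (Ordinal (jK : (j < K.+1)%N))).
have vR : vmeasurable (fun w => S n w t - S m w t) by exact: vmeasurableB.
have mbig : measurable [set w | eps < `|S n w t - S m w t|].
  exact/measurable_fun_gt/vmeasurable_norm.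
pose C i j := [set w | 8 * e <= `|q i - q j| /\
  `|S n w t - S m w t - (q i - q j)| < 4 * e].
have mC i j : measurable (C i j).
  apply: measurable_bool_and; exact/measurable_fun_lt/vR.
pose CC := \bigcup_(i in `I_K.+1) \bigcup_(j in `I_K.+1) C i j.
have mCi i : measurable (\bigcup_(j in `I_K.+1) C i j) by exact: bigcup_measurable.
have mCC : measurable CC by exact: bigcup_measurable.
have PCC : pr P CC <= h.
  rewrite (_ : h = K.+1%:R * (K.+1%:R * (h / K2))); last first.
    by rewrite mulrA -/K2 mulrC divfK// gt_eqF.
  apply: pr_bigcup_le => // i iK; apply: pr_bigcup_le => // j jK.
  have [qij|qij] := leP (8 * e) `|q i - q j|; last first.
    rewrite (_ : C i j = set0) ?pr0 ?divr_ge0 ?ltW//.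
    by apply/seteqP; split => // w [/=]; rewrite leNgt qij.
  apply/ltW/(N1P (i, j) iK jK qij m n (N1m i j iK jK) mn) => // w.
  by case.
have := @pr_cover3 _ _ _ P _ _ _ _ mbig (measurableC (mnear m)) (measurableC (mnear n)) mCC.
have tm := tightC m N0m; have tn := tightC n (leq_trans N0m mn).
suff sub : [set w | eps < `|S n w t - S m w t|] `<=` ~` near_q m `|` ~` near_q n `|` CC.
  by move=> /(_ sub); lra.
move=> w /= Rw; have [[j jK Sj]|] := pselect (near_q m w); last by left; left.
have [[i iK Si]|] := pselect (near_q n w); last by left; right.
right; exists i => //; exists j => //.
have close : `|S n w t - S m w t - (q i - q j)| < 4 * e.
  rewrite (_ : S n w t - S m w t - (q i - q j) = S n w t - q i - (S m w t - q j)).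
    by apply: le_lt_trans (ler_normB _ _) _; move: Si Sj => /=; lra.
  by rewrite !opprD !opprK addrACA.
split=> //; have := ler_distD (q i - q j) (S n w t - S m w t) 0; rewrite !subr0.
rewrite /e in close *; lra.
Qed.

End PointwiseCauchy.

(** * Uniformity over the points of a finite set *)

Section FiniteFamilies.
Context {R : realType} {d : measure_display} {T : measurableType d}.
Variable P : probability T R.
Context {I : eqType}.

Lemma seq_min_gt0 (L : seq I) (g : I -> R) : (forall t, t \in L -> 0 < g t) ->
  exists2 r : R, 0 < r & forall t, t \in L -> r <= g t.
Proof.
elim: L => [|t L ih] gL; first by exists 1.
have [|r r0 rL] := ih; first by move=> s sL; apply: gL; rewrite inE sL orbT.
exists (Num.min (g t) r); first by rewrite lt_min r0 gL// mem_head.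
move=> s; rewrite inE => /predU1P[->|sL]; first by rewrite ge_min lexx.
by rewrite ge_min rL// orbT.
Qed.

Lemma seq_eventually (L : seq I) (Q : I -> nat -> nat -> Prop) :
  (forall t, t \in L -> exists N, forall m n, (N <= m)%N -> (m <= n)%N -> Q t m n) ->
  exists N, forall t, t \in L -> forall m n, (N <= m)%N -> (m <= n)%N -> Q t m n.
Proof.
elim: L => [|t L ih] QL; first by exists 0%N.
have [|N NL] := ih; first by move=> s sL; apply: QL; rewrite inE sL orbT.
have [N' N't] := QL t (mem_head _ _).
exists (maxn N N') => s; rewrite inE => /predU1P[->|sL] m n; rewrite geq_max => /andP[? ?].
  exact: N't.
exact: NL.
Qed.

Lemma measurable_exists_seq d' (M : measurableType d') (L : seq I) (A : I -> set M) :
  (forall s, s \in L -> measurable (A s)) ->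
  measurable [set w | exists2 s, s \in L & A s w].
Proof.
elim: L => [|t L ih] mA.
  by rewrite (_ : [set w | _] = set0)//; apply/seteqP; split => w //= [].
rewrite (_ : [set w | _] = A t `|` [set w | exists2 s, s \in L & A s w]).
  apply: measurableU; first by apply: mA; rewrite mem_head.
  by apply: ih => s sL; apply: mA; rewrite inE sL orbT.
apply/seteqP; split => w /=.
  by move=> [s]; rewrite inE => /predU1P[->|sL] As; [left|right; exists s].
by move=> [At|[s sL As]]; [exists t; rewrite ?mem_head|exists s; rewrite // inE sL orbT].
Qed.

Lemma pr_exists_seq (L : seq I) (A : I -> set T) (c : R) :
  (forall s, s \in L -> measurable (A s)) -> (forall s, s \in L -> pr P (A s) <= c) ->
  pr P [set w | exists2 s, s \in L & A s w] <= (size L)%:R * c.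
Proof.
elim: L => [|t L ih] mA Ac.
  rewrite (_ : [set w | _] = set0) ?pr0 ?mul0r//.
  by apply/seteqP; split => w //= [].
have mL s : s \in L -> measurable (A s) by move=> sL; apply: mA; rewrite inE sL orbT.
rewrite -natr1 mulrDl mul1r addrC.
apply: (@le_trans _ _ (pr P (A t) + pr P [set w | exists2 s, s \in L & A s w])).
  apply: pr_cover.
  - exact: measurable_exists_seq.
  - by apply: mA; rewrite mem_head.
  - exact: measurable_exists_seq.
  - by move=> w [s]; rewrite inE => /predU1P[->|sL] As; [left|right; exists s].
apply: lerD; first by apply: Ac; rewrite mem_head.
by apply: ih => // s sL; apply: Ac; rewrite inE sL orbT.
Qed.

End FiniteFamilies.

(** * Separated balls charged by a nonconstant random vector *)

Section JumpSpread.
Context {R : realType} {d : measure_display} {T : measurableType d}.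
Variable P : probability T R.
Context {E : normedModType R}.
Hypothesis sepE : separable E.
Variable J : T -> E.
Hypothesis mJ : vmeasurable J.

Let mlt (a : E) (r : R) : measurable [set w | `|J w - a| < r].
Proof. by apply: measurable_fun_lt; exact: mJ. Qed.

Let small_ball (rho : R) : 0 < rho -> (forall a b : E, 8 * rho <= `|a - b| ->
    pr P [set w | `|J w - a| < rho] = 0 \/ pr P [set w | `|J w - b| < rho] = 0) ->
  exists a : E, pr P [set w | 9 * rho <= `|J w - a|] = 0.
Proof.
move=> rho0 ab; have [q qE] := separable_seq sepE.
have [a a0] : exists a : E, 0 < pr P [set w | `|J w - a| < rho].
  apply: contrapT => no.
  have : pr P (\bigcup_i [set w | `|J w - q i| < rho]) = 0.
    apply: pr_bigcup_eq0 => // k; apply/le_anti; rewrite pr_ge0 andbT leNgt.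
    by apply/negP => qk; apply: no; exists (q k).
  rewrite (_ : \bigcup_i _ = setT) ?prT; first by move/eqP; rewrite oner_eq0.
  by apply/seteqP; split => // w _; have [i ?] := qE (J w) rho rho0; exists i.
exists a; apply/le_anti; rewrite pr_ge0 andbT.
pose A i := [set w | (8 * rho <= `|a - q i|) /\ `|J w - q i| < rho].
have mA i : measurable (A i) by apply: measurable_bool_and; exact: mlt.
have A0 i : pr P (A i) = 0.
  have [ai|ai] := leP (8 * rho) `|a - q i|.
    rewrite (_ : A i = [set w | `|J w - q i| < rho]).
      by have [a0'|] := ab a (q i) ai => //; rewrite a0' ltxx in a0.
    by apply/seteqP; split => w //= [].
  rewrite (_ : A i = set0) ?pr0//.
  by apply/seteqP; split => w // [/=]; rewrite leNgt ai.
rewrite -(pr_bigcup_eq0 mA A0); apply: le_pr.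
- by apply: measurable_fun_ge; exact: mJ.
- exact: bigcup_measurable.
- move=> w /= Ja; have [i qi] := qE (J w) rho rho0; exists i => //; split => //.
  have := ler_distD (q i) (J w) a; rewrite (distrC (q i) a); lra.
Qed.

(** If the conclusion failed, [small_ball] would apply at every scale: for all [k], almost surely
    [J] is within [9 * invS k] of a point [a k]. Two outcomes with this property for all [k] have
    the same value, so [J] would be almost surely constant. *)
Lemma nonconstant_spread : (forall c, P [set w | J w = c] <> 1%E) ->
  exists a b (rho kap : R), [/\ 0 < rho, 0 < kap, 8 * rho <= `|a - b|,
    kap <= pr P [set w | `|J w - a| < rho] & kap <= pr P [set w | `|J w - b| < rho]].
Proof.
move=> Jc; apply: contrapT => no.
have /choice[a aP] : forall k : nat, exists a : E,
    pr P [set w | 9 * invS k <= `|J w - a|] = 0.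
  move=> k; apply: small_ball; first exact: invS_gt0.
  move=> a b ab; apply: contrapT => /not_orP[/eqP a0 /eqP b0]; apply: no.
  have {}a0 : 0 < pr P [set w | `|J w - a| < invS k] by rewrite lt_neqAle eq_sym a0 pr_ge0.
  have {}b0 : 0 < pr P [set w | `|J w - b| < invS k] by rewrite lt_neqAle eq_sym b0 pr_ge0.
  exists a, b, (invS k), (Num.min (pr P [set w | `|J w - a| < invS k])
                                    (pr P [set w | `|J w - b| < invS k])).
  by split => //; rewrite ?invS_gt0 ?lt_min ?a0 ?ge_min ?lexx ?orbT.
pose Z k := [set w | 9 * invS k <= `|J w - a k|].
have mZ k : measurable (Z k) by apply: measurable_fun_ge; exact: mJ.
have mUZ : measurable (\bigcup_k Z k) by exact: bigcup_measurable.
have Z0 := pr_bigcup_eq0 mZ aP.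
have [w0 w0Z] : (~` \bigcup_k Z k) !=set0.
  apply/set0P/eqP => Z1; have := prC P mUZ; rewrite Z1 pr0 Z0 subr0.
  by move/eqP; rewrite eq_sym oner_eq0.
apply: (Jc (J w0)); have mc : measurable [set w | J w = J w0].
  rewrite (_ : [set w | _] = [set w | `|J w - J w0| <= 0]).
    by apply: measurable_fun_le; exact: mJ.
  apply/seteqP; split => w /=; first by move=> ->; rewrite subrr normr0.
  by rewrite normr_le0 subr_eq0 => /eqP.
rewrite (prE P mc); congr EFin; apply/le_anti; rewrite pr_le1//=.
have <- : pr P (~` \bigcup_k Z k) = 1 by rewrite prC// Z0 subr0.
apply: le_pr => //; first exact: measurableC.
move=> w wZ /=; apply/eqP; rewrite -subr_eq0 -normr_le0 leNgt; apply/negP => Jw.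
have [k kJ] := invS_lt (ltac:(lra) : 0 < `|J w - J w0| / 18).
have h1 : `|J w - a k| < 9 * invS k.
  by rewrite ltNge; apply/negP => ?; apply: wZ; exists k.
have h2 : `|J w0 - a k| < 9 * invS k.
  by rewrite ltNge; apply/negP => ?; apply: w0Z; exists k.
have := ler_distD (a k) (J w) (J w0); rewrite (distrC (a k)); lra.
Qed.

End JumpSpread.

Section Grid.
Context {R : realType} {d : measure_display} {T : measurableType d}.
Variable P : probability T R.
Context {E : normedModType R}.
Hypothesis sepE : separable E.
Variable Y : {RV P >-> cadlag01 E}.

Lemma jump_free_grid (beta : R) : 0 < beta -> exists G : seq R,
  (forall u, u \in G -> jump_free Y u) /\
  forall s : R, s \in `[0, 1] -> s \in G \/
    exists u v, [/\ u \in G, v \in G, u < s < v & v - u < beta].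
Proof.
(* The ends of the cell come from the subintervals of length [h] before and after the one containing
   [s], or are 0 and 1, so they differ by at most [3 * h]. *)
move=> beta0; have [K Kb] := invS_lt (ltac:(lra) : 0 < beta / 3).
pose h : R := invS K; have h0 : 0 < h by exact: invS_gt0.
have hK : h * K.+1%:R = 1 by rewrite mulVf.
have /choice[g gP] : forall i : nat, exists t, (i <= K)%N ->
    (h * i%:R < t < h * i.+1%:R) /\ jump_free Y t.
  move=> i; have [iK|iK] := leqP i K; last by exists 0.
  have [|||t [ti jt]] := @jump_free_dense _ _ _ _ _ sepE Y (h * i%:R) (h * i.+1%:R).
  - by rewrite mulr_ge0// ltW.
  - by rewrite ltr_pM2l// ltr_nat.
  - by rewrite -[leRHS]hK ler_pM2l// ler_nat.
  - by exists t.
pose L := [seq g i | i <- iota 0 K.+1].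
have LP u : reflect (exists2 i, (i <= K)%N & u = g i) (u \in L).
  apply: (iffP mapP) => -[i iK ->]; exists i => //; move: iK; first by rewrite mem_iota.
  by rewrite mem_iota add0n ltnS.
clearbody L; exists (0 :: 1 :: L); split.
  move=> u; rewrite !inE => /or3P[/eqP->|/eqP->|/LP[i iK ->]].
  - exact: jump_free0.
  - exact: jump_free1.
  - exact: (gP i iK).2.
have gG i : (i <= K)%N -> g i \in 0 :: 1 :: L.
  by move=> iK; rewrite !inE; apply/or3P/Or33/LP; exists i.
move=> s; rewrite in_itv/= => /andP[s0 s1].
have [->|sn0] := eqVneq s 0; first by left; rewrite mem_head.
have [->|sn1] := eqVneq s 1; first by left; rewrite !inE eqxx orbT.
right; have {}s0 : 0 < s by rewrite lt_neqAle eq_sym sn0.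
have {}s1 : s < 1 by rewrite lt_neqAle sn1.
pose i := Num.truncn (s / h).
have /andP[si1 si2] : i%:R <= s / h < i.+1%:R.
  by apply: truncn_itv; rewrite divr_ge0// ltW.
rewrite ler_pdivlMr// mulrC in si1; rewrite ltr_pdivrMr// mulrC in si2.
have [u [uG us su]] : exists u, [/\ u \in 0 :: 1 :: L,
    u < s & h * i%:R - h <= u].
  case: (i) si1 => [|j] sj.
    by exists 0; rewrite mem_head; split => //; rewrite mulr0; lra.
  have jK : (j <= K)%N.
    rewrite -ltnS -(ltr_nat R) -(ltr_pM2l h0) hK; apply: le_lt_trans s1.
    by apply: le_trans sj; rewrite ler_pM2l// ler_nat.
  have [/andP[g1 g2] _] := gP j jK.
  exists (g j); split; [exact: gG|exact: lt_le_trans sj|].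
  by rewrite -natr1 mulrDr mulr1; lra.
have [v [vG sv vs]] : exists v, [/\ v \in 0 :: 1 :: L,
    s < v & v <= h * i%:R + 2 * h].
  have [iK|iK] := leqP i.+1 K.
    have [/andP[g1 g2] _] := gP i.+1 iK.
    exists (g i.+1); split; [exact: gG|exact: lt_trans g1|].
    by move: g2; rewrite -!natr1 !mulrDr !mulr1; lra.
  exists 1; split; [by rewrite !inE eqxx orbT|by []|].
  have : h * K.+1%:R <= h * i.+1%:R by rewrite ler_pM2l// ler_nat.
  by rewrite hK -natr1 mulrDr mulr1; lra.
exists u, v; split => //; first by rewrite us.
by rewrite -/h in Kb; lra.
Qed.

End Grid.

(** * Increments of [S m] over short cells *)

Section Cells.
Context {R : realType} {d : measure_display} {T : measurableType d}.
Variable P : probability T R.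
Context {E : normedModType R}.
Hypothesis sepE : separable E.
Variable X : nat -> {RV P >-> cadlag01 E}.
Variable S : nat -> T -> cadlag01 E.
Hypothesis S_def : forall n w, S n w = \sum_(j < n) X j w.
Variable Y : {RV P >-> cadlag01 E}.
Hypothesis S_cvg : cvg_in_distribution P S Y.

Let vS n s := vmeasurable_partial_sum sepE S_def n s.
Let vY s := @vmeasurable_eval _ _ _ P E Y s.

Lemma increment_near (u v : R) (a : E) (r c : R) : jump_free Y u -> jump_free Y v ->
  0 < r -> pr P [set w | r < `|Y w v - Y w u - a|] < c ->
  \forall m \near \oo, pr P [set w | 2 * r <= `|S m w v - S m w u - a|] < c.
Proof.
move=> Du Dv r0 Yc.
have mY : vmeasurable (fun w => Y w v - Y w u) by exact: vmeasurableB.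
have := fdd_pr_near S_cvg (L := [:: u; v]) (h := fun x => `|x v - x u - a|)
  (C := 2) (r := r) (eta := c).
move=> /(_ _ _ r0 _ (mY a) Yc) [||g x x' xx|N _ NS].
- by move=> s; rewrite !inE => /orP[] /eqP ->; exact: jump_free_stable.
- by [].
- apply: le_trans (ler_dist_dist _ _) _; rewrite subrBB.
  rewrite (_ : _ - _ - _ = (x v - x' v) - (x u - x' u)).
    apply: le_trans (ler_normB _ _) _.
    by have := xx u; have := xx v; rewrite !inE !eqxx orbT => /(_ isT) ? /(_ isT) ?; lra.
  by rewrite !opprD !opprK addrACA.
exists N => // m /= Nm; apply: (NS m Nm) => //.
by apply: measurable_fun_ge; apply: vmeasurableB => //; exact: vS.
Qed.

Variable e : R.
Hypothesis e0 : 0 < e.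
Variables (bigs : seq R) (a b : R -> E) (rho : R -> R) (kap dw : R).
Hypothesis bigsP : forall t, t \in bigs <->
  t \in `[0, 1] /\ 1 / 2 <= pr P [set w | e < `|jump (Y w) t|].
Hypothesis rho0 : forall t, t \in bigs -> 0 < rho t.
Hypothesis kap0 : 0 < kap.
Hypothesis kap4 : 4 * kap <= 1.
Hypothesis dw0 : 0 < dw.
Hypothesis aP : forall t, t \in bigs ->
  2 * kap <= pr P [set w | `|jump (Y w) t - a t| < rho t].
Hypothesis bP : forall t, t \in bigs ->
  2 * kap <= pr P [set w | `|jump (Y w) t - b t| < rho t].

Let dist_via (x y z : E) (r s : R) : `|x - z| <= r -> `|y - z| <= s -> `|x - y| <= r + s.
Proof. by move=> xz yz; have := ler_distD z x y; rewrite (distrC z); lra. Qed.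

(* Either the increment of [S m] over the cell is small with a probability
   bounded below, or the cell contains a fixed jump time of [Y] and the
   increment charges two separated balls. *)
Definition cell_ok (u v : R) (m : nat) :=
  kap <= pr P [set w | `|S m w v - S m w u| < 4 * e] \/
  exists t, [/\ t \in bigs, u < t <= v, t - dw < u, v < t + dw &
    kap <= pr P [set w | `|S m w v - S m w u - a t| < 3 * rho t] /\
    kap <= pr P [set w | `|S m w v - S m w u - b t| < 3 * rho t]].

Let small_cell (u v : R) : jump_free Y u -> jump_free Y v ->
  pr P [set w | 2 * e < `|Y w v - Y w u|] < 3 / 4 ->
  exists N, forall m, (N <= m)%N -> cell_ok u v m.
Proof.
have k4 := kap4; move=> Du Dv Yuv; have := @increment_near u v 0 (2 * e) (3 / 4) Du Dv _ _.
rewrite mulr_gt0// => /(_ isT).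
under eq_set do rewrite subr0; move=> /(_ Yuv) [N _ NS].
exists N => m Nm; left; have := NS m Nm => /=.
under eq_set do rewrite subr0.
have vI : vmeasurable (fun w => S m w v - S m w u).
  by apply: vmeasurableB => //; exact: vS.
have -> : [set w | 2 * (2 * e) <= `|S m w v - S m w u|] =
    ~` [set w | `|S m w v - S m w u| < 4 * e].
  have -> : 2 * (2 * e) = 4 * e by ring.
  by apply/seteqP; split => w /=; rewrite leNgt => /negP.
rewrite prC; last by apply: measurable_fun_lt; exact: vmeasurable_norm.
lra.
Qed.

(** The jump of [Y] is in the ball of radius [rho t] with probability at least [2 * kap]. Discarding
    [B] costs [kap] and replaces the jump by the increment of [Y], within [3 / 2 * rho t]; the
    passage to [S m] doubles the radius. *)
Let ball_cell (u v t : R) (z : E) (B : set T) :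
  jump_free Y u -> jump_free Y v -> t \in bigs -> measurable B -> pr P B < kap ->
  (forall w, ~ B w -> `|Y w v - Y w u - jump (Y w) t| <= rho t / 2) ->
  2 * kap <= pr P [set w | `|jump (Y w) t - z| < rho t] ->
  exists N, forall m, (N <= m)%N ->
    kap <= pr P [set w | `|S m w v - S m w u - z| < 3 * rho t].
Proof.
have k4 := kap4; move=> Du Dv tb mB PB YB zP; have r0 := rho0 tb.
have [tI _] := (bigsP t).1 tb.
have vJ : vmeasurable (fun w => jump (Y w) t) by exact: vmeasurable_jump.
have vYI : vmeasurable (fun w => Y w v - Y w u) by exact: vmeasurableB.
have mJz : measurable [set w | `|jump (Y w) t - z| < rho t].
  by apply: measurable_fun_lt; exact: vJ.
have mYz : measurable [set w | 3 / 2 * rho t < `|Y w v - Y w u - z|].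
  by apply: measurable_fun_gt; exact: vYI.
have Yz : pr P [set w | 3 / 2 * rho t < `|Y w v - Y w u - z|] < 1 - kap.
  have := @pr_cover _ _ _ P _ _ _ mYz (measurableC mJz) mB.
  rewrite prC// => H; apply: le_lt_trans (H _) _; last by lra.
  move=> w /= Yw; have [Bw|nB] := pselect (B w); first by right.
  left; apply/negP; rewrite -leNgt.
  have := YB w nB; have := ler_distD (jump (Y w) t) (Y w v - Y w u) z; lra.
have [|N _ NS] := @increment_near u v z (3 / 2 * rho t) (1 - kap) Du Dv _ Yz.
  by rewrite mulr_gt0.
exists N => m Nm; have := NS m Nm => /=.
have vI : vmeasurable (fun w => S m w v - S m w u).
  by apply: vmeasurableB => //; exact: vS.
have -> : [set w | 2 * (3 / 2 * rho t) <= `|S m w v - S m w u - z|] =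
    ~` [set w | `|S m w v - S m w u - z| < 3 * rho t].
  have -> : 2 * (3 / 2 * rho t) = 3 * rho t by field.
  by apply/seteqP; split => w /=; rewrite leNgt => /negP.
rewrite prC; last by apply: measurable_fun_lt; exact: vI.
lra.
Qed.

(** By the Lebesgue number it is enough to argue near one [t]. If [t] is not in [bigs], increments
    of [Y] near [t] are at most [2 * e] outside an event of probability less than 1/8 + 1/2 < 3/4.
    If [t] is in [bigs], a cell on one side of [t] has a small increment, while over a cell with
    [u < t <= v] the increment is almost the jump at [t]. *)
Lemma cells_exist : exists2 beta : R, 0 < beta & forall u v,
  jump_free Y u -> jump_free Y v -> u < v -> v - u < beta ->
  exists N, forall m, (N <= m)%N -> cell_ok u v m.
Proof.
have e0' := e0; have k4 := kap4; pose Q (u v : R) := jump_free Y u -> jump_free Y v -> u < v ->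
  exists N, forall m, (N <= m)%N -> cell_ok u v m.
have [t tI|beta beta0 Qb] := @lebesgue_number R Q; last first.
  exists beta => // u v Du Dv uv vub; apply: Qb => //.
  - by case: Du.
  - by case: Dv.
  - by rewrite distrC gtr0_norm ?subr_gt0.
have vJ : vmeasurable (fun w => jump (Y w) t) by exact: vmeasurable_jump.
have mJe : measurable [set w | e < `|jump (Y w) t|] by exact: measurable_jump_gt.
have [tb|tnb] := boolP (t \in bigs); last first.
  have pe : pr P [set w | e < `|jump (Y w) t|] < 1 / 2.
    by rewrite ltNge; apply/negP => pe; move/negP: tnb; apply; apply/bigsP.
  have [||al al0 [B [mB PB YB]]] := @random_window _ _ _ P E sepE Y t (e / 2) (1 / 8) tI.
  - by rewrite divr_gt0.
  - by rewrite divr_gt0.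
  exists al; [exact: al0|move=> u v uI vI].
  rewrite !ltr_distl => /andP[u1 u2] /andP[v1 v2] Du Dv uv.
  apply: small_cell => //.
  have mY2 : measurable [set w | 2 * e < `|Y w v - Y w u|].
    by apply: measurable_fun_gt; apply: vmeasurable_norm; exact: vmeasurableB.
  apply: le_lt_trans (pr_cover P mY2 mB mJe _) _; last by lra.
  move=> w /= Yw; have [Bw|nB] := pselect (B w); first by left.
  right; rewrite ltNge; apply/negP => Jw.
  have lt_val : `|left_value (Y w) t - Y w t| <= e by rewrite /left_value addrAC subrr sub0r normrN.
  have lt_val' : `|Y w t - left_value (Y w) t| <= e by rewrite distrC.
  have cl s : s \in `[0, 1] -> t - al < s -> s < t + al ->
      (s < t /\ `|Y w s - left_value (Y w) t| <= e / 2) \/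
      (t <= s /\ `|Y w s - Y w t| <= e / 2).
    move=> sI s1 s2; have [st|ts] := ltP s t; [left|right]; split => //.
      by apply: (YB w nB s sI).1; rewrite s1.
    by apply: (YB w nB s sI).2; rewrite ts.
  move: Yw; apply/negP; rewrite -leNgt.
  have [[_ cu]|[_ cu]] := cl u uI u1 u2; have [[_ cv]|[_ cv]] := cl v vI v1 v2.
  - by apply: le_trans (dist_via cv cu) _; lra.
  - apply: le_trans (dist_via cv (dist_via cu lt_val')) _; lra.
  - apply: le_trans (dist_via cv (dist_via cu lt_val)) _; lra.
  - by apply: le_trans (dist_via cv cu) _; lra.
have r0 := rho0 tb; have [_ pe] := (bigsP t).1 tb.
(* Two errors [g] add up to at most [rho t / 2], required by [ball_cell], and to at most [e], for
   cells on one side of [t]. *)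
pose g := Num.min (rho t / 4) (e / 2).
have g0 : 0 < g by rewrite lt_min !divr_gt0.
have gr : g <= rho t / 4 by rewrite ge_min lexx.
have ge : g <= e / 2 by rewrite ge_min lexx orbT.
have [al al0 [B [mB PB YB]]] := @random_window _ _ _ P E sepE Y t g kap tI g0 kap0.
exists (Num.min al dw); first by rewrite lt_min al0.
move=> u v uI vI; rewrite !lt_min => /andP[ua ud] /andP[va vd] Du Dv uv.
move: ua ud va vd; rewrite !ltr_distl => /andP[u1 u2] /andP[u3 u4] /andP[v1 v2] /andP[v3 v4].
have same_side (z : T -> E) : (forall w, ~ B w -> `|Y w u - z w| <= g) ->
    (forall w, ~ B w -> `|Y w v - z w| <= g) ->
    exists N, forall m, (N <= m)%N -> cell_ok u v m.
  move=> uz vz; apply: small_cell => //.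
  have mY2 : measurable [set w | 2 * e < `|Y w v - Y w u|].
    by apply: measurable_fun_gt; apply: vmeasurable_norm; exact: vmeasurableB.
  apply: le_lt_trans (le_pr P mY2 mB _) _; last by lra.
  move=> w /= Yw; apply: contrapT => nB; move: Yw; apply/negP; rewrite -leNgt.
  by apply: le_trans (dist_via (vz w nB) (uz w nB)) _; lra.
have [vt|tv] := ltP v t.
  apply: (same_side (fun w => left_value (Y w) t)) => w nB.
    by apply: (YB w nB u uI).1; lra.
  by apply: (YB w nB v vI).1; lra.
have [tu|ut] := leP t u.
  apply: (same_side (fun w => Y w t)) => w nB.
    by apply: (YB w nB u uI).2; lra.
  by apply: (YB w nB v vI).2; lra.
have close w : ~ B w -> `|Y w v - Y w u - jump (Y w) t| <= rho t / 2.
  move=> nB; have cu : `|Y w u - left_value (Y w) t| <= g.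
    by apply: (YB w nB u uI).1; lra.
  have cv : `|Y w v - Y w t| <= g by apply: (YB w nB v vI).2; lra.
  rewrite (_ : _ - _ - _ = (Y w v - Y w t) - (Y w u - left_value (Y w) t)).
    by apply: le_trans (ler_normB _ _) _; lra.
  by rewrite /left_value opprB addrA addrA addrNK addrAC.
have [Na NaP] := ball_cell Du Dv tb mB PB close (aP tb).
have [Nb NbP] := ball_cell Du Dv tb mB PB close (bP tb).
exists (maxn Na Nb) => m; rewrite geq_max => /andP[Nam Nbm]; right.
exists t; split => //; first by rewrite ut.
by split; [exact: NaP|exact: NbP].
Qed.

End Cells.

Section BigJumps.
Context {R : realType} {d : measure_display} {T : measurableType d}.
Variable P : probability T R.
Context {E : normedModType R}.
Hypothesis sepE : separable E.
Variable Y : {RV P >-> cadlag01 E}.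
Hypothesis Y_jump : ~ exists (t : R) (c : E), [/\ t \in `[0, 1], c != 0 &
  P [set w | jump (Y w) t = c] = 1%E].

Lemma big_jump_times (e : R) : 0 < e -> exists bigs : seq R, forall t, t \in bigs <->
  t \in `[0, 1] /\ 1 / 2 <= pr P [set w | e < `|jump (Y w) t|].
Proof.
move=> e0; have [|s sE] := (finite_seqP _).1 (@finite_jump_times _ _ _ P E sepE Y e (1 / 2) e0 _).
  by rewrite divr_gt0.
exists s => t; have -> : t \in s = ([set` s] t) :> Prop by [].
by rewrite -sE.
Qed.

(** The hypothesis on [Y] enters here: it forbids an almost surely constant jump [c != 0], while
    [c = 0] contradicts a jump larger than [e] with probability at least 1/2. *)
Lemma big_jump_spread (e t : R) : 0 < e -> t \in `[0, 1] ->
  1 / 2 <= pr P [set w | e < `|jump (Y w) t|] ->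
  exists a b (rho kap : R), [/\ 0 < rho, 0 < kap, 8 * rho <= `|a - b|,
    kap <= pr P [set w | `|jump (Y w) t - a| < rho] &
    kap <= pr P [set w | `|jump (Y w) t - b| < rho]].
Proof.
move=> e0 tI pe; apply: nonconstant_spread => //; first exact: vmeasurable_jump.
move=> c Jc; have [c0|c0] := eqVneq c 0; last by apply: Y_jump; exists t, c.
have mJ : measurable [set w | e < `|jump (Y w) t|] by exact: measurable_jump_gt.
have mc : measurable [set w | jump (Y w) t = c].
  rewrite c0 (_ : [set w | _] = [set w | `|jump (Y w) t| <= 0]).
    by apply/measurable_fun_le/vmeasurable_norm/vmeasurable_jump.
  apply/seteqP; split => w /=; first by move=> ->; rewrite normr0.
  by rewrite normr_le0 => /eqP.
have : pr P [set w | e < `|jump (Y w) t|] <= pr P (~` [set w | jump (Y w) t = c]).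
  apply: le_pr => //; first exact: measurableC.
  by move=> w /= + Jw; rewrite Jw c0 normr0 ltNge ltW.
by rewrite prC// {2}/pr Jc /= subrr; lra.
Qed.

End BigJumps.

Section CellIncrements.
Context {R : realType} {E : normedModType R}.
Implicit Types (x y : R -> E) (u s v e : R).

(* In the next three lemmas [x] and [y] are paths of [S m] and [S n] with at
   most one large jump on a cell [u, v] around [s], at whose ends they are
   close to each other. *)
Lemma small_increment x y u s v e : 0 < e ->
  `|x s - x u| < e \/ `|x v - x s| < e -> `|y s - y u| < e \/ `|y v - y s| < e ->
  `|y u - x u| <= e -> `|y v - x v| <= e -> `|x v - x u| < 4 * e ->
  `|y s - x s| <= 13 * e.
Proof.
move=> e0 Gx Gy yxu yxv xvu.
have xsu : `|x u - x s| <= 5 * e.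
  rewrite distrC; case: Gx => xs; first by lra.
  by have := ler_distD (x v) (x s) (x u); rewrite (distrC (x s) (x v)); lra.
have ysu : `|y s - y u| <= 7 * e.
  case: Gy => ys; first by lra.
  have := ler_distD (y v) (y s) (y u); rewrite (distrC (y s) (y v)).
  have := ler_distD (x v) (y v) (y u); have := ler_distD (x u) (x v) (y u).
  by rewrite (distrC (x u) (y u)); lra.
(* The constant is 13 = 7 + 1 + 5, along the chain [y s], [y u], [x u], [x s]. *)
have := ler_distD (y u) (y s) (x s); have := ler_distD (x u) (y u) (x s); lra.
Qed.

Lemma left_increment x y u s v e : `|y s - y u| < e -> `|y u - x u| <= e ->
  `|x s - x u| < e \/ `|x v - x s| < e -> 3 * e < `|y s - x s| ->
  `|x v - x u - - (y s - x s)| < 3 * e.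
Proof.
move=> ysu yxu [xsu|xvs] yxs.
  have := ler_distD (y u) (y s) (x s); have := ler_distD (x u) (y u) (x s).
  by rewrite (distrC (x u)); lra.
rewrite (_ : _ - _ - _ = (x v - x s) + (y s - x u)).
  have := ler_normD (x v - x s) (y s - x u); have := ler_distD (y u) (y s) (x u); lra.
by rewrite opprK addrACA [RHS]addrACA (addrC (- x u)).
Qed.

Lemma right_increment x y u s v e : `|y v - y s| < e -> `|y v - x v| <= e ->
  `|x s - x u| < e \/ `|x v - x s| < e -> 3 * e < `|y s - x s| ->
  `|x v - x u - (y s - x s)| < 3 * e.
Proof.
move=> yvs yxv [xsu|xvs] yxs; last first.
  have := ler_distD (y v) (y s) (x s); have := ler_distD (x v) (y v) (x s).
  by rewrite (distrC (y s) (y v)); lra.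
rewrite (_ : _ - _ - _ = (x s - x u) + (x v - y s)).
  have := ler_normD (x s - x u) (x v - y s); have := ler_distD (y v) (x v) (y s).
  by rewrite (distrC (x v) (y v)); lra.
by rewrite opprB addrACA [RHS]addrACA (addrC (x v)) (addrC (- x u)).
Qed.

End CellIncrements.

(** * The bound uniform in the number of points *)

Section KeyEstimate.
Context {R : realType} {d : measure_display} {T : measurableType d}.
Variable P : probability T R.
Context {E : normedModType R}.
Hypothesis sepE : separable E.
Variable X : nat -> {RV P >-> cadlag01 E}.
Hypothesis X_indep : independent_RVs X.
Variable S : nat -> T -> cadlag01 E.
Hypothesis S_def : forall n w, S n w = \sum_(j < n) X j w.
Variable Y : {RV P >-> cadlag01 E}.
Hypothesis S_cvg : cvg_in_distribution P S Y.
Hypothesis Y_jump : ~ exists (t : R) (c : E), [/\ t \in `[0, 1], c != 0 &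
  P [set w | jump (Y w) t = c] = 1%E].

Let vS n s := vmeasurable_partial_sum sepE S_def n s.
Let vY s := @vmeasurable_eval _ _ _ P E Y s.

(** The first point of the list [F] at which [A] occurs is determined by the future, hence
    independent of the past event [C s]. The constant [c] does not depend on the length of [F]. *)
Lemma decoupling_seq m (F : seq R) (A C : R -> set T) (Z : set T) (c : R) :
  (forall s, s \in F -> measurable (A s : set (future X m))) ->
  (forall s, s \in F -> measurable (C s : set (past X m)) /\ c <= pr P (C s)) ->
  measurable Z -> 0 <= c -> (forall s, s \in F -> A s `&` C s `<=` Z) ->
  c * pr P [set w | exists2 s, s \in F & A s w] <= pr P Z.
Proof.
move=> mA mC mZ c0 ACZ.
pose A' k : set (future X m) := if (k < size F)%N then A (nth 0 F k) else set0.
pose C' k : set (past X m) := if (k < size F)%N then C (nth 0 F k) else setT.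
have mA' k : measurable (A' k).
  rewrite /A'; case: ifPn => [kF|_]; last exact: measurable0.
  by apply: mA; exact: mem_nth.
have mC' k : measurable (C' k).
  rewrite /C'; case: ifPn => [kF|_]; last exact: measurableT.
  exact: (mC _ (mem_nth _ kF)).1.
have mD k : measurable (seqDU A' k) by exact: seqDU_measurable.
rewrite (_ : [set w | _] = \bigcup_k A' k).
  apply: (@decoupling _ _ _ P A' C') => //.
  - by move=> k; apply: (@future_measurable _ _ _ P E X m); exact: mA'.
  - by move=> k; apply: (@past_measurable _ _ _ P E X m); exact: mC'.
  - move=> k; rewrite /A' /C'; case: ifPn => [kF|_]; last by rewrite set0I.
    by apply: ACZ; exact: mem_nth.
  move=> k; rewrite setIC (past_future_indep X_indep (mC' k) (mD k)).
  rewrite /C'; case: ifPn => [kF|kF].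
    by rewrite ler_wpM2r ?pr_ge0//; exact: (mC _ (mem_nth _ kF)).2.
  rewrite (_ : seqDU A' k = set0) ?pr0 ?mulr0//.
  by apply/seteqP; split => w // []; rewrite /A' (negbTE kF).
apply/seteqP; split => w /=.
  move=> [s sF As]; exists (index s F) => //; rewrite /A' index_mem sF.
  by rewrite nth_index.
move=> [k _]; rewrite /A'; case: ifPn => // kF Ak.
by exists (nth 0 F k) => //; exact: mem_nth.
Qed.

(** Which past event leads to [Z] may depend on the future through [B]. Both choices have
    probability at least [c], and treating the two pieces of [A s] separately costs only a factor
    2. *)
Lemma two_sided_decoupling m (F : seq R) (A : R -> set T) (Z : set T) (c : R) :
  (forall s, s \in F -> measurable (A s : set (future X m))) ->
  measurable Z -> 0 <= c ->
  (forall s, s \in F -> exists B C D,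
    [/\ measurable (B : set (future X m)),
        measurable (C : set (past X m)) /\ c <= pr P C,
        measurable (D : set (past X m)) /\ c <= pr P D,
        (A s `&` B) `&` C `<=` Z & (A s `\` B) `&` D `<=` Z]) ->
  c * pr P [set w | exists2 s, s \in F & A s w] <= 2 * pr P Z.
Proof.
move=> mA mZ c0 H.
have /choice[f fP] : forall s, exists f : set T * set T * set T, s \in F ->
    [/\ measurable (f.1.1 : set (future X m)),
        measurable (f.1.2 : set (past X m)) /\ c <= pr P f.1.2,
        measurable (f.2 : set (past X m)) /\ c <= pr P f.2,
        (A s `&` f.1.1) `&` f.1.2 `<=` Z & (A s `\` f.1.1) `&` f.2 `<=` Z].
  move=> s; have [/H[B [C [D BCD]]]|nF] := boolP (s \in F); last by exists (setT, setT, setT).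
  by exists (B, C, D).
have mI s : s \in F -> measurable (A s `&` (f s).1.1 : set (future X m)).
  by move=> sF; have [mB _ _ _ _] := fP s sF; apply: measurableI => //; exact: mA.
have mD s : s \in F -> measurable (A s `\` (f s).1.1 : set (future X m)).
  by move=> sF; have [mB _ _ _ _] := fP s sF; apply: measurableD => //; exact: mA.
have le1 := @decoupling_seq m F (fun s => A s `&` (f s).1.1) (fun s => (f s).1.2) Z c mI _ mZ c0 _.
have le2 := @decoupling_seq m F (fun s => A s `\` (f s).1.1) (fun s => (f s).2) Z c mD _ mZ c0 _.
have mT (A' : R -> set T) : (forall s, s \in F -> measurable (A' s : set (future X m))) ->
    measurable [set w | exists2 s, s \in F & A' s w].
  move=> mA'; apply: measurable_exists_seq => s /mA'.
  exact: (@future_measurable _ _ _ P E X m).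
apply: (@le_trans _ _ (c * (pr P [set w | exists2 s, s \in F & (A s `&` (f s).1.1) w] +
                          pr P [set w | exists2 s, s \in F & (A s `\` (f s).1.1) w]))).
  apply: ler_wpM2l => //; apply: pr_cover; [exact: mT|exact: mT|exact: mT|].
  move=> w [s sF As]; have [Bw|nB] := pselect ((f s).1.1 w); [left|right]; by exists s.
rewrite mulrDr mulr_natl mulr2n; apply: lerD.
  by apply: le1 => s /fP[].
by apply: le2 => s /fP[].
Qed.

Lemma window_seq (L : seq R) (gam eta : R) : (forall t, t \in L -> t \in `[0, 1]) ->
  0 < gam -> 0 < eta ->
  exists2 a : R, 0 < a & exists B, [/\ measurable B, pr P B < eta &
    forall w, ~ B w -> forall t s : R, t \in L -> s \in `[0, 1] ->
      (t - a < s < t -> `|Y w s - left_value (Y w) t| <= gam) /\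
      (t <= s < t + a -> `|Y w s - Y w t| <= gam)].
Proof.
move=> + gam0; elim: L eta => [|t L ih] eta LI eta0.
  by exists 1 => //; exists set0; split; rewrite ?pr0.
have eta2 : 0 < eta / 2 by rewrite divr_gt0.
have [|a a0 [B [mB PB YB]]] := ih (eta / 2) _ eta2.
  by move=> u uL; apply: LI; rewrite inE uL orbT.
have tI : t \in `[0, 1] by apply: LI; rewrite mem_head.
have [b b0 [C [mC PC YC]]] := @random_window _ _ _ P E sepE Y t gam (eta / 2) tI gam0 eta2.
exists (Num.min a b); first by rewrite lt_min a0.
exists (B `|` C); split; first exact: measurableU.
  by have := prU_le P mB mC; lra.
have ma : Num.min a b <= a by rewrite ge_min lexx.
have mb : Num.min a b <= b by rewrite ge_min lexx orbT.
move=> w /not_orP[Bw Cw] u s; rewrite inE => /predU1P[->|uL] sI.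
  by split=> /andP[s1 s2]; [apply: (YC w Cw s sI).1|apply: (YC w Cw s sI).2]; lra.
by split=> /andP[s1 s2]; [apply: (YB w Bw u s uL sI).1|apply: (YB w Bw u s uL sI).2]; lra.
Qed.

Lemma pairs_near (L : seq (R * R)) (r eta : R) (B : set T) :
  (forall p, p \in L -> jump_free Y p.1 /\ jump_free Y p.2) -> 0 < r ->
  measurable B -> pr P B < eta ->
  (forall w, ~ B w -> forall p, p \in L -> `|Y w p.1 - Y w p.2| <= r) ->
  \forall n \near \oo, forall A, measurable A ->
    (forall w, A w -> exists2 p, p \in L & 2 * r <= `|S n w p.1 - S n w p.2|) ->
    pr P A < eta.
Proof.
move=> LD r0 mB PB YB.
pose h (K : seq (R * R)) (x : R -> E) : R := \big[Num.max/0]_(p <- K) `|x p.1 - x p.2|.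
have h_le K x (c : R) : 0 <= c -> (forall p, p \in K -> `|x p.1 - x p.2| <= c) -> h K x <= c.
  by move=> c0 Kc; rewrite /h big_seq_cond; apply: bigmax_le => // p /andP[pK _]; exact: Kc.
have h_ge K x p : p \in K -> `|x p.1 - x p.2| <= h K x.
  rewrite /h; elim: K => // q K ih; rewrite inE big_cons le_max.
  by move=> /predU1P[->|/ih ->]; rewrite ?lexx ?orbT.
have h0 K x : 0 <= h K x by rewrite /h; exact: bigmax_ge_id.
have mh K : measurable_fun setT (fun w => h K (Y w)).
  elim: K => [|p K ih].
    by under eq_fun do rewrite /h big_nil; exact: measurable_cst.
  under eq_fun do rewrite /h big_cons; apply: measurable_maxr => //.
  by apply: vmeasurable_norm; apply: vmeasurableB => //; exact: vY.
(* The stable point 1 makes the list nonempty, so that closeness on it implies [0 <= g]. *)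
pose pts := 1 :: ([seq p.1 | p <- L] ++ [seq p.2 | p <- L]).
have hlip (g : R) x x' : (forall t, t \in pts -> `|x t - x' t| <= g) ->
    `|h L x - h L x'| <= 2 * g.
  have one (y y' : R -> E) : (forall t, t \in pts -> `|y t - y' t| <= g) ->
      h L y <= h L y' + 2 * g.
    move=> yy; have g0 : 0 <= g by apply: le_trans (yy 1 (mem_head _ _)).
    apply: h_le; first by rewrite addr_ge0// mulr_ge0.
    move=> p pL.
    have y1 : `|y p.1 - y' p.1| <= g.
      by apply: yy; rewrite inE mem_cat map_f ?orbT.
    have y2 : `|y p.2 - y' p.2| <= g.
      by apply: yy; rewrite inE mem_cat (map_f _ pL) ?orbT.
    have := h_ge L y' p pL; have := ler_distD (y' p.1) (y p.1) (y p.2).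
    have := ler_distD (y' p.2) (y' p.1) (y p.2); rewrite (distrC (y' p.2)); lra.
  move=> xx; rewrite ler_distl; have := one x x' xx.
  by have := one x' x (fun t tp => ltac:(rewrite distrC; exact: xx)); lra.
have pts_stable t : t \in pts -> stable_at P Y t.
  rewrite inE mem_cat => /predU1P[->|/orP[/mapP[p pL ->]|/mapP[p pL ->]]].
  - exact/jump_free_stable/jump_free1.
  - exact: jump_free_stable (LD p pL).1.
  - exact: jump_free_stable (LD p pL).2.
have Yh : pr P [set w | r < h L (Y w)] < eta.
  apply: le_lt_trans PB; apply: le_pr => //; first exact: measurable_fun_gt.
  move=> w /= rh; apply: contrapT => nB; move: rh; apply/negP; rewrite -leNgt.
  by apply: h_le; [exact: ltW|exact: YB].
have [N _ NP] := fdd_pr_near S_cvg pts_stable (ltac:(by []) : 0 <= 2) r0 hlip (mh L) Yh.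
exists N => // n Nn A mA AP; apply: (NP n Nn A mA) => w Aw.
by have [p pL] := AP w Aw; move=> /le_trans; apply; exact: h_ge.
Qed.

(** Outside [Z], a large difference at [s] contradicts a small increment of [S m]. In a cell with a
    fixed jump time it makes that increment [3 * eps]-close, hence [rho t]-close, to a future
    quantity [z]. If [z] is at distance at least [4 * rho t] from [a t], an increment within
    [3 * rho t] of [a t] is impossible; otherwise, since [8 * rho t <= |a t - b t|], one within
    [3 * rho t] of [b t] is. *)
Lemma key_cell m n (Z : set T) (e eps kap dw : R) (bigs : seq R) (a b : R -> E)
    (rho : R -> R) (u s v : R) : (m <= n)%N -> 0 < eps -> eps <= e ->
  (forall t, t \in bigs -> 3 * eps <= rho t /\ 8 * rho t <= `|a t - b t|) ->
  cell_ok P S e bigs a b rho kap dw u v m ->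
  (forall w, ~ Z w -> [/\
     `|S m w s - S m w u| < eps \/ `|S m w v - S m w s| < eps,
     `|S n w s - S n w u| < eps \/ `|S n w v - S n w s| < eps,
     `|S n w u - S m w u| <= eps /\ `|S n w v - S m w v| <= eps,
     forall t, t \in bigs -> t - dw < u -> s < t -> `|S n w s - S n w u| < eps &
     forall t, t \in bigs -> t <= s -> v < t + dw -> `|S n w v - S n w s| < eps]) ->
  exists B C D,
    [/\ measurable (B : set (future X m)),
        measurable (C : set (past X m)) /\ kap <= pr P C,
        measurable (D : set (past X m)) /\ kap <= pr P D,
        ([set w | 13 * e < `|S n w s - S m w s|] `&` B) `&` C `<=` Z &
        ([set w | 13 * e < `|S n w s - S m w s|] `\` B) `&` D `<=` Z].
Proof.
move=> mn eps0 epse rhoP uvP ZP.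
have vD : @vmeasurable R E _ (past X m) (fun w => S m w v - S m w u).
  by apply: vmeasurableB => //; exact: past_partial_sum.
case: uvP => [small|[t [tb /andP[ut tv] tu vt [ka kb]]]].
  have mC : measurable ([set w | `|S m w v - S m w u| < 4 * e] : set (past X m)).
    by apply: measurable_fun_lt; exact: vmeasurable_norm.
  exists setT, [set w | `|S m w v - S m w u| < 4 * e], [set w | `|S m w v - S m w u| < 4 * e].
  split => //; last by move=> w [[_ []]].
  move=> w [[/= Rs _] Dm]; apply: contrapT => nZ; have [Gm Gn [Ru Rv] _ _] := ZP w nZ.
  move: Rs; apply/negP; rewrite -leNgt; have e0 := lt_le_trans eps0 epse.
  apply: (@small_increment _ _ _ _ u _ v _ e0) Dm; [| |exact: le_trans epse|exact: le_trans epse].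
    by case: Gm => /lt_le_trans/(_ epse); [left|right].
  by case: Gn => /lt_le_trans/(_ epse); [left|right].
have [er ab] := rhoP t tb.
(* Before [t] the path of [S n] is still near its value at [u], so the difference means that [S m]
   has jumped too early; from [t] on [S n] is already near its value at [v] and [S m] is late. This
   decides the sign. *)
pose z w := if s < t then - (S n w s - S m w s) else S n w s - S m w s.
have vz : @vmeasurable R E _ (future X m) z.
  have vR : @vmeasurable R E _ (future X m) (fun w => S n w s - S m w s).
    by apply: future_increment => //; rewrite leqnn.
  by rewrite /z; case: (s < t) => //; exact: vmeasurableN.
have Dz w : ~ Z w -> 13 * e < `|S n w s - S m w s| -> `|S m w v - S m w u - z w| < 3 * eps.
  move=> nZ Rs; have [Gm Gn [Ru Rv] cl cr] := ZP w nZ; rewrite /z.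
  have [st|ts] := ltP s t.
    by apply: left_increment (cl t tb tu st) Ru Gm _; lra.
  by apply: right_increment (cr t tb ts vt) Rv Gm _; lra.
exists [set w | 4 * rho t <= `|z w - a t|], [set w | `|S m w v - S m w u - a t| < 3 * rho t],
  [set w | `|S m w v - S m w u - b t| < 3 * rho t]; split.
- by apply: measurable_fun_ge; exact: vz.
- by split=> //; apply: measurable_fun_lt; exact: vD.
- by split=> //; apply: measurable_fun_lt; exact: vD.
- move=> w [[/= Rs za] Da]; apply: contrapT => nZ; have := Dz w nZ Rs.
  have := ler_distD (S m w v - S m w u) (z w) (a t); rewrite (distrC (z w) (_ - _)); lra.
- move=> w [[/= Rs /negP]]; rewrite -ltNge => za Db; apply: contrapT => nZ; have := Dz w nZ Rs.
  have := ler_distD (S m w v - S m w u) (z w) (b t); rewrite (distrC (z w) (_ - _)).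
  have := ler_distD (z w) (a t) (b t); rewrite (distrC (a t) (z w)); lra.
Qed.

(** The index [m] is chosen from the grid, the cells and the three-point modulus, all independent of
    [F]. Only the position of [S n] relative to the fixed jump times at the points of [F] requires
    [n] to depend on [F]. *)
Lemma key_estimate (e p : R) : 0 < e -> 0 < p ->
  exists M, forall m, (M <= m)%N -> forall F : seq R, (forall s, s \in F -> jump_free Y s) ->
  exists N, forall n, (N <= n)%N -> (m <= n)%N ->
    pr P [set w | exists2 s, s \in F & 13 * e < `|S n w s - S m w s|] <= p.
Proof.
move=> e0 p0; have [bigs bigsP] := big_jump_times sepE Y e0.
have /choice[f fP] : forall t, exists f : E * E * R * R, t \in bigs ->
    [/\ 0 < f.1.2, 0 < f.2, 8 * f.1.2 <= `|f.1.1.1 - f.1.1.2|,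
      f.2 <= pr P [set w | `|jump (Y w) t - f.1.1.1| < f.1.2] &
      f.2 <= pr P [set w | `|jump (Y w) t - f.1.1.2| < f.1.2]].
  move=> t; have [/bigsP[tI pt]|_] := boolP (t \in bigs); last by exists (0, 0, 0, 0).
  have [a [b [rho [kap H]]]] := big_jump_spread sepE Y_jump e0 tI pt.
  by exists (a, b, rho, kap).
pose a t := (f t).1.1.1; pose b t := (f t).1.1.2; pose rho t := (f t).1.2.
have rho0 t : t \in bigs -> 0 < rho t by case/fP.
have [|k1 k10 k1P] := @seq_min_gt0 R R bigs (fun t => (f t).2 / 2).
  by move=> t /fP[_ k _ _ _]; rewrite divr_gt0.
have [|r1 r10 r1P] := @seq_min_gt0 R R bigs (fun t => rho t / 3).
  by move=> t tb; rewrite divr_gt0// rho0.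
pose kap := Num.min k1 (1 / 4); pose eps := Num.min r1 e.
have kap0 : 0 < kap by rewrite lt_min k10 divr_gt0.
have kap4 : 4 * kap <= 1.
  by have : kap <= 1 / 4; [rewrite ge_min lexx orbT|lra].
have kapk1 : kap <= k1 by rewrite ge_min lexx.
have eps0 : 0 < eps by rewrite lt_min r10.
have epse : eps <= e by rewrite ge_min lexx orbT.
have epsr1 : eps <= r1 by rewrite ge_min lexx.
have aP t : t \in bigs -> 2 * kap <= pr P [set w | `|jump (Y w) t - a t| < rho t].
  by move=> tb; have k1t := k1P t tb; have [_ _ _ ka _] := fP t tb; apply: (le_trans _ ka); lra.
have bP t : t \in bigs -> 2 * kap <= pr P [set w | `|jump (Y w) t - b t| < rho t].
  by move=> tb; have k1t := k1P t tb; have [_ _ _ _ kb] := fP t tb; apply: (le_trans _ kb); lra.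
have rhoP t : t \in bigs -> 3 * eps <= rho t /\ 8 * rho t <= `|a t - b t|.
  by move=> tb; have [_ _ ab _ _] := fP t tb; split => //; have := r1P t tb; lra.
(* The exceptional set has probability at most [4 * eta] and decoupling doubles it:
   [8 * eta / kap = p / 2]. The other half of [p] covers the points of [F] on the grid. *)
pose eta := kap * p / 16; have eta0 : 0 < eta by rewrite divr_gt0// mulr_gt0.
have [||dw dw0 [B [mB PB YB]]] := @window_seq bigs (eps / 4) eta _ _ eta0.
- by move=> t /bigsP[].
- by rewrite divr_gt0.
have eps2 : 0 < eps / 2 by rewrite divr_gt0.
have [del del0 [B3 [mB3 PB3 YB3]]] := @random_three_point _ _ _ P E sepE Y (eps / 2) eta eps2 eta0.
have [N3 _ three] := three_point_near S_cvg del0 eps2 mB3 PB3 YB3.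
have [beta beta0 cells] := cells_exist sepE S_def S_cvg e0 bigsP rho0 kap0 kap4 dw0 aP bP.
pose beta' := Num.min beta (del / 2).
have beta'0 : 0 < beta' by rewrite lt_min beta0 divr_gt0.
have [G [GD Ggrid]] := jump_free_grid sepE Y beta'0.
have [N1 N1P] : exists N, forall q, q \in [seq (u, v) | u <- G, v <- G] ->
    forall m n, (N <= m)%N -> (m <= n)%N -> q.1 < q.2 -> q.2 - q.1 < beta ->
    cell_ok P S e bigs a b rho kap dw q.1 q.2 m.
  apply: (@seq_eventually _ _ (fun q m _ => q.1 < q.2 -> q.2 - q.1 < beta ->
    cell_ok P S e bigs a b rho kap dw q.1 q.2 m)).
  move=> q /allpairsP[[u v] [/= uG vG ->]] /=.
  have [uv|vu] := ltP u v; last by exists 0%N => m n _ _ uv; exfalso; move: uv vu => /=; lra.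
  have [uvb|uvb] := ltP (v - u) beta; last first.
    by exists 0%N => m n _ _ _ h; exfalso; move: h uvb => /=; lra.
  have [N NP] := cells u v (GD u uG) (GD v vG) uv uvb.
  by exists N => m n Nm _ _ _; exact: NP.
pose g := eta / (size G).+1%:R; have g0 : 0 < g by rewrite divr_gt0.
have [N2 N2P] : exists N, forall u, u \in G -> forall m n, (N <= m)%N -> (m <= n)%N ->
    pr P [set w | eps < `|S n w u - S m w u|] < g.
  apply: (@seq_eventually _ _ (fun u m n => pr P [set w | eps < `|S n w u - S m w u|] < g)).
  move=> u uG; apply: (pointwise_cauchy sepE X_indep S_def S_cvg) => //.
  by apply: jump_free_stable => //; exact: GD.
exists (maxn N1 (maxn N2 N3)) => m; rewrite !geq_max => /and3P[N1m N2m N3m] F FD.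
have /choice[c cP] : forall s, exists c : R * R, s \in F -> s \notin G ->
    [/\ c.1 \in G, c.2 \in G, c.1 < s < c.2 & c.2 - c.1 < beta'].
  move=> s; have [sF|_] := boolP (s \in F); last by exists (0, 0).
  have [sI _] := FD s sF; have [sG|[u [v H]]] := Ggrid s sI.
    by exists (0, 0); rewrite sG.
  by exists (u, v).
pose F' := [seq s <- F | s \notin G].
have cF s : s \in F' -> [/\ (c s).1 \in G, (c s).2 \in G,
    (c s).1 < s < (c s).2 & (c s).2 - (c s).1 < beta'].
  by rewrite mem_filter => /andP[sG sF]; exact: cP.
have F'D s : s \in F' -> jump_free Y s.
  by rewrite mem_filter => /andP[_]; exact: FD.
(* The pairs in [L] lie on the same side of a fixed big jump time, inside its window, so [Y] takes
   close values there and [S n] inherits this for large [n]. *)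
pose cl s := has (fun t => (t - dw < (c s).1) && (s < t)) bigs.
pose cr s := has (fun t => (t <= s) && ((c s).2 < t + dw)) bigs.
pose L := [seq (s, (c s).1) | s <- F' & cl s] ++ [seq ((c s).2, s) | s <- F' & cr s].
have LD q : q \in L -> jump_free Y q.1 /\ jump_free Y q.2.
  rewrite mem_cat => /orP[/mapP[s + ->]|/mapP[s + ->]]; rewrite mem_filter => /andP[_ sF'] /=;
    by have [uG vG _ _] := cF s sF'; split; [exact: F'D || exact: GD|exact: F'D || exact: GD].
have F'I s : s \in F' -> s \in `[0, 1] by case/F'D.
have GI u : u \in G -> u \in `[0, 1] by case/GD.
have LB w : ~ B w -> forall q, q \in L -> `|Y w q.1 - Y w q.2| <= eps / 2.
  move=> nB q; rewrite mem_cat => /orP[/mapP[s + ->]|/mapP[s + ->]];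
    rewrite mem_filter => /andP[/hasP[t tb /andP[ts1 ts2]] sF'] /=;
    have [uG vG /andP[us sv] _] := cF s sF'.
    have h1 : `|Y w s - left_value (Y w) t| <= eps / 4.
      by apply: (YB w nB t s tb (F'I s sF')).1; lra.
    have h2 : `|Y w (c s).1 - left_value (Y w) t| <= eps / 4.
      by apply: (YB w nB t _ tb (GI _ uG)).1; lra.
    have := ler_distD (left_value (Y w) t) (Y w s) (Y w (c s).1).
    by rewrite (distrC (left_value (Y w) t)); lra.
  have h1 : `|Y w s - Y w t| <= eps / 4.
    by apply: (YB w nB t s tb (F'I s sF')).2; lra.
  have h2 : `|Y w (c s).2 - Y w t| <= eps / 4.
    by apply: (YB w nB t _ tb (GI _ vG)).2; lra.
  have := ler_distD (Y w t) (Y w (c s).2) (Y w s).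
  by rewrite (distrC (Y w t)); lra.
have eps2E : 2 * (eps / 2) = eps by rewrite mulrC divfK.
have [N4 _ pairs] := pairs_near LD eps2 mB PB LB.
exists N4 => n N4n mn.
pose Gset k := [set w | exists2 s, s \in F' &
  ([set w | eps <= `|S k w s - S k w (c s).1|] `&`
   [set w | eps <= `|S k w (c s).2 - S k w s|]) w].
have vI k s t : vmeasurable (fun w => S k w s - S k w t).
  by apply: vmeasurableB => //; exact: vS.
have vR s : vmeasurable (fun w => S n w s - S m w s).
  by apply: vmeasurableB => //; exact: vS.
have mG k : measurable (Gset k).
  apply: measurable_exists_seq => s _; apply: measurableI;
    by apply: measurable_fun_ge; apply: vmeasurable_norm; exact: vI.
have PG k : (N3 <= k)%N -> pr P (Gset k) < eta.
  move=> N3k; apply: (three k N3k _ (mG k)) => w [s sF' [/= s1 s2]].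
  have [uG vG /andP[us sv] uv] := cF s sF'.
  have bd : beta' <= del / 2 by rewrite ge_min lexx orbT.
  have := GI _ uG; have := GI _ vG; rewrite !in_itv/= => /andP[_ v1] /andP[u0 _].
  exists (c s).1, s, (c s).2; rewrite eps2E; split; split => //; try exact: ltW.
  exact: le_trans (ltW uv) bd.
pose H := [set w | exists2 q, q \in L & [set w | eps <= `|S n w q.1 - S n w q.2|] w].
have mH : measurable H.
  apply: measurable_exists_seq => q _.
  by apply: measurable_fun_ge; apply: vmeasurable_norm; exact: vI.
have PH : pr P H < eta.
  apply: (pairs n N4n _ mH) => w [q qL /= Hq]; exists q => //.
  by rewrite eps2E.
pose W := [set w | exists2 u, u \in G & [set w | eps < `|S n w u - S m w u|] w].
have mW' u : measurable [set w | eps < `|S n w u - S m w u|].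
  by apply: measurable_fun_gt; apply: vmeasurable_norm; exact: vR.
have mW : measurable W by apply: measurable_exists_seq => u _; exact: mW'.
have PW : pr P W <= eta.
  apply: le_trans (pr_exists_seq (c := g) _ _) _ => //.
    by move=> u uG; apply/ltW/N2P.
  rewrite /g mulrCA ler_piMr ?(ltW eta0)// ler_pdivrMr// mul1r ler_nat.
  exact: leqnSn.
pose Z := Gset m `|` Gset n `|` H `|` W.
have mZ : measurable Z by do 3 apply: measurableU => //.
have PZ : pr P Z <= 4 * eta.
  have H1 := prU_le P (measurableU _ _ (measurableU _ _ (mG m) (mG n)) mH) mW.
  have H2 := prU_le P (measurableU _ _ (mG m) (mG n)) mH.
  have H3 := prU_le P (mG m) (mG n).
  have := PG m N3m; have := PG n (leq_trans N3m mn); rewrite /Z; lra.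
pose A s := [set w | 13 * e < `|S n w s - S m w s|].
have mA s : measurable (A s : set (future X m)).
  apply: measurable_fun_gt; apply: vmeasurable_norm.
  by apply: future_increment => //; rewrite leqnn.
have PA : kap * pr P [set w | exists2 s, s \in F' & A s w] <= 2 * pr P Z.
  apply: (@two_sided_decoupling m) => //; first exact: ltW.
  move=> s sF'; have [uG vG /andP[us sv] uv] := cF s sF'.
  apply: (@key_cell m n Z e eps kap dw bigs a b rho (c s).1 s (c s).2) => //.
    apply: (N1P ((c s).1, (c s).2) _ m m) => //=.
    - exact: allpairs_f.
    - exact: lt_trans sv.
    - by apply: lt_le_trans uv _; rewrite ge_min lexx.
  move=> w nZ; have nG k : Gset k `<=` Z -> `|S k w s - S k w (c s).1| < eps \/
      `|S k w (c s).2 - S k w s| < eps.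
    move=> GZ; have [ks|ks] := ltP `|S k w s - S k w (c s).1| eps; first by left.
    have [kv|kv] := ltP `|S k w (c s).2 - S k w s| eps; first by right.
    by exfalso; apply/nZ/GZ; exists s.
  have nR u : u \in G -> `|S n w u - S m w u| <= eps.
    move=> uG'; rewrite leNgt; apply/negP => uR.
    by apply: nZ; right; exists u.
  have nH q : q \in L -> `|S n w q.1 - S n w q.2| < eps.
    move=> qL; rewrite ltNge; apply/negP => qR.
    by apply: nZ; left; right; exists q.
  split.
  - by apply: nG => x; do 3 left.
  - by apply: nG => x; do 2 left; right.
  - by split; exact: nR.
  - move=> t tb tu st; apply: (nH (s, (c s).1)); rewrite mem_cat; apply/orP; left.
    apply: map_f; rewrite mem_filter sF' andbT; apply/hasP; exists t => //.
    by rewrite tu.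
  - move=> t tb ts vt; apply: (nH ((c s).2, s)); rewrite mem_cat; apply/orP; right.
    apply: (map_f (fun s => ((c s).2, s))); rewrite mem_filter sF' andbT.
    apply/hasP; exists t => //.
    by rewrite ts.
have mE F0 : measurable [set w | exists2 s, s \in (F0 : seq R) & A s w].
  apply: measurable_exists_seq => s _; exact: (@future_measurable _ _ _ P E X m).
have sub : [set w | exists2 s, s \in F & A s w] `<=` [set w | exists2 s, s \in F' & A s w] `|` W.
  move=> w [s sF As]; have [sG|sG] := boolP (s \in G).
    by right; exists s => //; apply: le_lt_trans As; rewrite /=; lra.
  by left; exists s => //; rewrite mem_filter sG.
apply: le_trans (pr_cover P (mE F) (mE F') mW sub) _.
have kp : kap * p <= p by rewrite ler_piMl ?(ltW p0)//; lra.
have PA' : pr P [set w | exists2 s, s \in F' & A s w] <= p / 2.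
  rewrite -(ler_pM2l kap0); apply: le_trans PA _; rewrite /eta in PZ; lra.
rewrite /eta in PW; lra.
Qed.

End KeyEstimate.

(** * Almost sure uniform convergence *)

Section MaximalInequality.
Context {R : realType} {d : measure_display} {T : measurableType d}.
Variable P : probability T R.
Context {E : normedModType R}.
Hypothesis sepE : separable E.
Variable X : nat -> {RV P >-> cadlag01 E}.
Hypothesis X_indep : independent_RVs X.
Variable S : nat -> T -> cadlag01 E.
Hypothesis S_def : forall n w, S n w = \sum_(j < n) X j w.

Let vI k s t : vmeasurable (fun w => S k w s - S t w s).
Proof. by apply: vmeasurableB => //; exact: vmeasurable_partial_sum. Qed.

(** At the first [k] for which [S k - S m] exceeds [2 * c] somewhere on [F], the independent
    difference [S n - S k] is at most [c] on [F] with probability at least [1 - p], and then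
    [S n - S m] exceeds [c]. *)
Lemma ottaviani m N n (F : seq R) (c p : R) : (m <= N)%N -> (N <= n)%N -> 0 <= p <= 1 ->
  (forall k, (m <= k <= N)%N ->
    pr P [set w | exists2 s, s \in F & c < `|S n w s - S k w s|] <= p) ->
  (1 - p) * pr P [set w | exists2 k, k \in index_iota m N.+1 &
      [set w | exists2 s, s \in F & 2 * c < `|S k w s - S m w s|] w] <= p.
Proof.
move=> mN Nn /andP[p0 p1] tail.
pose A k := if (m <= k <= N)%N then
  [set w | exists2 s, s \in F & [set w | 2 * c < `|S k w s - S m w s|] w] else set0.
pose C k := if (m <= k <= N)%N then
  ~` [set w | exists2 s, s \in F & [set w | c < `|S n w s - S k w s|] w] else setT.
(* Stated for every later [l], because [seqDU A k] also involves the earlier events. *)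
have mA k l : (k <= l)%N -> measurable (A k : set (past X l)).
  move=> kl; rewrite /A; case: ifPn => [/andP[mk kN]|_]; last exact: measurable0.
  apply: (@measurable_exists_seq _ _ (past X l)) => s _.
  apply: measurable_fun_gt; apply: vmeasurable_norm; apply: vmeasurableB => //.
    exact: past_partial_sum.
  by apply: past_partial_sum => //; exact: leq_trans kl.
have mC k : measurable (C k : set (future X k)).
  rewrite /C; case: ifPn => [/andP[mk kN]|_]; last exact: measurableT.
  apply: measurableC; apply: (@measurable_exists_seq _ _ (future X k)) => s _.
  apply: measurable_fun_gt; apply: vmeasurable_norm; apply: future_increment => //.
  by rewrite leqnn (leq_trans kN).
have mD k : measurable (seqDU A k : set (past X k)).
  rewrite /seqDU; apply: measurableD; first exact: mA.
  by apply: bigsetU_measurable => j _; apply: mA; exact: ltnW.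
have mtail k : measurable [set w | exists2 s, s \in F & c < `|S n w s - S k w s|].
  apply: (@measurable_exists_seq _ _ _ _ (fun s => [set w | c < `|S n w s - S k w s|])) => s _.
  by apply: measurable_fun_gt; apply: vmeasurable_norm; exact: vI.
apply: (@le_trans _ _ (pr P [set w | exists2 s, s \in F & c < `|S n w s - S m w s|])); last first.
  by apply: tail; rewrite leqnn.
rewrite (_ : [set w | exists2 k, _ & _] = \bigcup_k A k); last first.
  apply/seteqP; split => w /=.
    by move=> [k]; rewrite mem_index_iota ltnS => kN Fk; exists k => //; rewrite /A kN.
  move=> [k _]; rewrite /A; case: ifPn => // kN Fk.
  by exists k => //; rewrite mem_index_iota ltnS.
apply: (@decoupling _ _ _ P A C) => //.
- by move=> k; apply: (@past_measurable _ _ _ P E X k); exact: mA.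
- by move=> k; apply: (@future_measurable _ _ _ P E X k); exact: mC.
- by rewrite subr_ge0.
- move=> k w; rewrite /A /C; case: ifPn => [kN|_ []//] [[s sF sk] Cw].
  exists s => //; have : `|S n w s - S k w s| <= c.
    by rewrite leNgt; apply/negP => ?; apply: Cw; exists s.
  move: sk => /=; have := ler_distD (S n w s) (S k w s) (S m w s).
  rewrite (distrC (S k w s) (S n w s)); lra.
move=> k; rewrite (past_future_indep X_indep (mD k) (mC k)) mulrC ler_wpM2l ?pr_ge0//.
rewrite /C; case: ifPn => [kN|_]; last by rewrite prT gerBl.
by rewrite prC ?lerD2l ?lerN2; [exact: tail|exact: mtail].
Qed.

Variable Y : {RV P >-> cadlag01 E}.
Hypothesis S_cvg : cvg_in_distribution P S Y.
Hypothesis Y_jump : ~ exists (t : R) (c : E), [/\ t \in `[0, 1], c != 0 &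
  P [set w | jump (Y w) t = c] = 1%E].

Lemma jump_free_right_dense : exists q : nat -> R,
  right_dense q /\ forall i, jump_free Y (q i).
Proof.
have [q [qI qd]] := @right_dense_exists R.
have /choice[g gP] : forall ik : nat * nat, exists t, jump_free Y t /\
    (q ik.1 <= t) /\ (q ik.1 < 1 -> t < q ik.1 + invS ik.2).
  move=> [i k] /=; have := qI i; rewrite in_itv/= => /andP[q0 q1].
  have [q1'|q1'] := ltP (q i) 1; last by exists 1; split; [exact: jump_free1|].
  have k0 : 0 < invS k :> R by exact: invS_gt0.
  have [|||t [/andP[t1 t2] jt]] := @jump_free_dense _ _ _ P E sepE Y (q i)
    (Num.min 1 (q i + invS k)).
  - by [].
  - by rewrite lt_min q1' ltrDl.
  - by rewrite ge_min lexx.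
  exists t; split => //; split; first exact: ltW.
  by move=> _; apply: lt_le_trans t2 _; rewrite ge_min lexx orbT.
pose r n := if choice.unpickle n is Some ik then g ik else 1.
have rD i : jump_free Y (r i).
  by rewrite /r; case: choice.unpickle => [ik|]; [exact: (gP ik).1|exact: jump_free1].
exists r; split => //; split; first by move=> i; case: (rD i).
move=> s a sI a0; move: (sI); rewrite in_itv/= => /andP[s0].
rewrite le_eqVlt => /predU1P[s1|s1].
  have [i qi] := qd s a sI a0; exists (choice.pickle (i, 0%N)); rewrite /r choice.pickleK.
  have [[gI _] [qg _]] := gP (i, 0%N); move: gI qg qi; rewrite in_itv/=; lra.
(* Half of [a] is spent on reaching [q i], half on the jump-free time to its right; the bound
   [1 - s] ensures [q i < 1], so that this second time is close. *)
have [|i /andP[q1 q2]] := qd s (Num.min (a / 2) (1 - s)) sI.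
  by rewrite lt_min divr_gt0// subr_gt0.
have m1 : Num.min (a / 2) (1 - s) <= a / 2 by rewrite ge_min lexx.
have m2 : Num.min (a / 2) (1 - s) <= 1 - s by rewrite ge_min lexx orbT.
have [k ka] := invS_lt (ltac:(lra) : 0 < a / 2).
exists (choice.pickle (i, k)); rewrite /r choice.pickleK.
by have [_ [/= qg /(_ ltac:(lra)) gq]] := gP (i, k); lra.
Qed.

Lemma maximal_estimate (e p : R) : 0 < e -> 0 < p -> exists m,
  forall (F : seq R) N, (forall s, s \in F -> jump_free Y s) -> (m <= N)%N ->
    pr P [set w | exists2 k, k \in index_iota m N.+1 &
      [set w | exists2 s, s \in F & e < `|S k w s - S m w s|] w] <= p.
Proof.
(* With [p' <= 1 / 2], Ottaviani's inequality gives a bound by [2 * p' <= p]. The level [e / 26]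
   below compensates the factor 13 of the key estimate and the factor 2 of Ottaviani. *)
move=> e0 p0; pose p' := Num.min (p / 2) (1 / 2).
have p'0 : 0 < p' by rewrite lt_min !divr_gt0.
have p'p : p' <= p / 2 by rewrite ge_min lexx.
have p'h : p' <= 1 / 2 by rewrite ge_min lexx orbT.
have e26 : 0 < e / 26 by rewrite divr_gt0.
have [m key] := key_estimate sepE X_indep S_def S_cvg Y_jump e26 p'0.
exists m => F N FD mN.
have [M MP] : exists M, forall k, k \in index_iota m N.+1 -> forall i n, (M <= i)%N -> (i <= n)%N ->
    (k <= n)%N -> pr P [set w | exists2 s, s \in F & 13 * (e / 26) < `|S n w s - S k w s|] <= p'.
  apply: (@seq_eventually _ _ (fun k _ n => (k <= n)%N ->
    pr P [set w | exists2 s, s \in F & 13 * (e / 26) < `|S n w s - S k w s|] <= p')) => k.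
  rewrite mem_index_iota => /andP[mk _]; have [M MP] := key k mk F FD.
  by exists M => i n Mi /(leq_trans Mi); exact: MP.
have e13 : 2 * (13 * (e / 26)) = e by field.
have p'01 : 0 <= p' <= 1 by apply/andP; split; lra.
have := @ottaviani m N (maxn M N) F (13 * (e / 26)) p' mN (leq_maxr _ _) p'01 _.
rewrite e13; set q := pr P _ => H.
have {}H : (1 - p') * q <= p'.
  apply: H => k kN; apply: (MP k _ _ _ (leqnn M)).
  - by rewrite mem_index_iota ltnS.
  - exact: leq_maxl.
  - by rewrite leq_max; case/andP: kN => _ ->; rewrite orbT.
have q0 : 0 <= q by exact: pr_ge0.
have : p' * q <= 1 / 2 * q by rewrite ler_wpM2r.
lra.
Qed.

End MaximalInequality.

Section UniformLimit.
Context {R : realType} {E : completeNormedModType R}.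

Lemma cauchy_seq_cvg (u : nat -> E) :
  (forall e : R, 0 < e -> exists N, forall n, (N <= n)%N -> `|u n - u N| <= e) ->
  exists l : E, forall e : R, 0 < e -> exists N, forall n, (N <= n)%N -> `|u n - l| <= e.
Proof.
move=> uC; have /cauchy_cvgP/cvg_ex[l ul] : cauchy (u @ \oo).
  apply: cauchy_exP => e e0; have [|N NP] := uC (e / 2); first by rewrite divr_gt0.
  exists (u N); exists N => // n /= Nn; rewrite -ball_normE /= distrC.
  by apply: le_lt_trans (NP n Nn) _; lra.
exists l => e e0; move/cvgrPdist_le: ul => /(_ e e0)[N _ NP].
by exists N => n Nn; rewrite distrC; exact: NP.
Qed.

Lemma uniform_limit_cadlag (x : nat -> cadlag01 E) :
  (forall e : R, 0 < e -> exists N, forall n, (N <= n)%N -> forall s : R, s \in `[0, 1] ->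
    `|x n s - x N s| <= e) ->
  exists y : cadlag01 E, forall e : R, 0 < e -> exists N, forall n, (N <= n)%N ->
    forall s : R, s \in `[0, 1] -> `|x n s - y s| <= e.
Proof.
move=> xC.
have /choice[f fP] : forall s : R, exists l : E, (s \in `[0, 1] -> forall e : R, 0 < e ->
    exists N, forall n, (N <= n)%N -> `|x n s - l| <= e) /\ (s \notin `[0, 1] -> l = 0).
  move=> s; have [sI|sI] := boolP (s \in `[0, 1]); last by exists 0.
  have [e /xC[N NP]|l lP] := @cauchy_seq_cvg (fun n => x n s); last by exists l.
  by exists N => n Nn; exact: NP.
have fU (e : R) : 0 < e -> exists N, forall n, (N <= n)%N ->
    forall s : R, s \in `[0, 1] -> `|x n s - f s| <= e.
  move=> e0; have [|N NP] := xC (e / 3); first by rewrite divr_gt0.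
  exists N => n Nn s sI; have [|M MP] := (fP s).1 sI (e / 3); first by rewrite divr_gt0.
  have := MP (maxn N M) (leq_maxr _ _).
  have := NP (maxn N M) (leq_maxl _ _) s sI; have := NP n Nn s sI.
  have := ler_distD (x N s) (x n s) (f s).
  have := ler_distD (x (maxn N M) s) (x N s) (f s).
  rewrite (distrC (x N s) (x (maxn N M) s)); lra.
have f_cadlag : is_cadlag01 f.
  split=> [t t01|t t01|t]; last exact: (fP t).2.
    have tI : t \in `[0, 1] by rewrite in_itv/=; lra.
    apply/cvgrPdist_le => e e0; have [|N /(_ N (leqnn N)) NP] := fU (e / 3).
      by rewrite divr_gt0.
    have [|a a0 aP] := @cadlag_right _ _ (x N) t (e / 3) t01; first by rewrite divr_gt0.
    exists (Num.min a (1 - t)) => /=; first by rewrite lt_min a0; lra.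
    move=> s; rewrite /= lt_min ltr_distlC => /andP[/andP[_ sa]].
    rewrite ltr_distlC => /andP[_ s1] ts.
    have sI : s \in `[0, 1] by rewrite in_itv/=; lra.
    have := NP s sI; have := NP t tI; have := aP s; rewrite (ltW ts) sa => /(_ isT).
    have := ler_distD (x N t) (f t) (f s); have := ler_distD (x N s) (x N t) (f s).
    rewrite (distrC (f t) (x N t)) (distrC (x N t) (x N s)); lra.
  (* The left limit of [f] at [t] is the limit of the left limits of the [x n], which inherit the
     uniform Cauchy property. *)
  have [e e0|l lP] := @cauchy_seq_cvg (fun n => left_value (x n) t).
    have [|N NP] := xC (e / 3); first by rewrite divr_gt0.
    exists N => n Nn.
    have [|a a0 aP] := @cadlag_left _ _ (x n) t (e / 3) t01; first by rewrite divr_gt0.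
    have [|b b0 bP] := @cadlag_left _ _ (x N) t (e / 3) t01; first by rewrite divr_gt0.
    pose c := Num.min (Num.min a b) t; pose s := t - c / 2.
    have c0 : 0 < c by rewrite !lt_min a0 b0; case/andP: t01.
    have ca : c <= a by rewrite !ge_min lexx.
    have cb : c <= b by rewrite !ge_min lexx orbT.
    have ct : c <= t by rewrite !ge_min lexx orbT.
    have sI : s \in `[0, 1] by rewrite in_itv/= /s; lra.
    have := NP n Nn s sI.
    have := aP s (ltac:(rewrite /s; lra)); have := bP s (ltac:(rewrite /s; lra)).
    have := ler_distD (x n s) (left_value (x n) t) (left_value (x N) t).
    have := ler_distD (x N s) (x n s) (left_value (x N) t).
    rewrite (distrC (left_value (x n) t) (x n s)); lra.
  apply/cvg_ex; exists l; apply/cvgrPdist_le => e e0.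
  have [|N1 N1P] := fU (e / 3); first by rewrite divr_gt0.
  have [|N2 N2P] := lP (e / 3); first by rewrite divr_gt0.
  pose n := maxn N1 N2.
  have [|a a0 aP] := @cadlag_left _ _ (x n) t (e / 3) t01; first by rewrite divr_gt0.
  exists (Num.min a t) => /=; first by rewrite lt_min a0; case/andP: t01.
  move=> s; rewrite /= lt_min ltr_distlC => /andP[/andP[sa _]].
  rewrite ltr_distlC => /andP[s0 _] st.
  have sI : s \in `[0, 1] by rewrite in_itv/=; lra.
  have := N1P n (leq_maxl _ _) s sI; have := N2P n (leq_maxr _ _).
  have := aP s; rewrite sa st => /(_ isT).
  have := ler_distD (left_value (x n) t) l (f s).
  have := ler_distD (x n s) (left_value (x n) t) (f s).
  rewrite (distrC l (left_value (x n) t)) (distrC (left_value (x n) t) (x n s)); lra.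
have fB : f \in @cadlag01_pred R E by exact/asboolP.
by exists (Cadlag01 fB).
Qed.

End UniformLimit.

Theorem corollary2p2 (R : realType) (d : measure_display)
    (T : measurableType d) (P : probability T R)
    (P_complete : measure_is_complete P)
    (E : completeNormedModType R) (E_separable : separable E)
    (X : nat -> {RV P >-> cadlag01 E}) (X_indep : independent_RVs X)
    (S : nat -> T -> cadlag01 E)
    (S_def : forall n w, S n w = \sum_(j < n) X j w)
    (Y : {RV P >-> cadlag01 E})
    (S_cvg : cvg_in_distribution P S Y)
    (Y_jump : ~ exists (t : R) (c : E), [/\ t \in `[0, 1], c != 0 &
        P [set w | jump (Y w) t = c] = 1%E]) :
  {ae P, forall w, exists s : cadlag01 E,
    {uniform `[0, 1]%classic, (fun n => S n w : R -> E) @ \oo --> (s : R -> E)}}.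
Proof.
have [q [qd qJ]] := @jump_free_right_dense _ _ _ P E E_separable Y.
(* The number [N] bounds both the index [k] and the number of dense times used, so a single
   increasing union exhausts all indices and all times. *)
pose D (c : R) m N := [set w | exists2 k, k \in index_iota m N.+1 &
  [set w | exists2 s, s \in [seq q i | i <- iota 0 N] & c < `|S k w s - S m w s|] w].
have mD c m N : measurable (D c m N).
  apply: measurable_exists_seq => k _.
  apply: (@measurable_exists_seq _ _ _ _ (fun s => [set w | c < `|S k w s - S m w s|])) => s _.
  apply: measurable_fun_gt; apply: vmeasurable_norm.
  by apply: vmeasurableB => //; exact: vmeasurable_partial_sum.
have ndD c m : nondecreasing_seq (D c m).
  move=> N N' NN'; apply/subsetPset => w [k kN [s /mapP[i]]].
  rewrite mem_iota add0n => /andP[_ iN] -> ?; exists k.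
    by move: kN; rewrite !mem_index_iota => /andP[-> kN] /=; exact: leq_trans NN'.
  exists (q i) => //; apply/mapP; exists i => //; rewrite mem_iota add0n /=.
  exact: leq_trans NN'.
have mUD c m : measurable (\bigcup_N D c m N) by exact: bigcup_measurable.
have /choice[m mP] : forall jl : nat * nat, exists m,
    pr P (\bigcup_N D (invS jl.1) m N) <= invS jl.2.
  move=> [j l]; have [m mP] := maximal_estimate E_separable X_indep S_def S_cvg Y_jump
    (invS_gt0 j) (invS_gt0 l).
  exists m; apply: pr_nondecreasing_le => // N.
  have [mN|Nm] := leqP m N.
    by apply: mP => // s /mapP[i _ ->]; exact: qJ.
  rewrite (_ : D _ _ _ = set0) ?pr0 ?ltW ?invS_gt0//.
  apply/seteqP; split => // w [k]; rewrite mem_index_iota => /andP[mk kN].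
  by have := leq_ltn_trans mk kN; rewrite ltnS leqNgt Nm.
(* Outside [B j] the path satisfies the uniform Cauchy condition of order [invS j] from some start
   [m (j, l)]; [B j] is null since its probability is at most [invS l] for every [l]. *)
pose B j := \bigcap_l \bigcup_N D (invS j) (m (j, l)) N.
have mB j : measurable (B j) by apply: bigcap_measurableType => l _; exact: mUD.
have B0 j : pr P (B j) = 0.
  apply/le_anti; rewrite pr_ge0 andbT leNgt; apply/negP => /invS_lt[l].
  apply/negP; rewrite -leNgt; apply: le_trans (mP (j, l)).
  by apply: le_pr => // w; exact.
exists (\bigcup_j B j); split.
- exact: bigcup_measurable.
- by rewrite prE ?pr_bigcup_eq0//; exact: bigcup_measurable.
move=> w /= noS; apply: contrapT => nB; apply: noS.
have [e e0|y yP] := @uniform_limit_cadlag R E (fun n => S n w).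
  have [j je] := invS_lt (ltac:(lra) : 0 < e / 3).
  have /existsNP[l /= lB] : ~ forall l, (\bigcup_N D (invS j) (m (j, l)) N) w.
    by move=> H; apply: nB; exists j => // l _; exact: H.
  exists (m (j, l)) => n mn s sI.
  have qn i : `|S n w (q i) - S (m (j, l)) w (q i)| <= invS j.
    (* This is large enough to include both the index [n] and the point [q i]. *)
    rewrite leNgt; apply/negP => ji; apply: lB; exists (maxn n i.+1) => //.
    exists n; first by rewrite mem_index_iota mn ltnS leq_maxl.
    exists (q i) => //; apply/map_f; rewrite mem_iota add0n /=.
    by rewrite leq_maxr.
  have [||i [_ qi]] := @right_dense_approx _ _ q (S n w - S (m (j, l)) w) s 1 (e / 3) qd sI.
  - by [].
  - by rewrite divr_gt0.
  have := qn i; have := ler_distD (S n w (q i) - S (m (j, l)) w (q i))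
    (S n w s - S (m (j, l)) w s) 0.
  rewrite !subr0 (distrC (S n w s - _)); move: qi => /=; lra.
exists y => U /uniform_nbhs[V [+ VU]]; rewrite -entourage_ballE => -[e /= e0 eV].
have [|N NP] := yP (e / 2); first by rewrite divr_gt0.
exists N => // n /= Nn; apply: VU => s sI; apply: eV => /=.
rewrite -ball_normE /= distrC; apply: le_lt_trans (NP n Nn s sI) _; lra.
Qed.
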